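(* Let $k\ge0$ be an integer, let the CFL ratio $\lambda=\Delta t/h>0$ be fixed, and let $\Omega=\mathbb R\setminus[-1,1]$. Assume: (A1) $\max_\xi\sigma_{ph}(\xi)<\frac{4}{(\Delta t)^2}$; (A2) $\max_\xi\sigma_{sp,i}(\xi)\le\frac{4}{(\Delta t)^2}$ for $i=1,\dots,k$; (A3) $h$ is sufficiently small that $\xi_c+h^{-\gamma}<\frac{\pi}{h}$ (with $\xi_c$, $\gamma\in(0,1)$ the wave packet parameters described in the context). Then for any fixed $T>0$ and any arbitrarily small $\varepsilon>0$ (in particular $\varepsilon\in(0,1)$), uniform observability fails for the fully discrete $P^k$-LDG scheme, with $C_T$ growing exponentially as $h\to0$: there exist a Gevrey index $s>1$ and positive constants $C_{1,3}(k,T,s)$ and $C_4(k,\lambda,s)$, independent of $h$, such that, for all sufficiently small $h$, every constant $C_T$ for which $$\mathcal E_h^0\le C_T\,\Delta t\sum_{n=0}^{N-1}\mathcal E_{h,\Omega}^n,\qquad N\Delta t=T,$$ holds for all solutions of the scheme satisfies $$C_T\ge C_{1,3}(k,T,s)\exp\Big(\frac{C_4(k,\lambda,s)}{h^{1-\varepsilon}}\Big).$$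
   Context: Mesh: $h>0$, $x_j=jh$, $x_{j+1/2}=(j+\tfrac12)h$, $I_j=(x_{j-1/2},x_{j+1/2})$, $j\in\mathbb Z$. $V_h^k=\{v\in L^2(\mathbb R): v|_{I_j}\in P^k(I_j)\ \forall j\}$, with $P^k(I_j)$ the polynomials of degree at most $k$. On $I_j$ a function $u_h\in V_h^k$ is written in the monomial basis $\phi_{j,l}(x)=\big(\tfrac{x-x_j}{h/2}\big)^l$, $l=0,\dots,k$, with coefficient vector $\bm u_j\in\mathbb C^{k+1}$; $\bm U=\{\bm u_j\}_{j}\in\ell^2(\mathbb Z;\mathbb C^{k+1})$. Superscripts $\pm$ denote right/left limits at interfaces. LDG matrices (alternating fluxes): given $u_h$, $q_h\in V_h^k$ is defined by $$\int_{I_j} q_h v\,dx=-\int_{I_j}u_hv_x\,dx+(u_h)^-_{j+1/2}v^-_{j+1/2}-(u_h)^-_{j-1/2}v^+_{j-1/2}\quad\forall v\in P^k(I_j),\ j\in\mathbb Z.$$ $\bm M^h=\big(\int_{I_j}\phi_{j,l}\phi_{j,m}\,dx\big)_{l,m=0}^k$, and the real blocks $\bm K^h_{-1},\bm K^h_0,\bm K^h_{+1}$ are defined by $$\big(\bm K^h_{-1}\bm u_{j-1}+\bm K^h_0\bm u_j+\bm K^h_{+1}\bm u_{j+1}\big)_l=\int_{I_j}q_h(\phi_{j,l})_x\,dx-(q_h)^+_{j+1/2}(\phi_{j,l})^-_{j+1/2}+(q_h)^+_{j-1/2}(\phi_{j,l})^+_{j-1/2}.$$ $\mathbb M^h$ is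 block-diagonal with blocks $\bm M^h$, and $(\mathbb K^h\bm U)_j=\bm K^h_{-1}\bm u_{j-1}+\bm K^h_0\bm u_j+\bm K^h_{+1}\bm u_{j+1}$. Scheme: with time step $\Delta t$, $t_n=n\Delta t$, a solution is a sequence $\bm U^n\in\ell^2(\mathbb Z;\mathbb C^{k+1})$, $n\ge0$, with $\mathbb M^h\frac{\bm U^{n+1}-2\bm U^n+\bm U^{n-1}}{(\Delta t)^2}+\mathbb K^h\bm U^n=0$, $n\ge1$. Energies: $\langle\bm U,\bm V\rangle=\sum_j\bm u_j\cdot\overline{\bm v_j}$, $\langle\bm U,\bm V\rangle_\Omega=\sum_{j:\,x_j\in\Omega}\bm u_j\cdot\overline{\bm v_j}$, $\|\bm U\|_{\bm S}^2=\langle\bm U,\bm S\bm U\rangle$, $\|\bm U\|^2_{\bm S,\Omega}=\langle\bm U,\bm S\bm U\rangle_\Omega$ (real part understood) for $\bm S\in\{\mathbb M^h,\mathbb K^h\}$, and $$\mathcal E_h^n=\tfrac12\Big\|\tfrac{\bm U^{n+1}-\bm U^n}{\Delta t}\Big\|^2_{\mathbb M^h}+\tfrac14\|\bm U^{n+1}\|^2_{\mathbb K^h}+\tfrac14\|\bm U^n\|^2_{\mathbb K^h}-\tfrac{(\Delta t)^2}{4}\Big\|\tfrac{\bm U^{n+1}-\bm U^n}{\Delta t}\Big\|^2_{\mathbb K^h};$$ $\mathcal E_{h,\Omega}^n$ is the same expression with all norms replaced by their $\Omega$-restricted versions. The scheme is uniformly observable (on $\Omega$ in time $T$) if the observability inequality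 holds for all solutions with some $C_T>0$ independent of $h$ and $\Delta t$. Modes: $\mathcal K^h(\xi)=\bm K^h_0+\bm K^h_{-1}e^{-\sqrt{-1}\,\xi h}+\bm K^h_{+1}e^{\sqrt{-1}\,\xi h}$, $\xi\in\Pi_h=[-\frac\pi h,\frac\pi h]$. The problem $(\mathcal K^h(\xi)-\sigma\bm M^h)\bm v=\bm0$ has $k+1$ real-analytic $\bm M^h$-orthonormal eigenpairs; $(\sigma_{ph},\bm v_{ph})$ is the unique branch with $\sigma_{ph}(0)=0$, and $(\sigma_{sp,i},\bm v_{sp,i})$, $i=1,\dots,k$, are the others. Wave packet parameters: $\gamma\in(0,1)$ is a freely chosen constant; $\xi_c=\xi_c(h)\in(0,\frac{\pi}{h})$ is a frequency near $\frac{\pi}{h}$ (i.e. $h\xi_c\to\pi$ as $h\to0$); $s>1$ is the index of the Gevrey class $G^s$ of a cut-off $\psi\in C_c^\infty([-1,1])\cap G^s$ used to build highly localized initial data $\psi((\xi-\xi_c)/\rho)$, $\rho=h^{-\gamma}$, in frequency space. *)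

(* Defs.v *)
(* MathComp-Analysis, with R[i] from mathcomp-real-closed. *)
From HB Require Import structures.
From mathcomp Require Import all_boot all_order all_algebra.
From mathcomp Require Import complex.
From mathcomp Require Import all_classical all_reals all_analysis.

Set Implicit Arguments.
Unset Strict Implicit.
Unset Printing Implicit Defensive.

Import Order.TTheory GRing.Theory Num.Theory.
Import numFieldNormedType.Exports.

Local Open Scope classical_set_scope.
Local Open Scope ring_scope.
Local Open Scope complex_scope.

Section Mesh.
Variables (R : realType) (k : nat) (h : R).

Definition center (j : int) : R := j%:~R * h.

(* x_{j+1/2}; in particular x_{j-1/2} is [face (j - 1)]. *)
Definition face (j : int) : R := (j%:~R + 2^-1) * h.

Definition cell (j : int) : set R := `]face (j - 1), face j[.

Definition phi (j : int) (l : nat) : {poly R} :=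
  ((h / 2)^-1 *: ('X - (center j)%:P)) ^+ l.

(* An element of V_h^k is given by its coefficient vectors in the bases
   (phi j l)_(l <= k); [bpoly u j] is the polynomial it equals on the cell j. *)
Definition bpoly (u : int -> 'cV[R]_k.+1) (j : int) : {poly R} :=
  \sum_(l < k.+1) u j l 0 *: phi j l.

(* Left and right limits at x_{j+1/2}: the values there of the polynomials of
   the cells j and j + 1. *)
Definition trace_minus (u : int -> 'cV[R]_k.+1) (j : int) : R :=
  (bpoly u j).[face j].
Definition trace_plus (u : int -> 'cV[R]_k.+1) (j : int) : R :=
  (bpoly u (j + 1)).[face j].

Definition cell_integral (j : int) (p : {poly R}) : R :=
  \int[lebesgue_measure]_(x in cell j) p.[x].

(* The integrals do not depend on the cell; we use the cell 0. *)
Definition mass : 'M[R]_k.+1 :=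
  \matrix_(l, m) cell_integral 0 (phi 0 l * phi 0 m).

Definition ldg_gradient (u q : int -> 'cV[R]_k.+1) : Prop :=
  forall (j : int) (v : {poly R}), (size v <= k.+1)%N ->
    cell_integral j (bpoly q j * v) =
      - cell_integral j (bpoly u j * v^`())
      + trace_minus u j * v.[face j]
      - trace_minus u (j - 1) * v.[face (j - 1)].

Record stencil := Stencil {
  Kminus : 'M[R]_k.+1;
  Kzero : 'M[R]_k.+1;
  Kplus : 'M[R]_k.+1 }.

(* The blocks are real, so testing the defining identity on real coefficients
   suffices; square-summability of u and q plays no role in this local
   identity. *)
Definition ldg_stencil (K : stencil) : Prop :=
  forall u q : int -> 'cV[R]_k.+1, ldg_gradient u q ->
  forall (j : int) (l : 'I_k.+1),
    (Kminus K *m u (j - 1) + Kzero K *m u j + Kplus K *m u (j + 1)) l 0 =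
      cell_integral j (bpoly q j * (phi j l)^`())
      - trace_plus q j * (phi j l).[face j]
      + trace_plus q (j - 1) * (phi j l).[face (j - 1)].

End Mesh.

Section Complexified.
Variables (R : realType) (k : nat).

Definition toC (A : 'M[R]_k.+1) : 'M[R[i]]_k.+1 := map_mx (real_complex R) A.

(* u . conj(v) *)
Definition hdot (u v : 'cV[R[i]]_k.+1) : R[i] := \sum_l u l 0 * conjc (v l 0).

Definition ell2 (U : int -> 'cV[R[i]]_k.+1) : Prop :=
  summable [set: int] (fun j => (complex.Re (hdot (U j) (U j)))%:E).

Definition mass_op (h : R) (U : int -> 'cV[R[i]]_k.+1) (j : int) :
    'cV[R[i]]_k.+1 :=
  toC (mass k h) *m U j.

Definition stiff_op (K : stencil R k) (U : int -> 'cV[R[i]]_k.+1) (j : int) :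
    'cV[R[i]]_k.+1 :=
  toC (Kminus K) *m U (j - 1) + toC (Kzero K) *m U j
  + toC (Kplus K) *m U (j + 1).

(* Sum of a real family over a set of integers; meaningful for absolutely
   summable families, the only ones it is applied to. *)
Definition zsum (A : set int) (f : int -> R) : R :=
  fine (esum A (EFin \o f)^\+ - esum A (EFin \o f)^\-)%E.

(* ||U||^2_{S,Omega}, real part taken, for an operator S on sequences. *)
Definition sqnorm (h : R)
    (S : (int -> 'cV[R[i]]_k.+1) -> (int -> 'cV[R[i]]_k.+1))
    (Omega : set R) (U : int -> 'cV[R[i]]_k.+1) : R :=
  zsum [set j | Omega (center h j)]
       (fun j => complex.Re (hdot (U j) (S U j))).

Definition scheme_solution (h dt : R) (K : stencil R k)
    (U : nat -> int -> 'cV[R[i]]_k.+1) : Prop :=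
  (forall n, ell2 (U n)) /\
  forall (n : nat) (j : int),
    mass_op h (fun i => (dt ^- 2)%:C *:
                 (U n.+2 i - 2%:R *: U n.+1 i + U n i)) j
    + stiff_op K (U n.+1) j = 0.

Definition velocity (dt : R) (U : nat -> int -> 'cV[R[i]]_k.+1) (n : nat)
    (j : int) : 'cV[R[i]]_k.+1 :=
  (dt^-1)%:C *: (U n.+1 j - U n j).

(* E_{h,Omega}^n; the total energy E_h^n is the case Omega = setT. *)
Definition energy (h dt : R) (K : stencil R k) (Omega : set R)
    (U : nat -> int -> 'cV[R[i]]_k.+1) (n : nat) : R :=
  2^-1 * sqnorm h (mass_op h) Omega (velocity dt U n)
  + 4^-1 * sqnorm h (stiff_op K) Omega (U n.+1)
  + 4^-1 * sqnorm h (stiff_op K) Omega (U n)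
  - dt ^+ 2 / 4 * sqnorm h (stiff_op K) Omega (velocity dt U n).

Definition observable (h dt : R) (K : stencil R k) (Omega : set R) (N : nat)
    (C : R) : Prop :=
  forall U : nat -> int -> 'cV[R[i]]_k.+1, scheme_solution h dt K U ->
    energy h dt K setT U 0 <=
      C * (dt * \sum_(0 <= n < N) energy h dt K Omega U n).

(* One constant serves all sufficiently small meshes with N dt = T,
   dt = lambda h. *)
Definition uniformly_observable (lambda : R) (K : R -> stencil R k)
    (Omega : set R) (T : R) : Prop :=
  exists C : R, 0 < C /\
    \forall h \near 0^'+, forall N : nat, N%:R * (lambda * h) = T ->
      observable h (lambda * h) (K h) Omega N C.

Definition Pi_h (h : R) : set R := `[- (pi / h), pi / h].

Definition cis (t : R) : R[i] := cos t +i* sin t.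

Definition symbol (h : R) (K : stencil R k) (xi : R) : 'M[R[i]]_k.+1 :=
  toC (Kzero K) + cis (- (xi * h)) *: toC (Kminus K)
  + cis (xi * h) *: toC (Kplus K).

Definition real_analytic_on (D : set R) (f : R -> R) : Prop :=
  forall x0, D x0 -> exists (a : nat -> R) (r : R), 0 < r /\
    forall x, D x -> `|x - x0| < r -> pseries a (x - x0) @ \oo --> f x.

(* The k + 1 analytic eigenpairs; the index ord0 is the physical branch, the
   indices lift ord0 i (i < k) are the spurious ones. *)
Record eigen_branches (h : R) (K : stencil R k)
    (sigma : 'I_k.+1 -> R -> R) (v : 'I_k.+1 -> R -> 'cV[R[i]]_k.+1) : Prop := {
  branch_analytic : forall p, real_analytic_on (Pi_h h) (sigma p);
  branch_vec_analytic : forall p l,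
    real_analytic_on (Pi_h h) (fun xi => complex.Re (v p xi l 0)) /\
    real_analytic_on (Pi_h h) (fun xi => complex.Im (v p xi l 0));
  branch_eigen : forall p xi, Pi_h h xi ->
    (symbol h K xi - (sigma p xi)%:C *: toC (mass k h)) *m v p xi = 0;
  branch_orthonormal : forall p q xi, Pi_h h xi ->
    hdot (v p xi) (toC (mass k h) *m v q xi) = (p == q)%:R;
  branch_physical : forall p, sigma p 0 = 0 <-> p = ord0 }.

End Complexified.

(* Main.v *)
Require Import Defs.
From mathcomp Require Import all_boot all_order all_algebra.
From mathcomp Require Import complex.
From mathcomp Require Import all_classical all_reals all_analysis.
From mathcomp Require Import measurable_realfun ring lra zify.

Set Implicit Arguments.
Unset Strict Implicit.
Unset Printing Implicit Defensive.

Import Order.TTheory GRing.Theory Num.Theory.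
Import numFieldNormedType.Exports.

Local Open Scope classical_set_scope.
Local Open Scope ring_scope.

(** Some wave packets of the scheme hardly move, and they can be localized well
    enough to hide from an observer outside [[-1, 1]].

    Rescaling the mesh turns the scheme into the leapfrog recursion
    [U^(n+2) - 2 U^(n+1) + U^n = - L U^(n+1)], where [L] is a fixed
    block-tridiagonal Toeplitz operator on sequences over the integers. With
    [J = 1 / h], the observed cells are those with [|j| > J], and the number of
    steps is proportional to [J]. It suffices to find solutions whose part in
    [|j| > J - 1] is exponentially small in [J]. The resulting lower bound
    [exp (c / h) / poly (1 / h)] beats [exp (h ^ (eps - 1))] for small [h], so that
    both constants can be taken equal to 1.

    The packet lives at the Nyquist frequency [xi = pi]. There all eigenvalues
    of the symbol are simple ([nyquist_simple], [nyq_distinct]), so the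
    eigenvectors are multiples of real ones, the first-order variation of each
    eigenvalue vanishes and the bands are flat: the spectrum at [xi] stays
    within [O(1 + cos xi)] of the one at [pi] ([band_flat]). The physical
    eigenvalue at [pi], called [z] below, is moreover interior to the stability
    interval, by the strict CFL condition on the physical branch.

    The initial velocity is [W(L) ^ (2 D) T_m(e - C)] applied to the physical
    eigenvector put on a single cell. [T_m(e - C)] is a Dolph-Chebyshev filter
    in the average [C] of the two shifts; it confines the frequencies to a window
    around [pi] ([chebyshev_filter]). [W] is the polynomial vanishing at the
    other eigenvalues at [pi]. All sequences are finitely supported.

    The solution is [U^n = f_n(L) U^1] with [f_n] a Chebyshev polynomial of the
    second kind. Replacing [f_n] by its Taylor polynomial [p] of degree less than
    [D] at [z] does not change [U^n] beyond the range of [p(L)], so that far away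
    [U^n] is [(f_n - p)(L) U^1], whose size is read off on the real spectrum of
    [L] by a discrete Parseval identity. The Taylor remainder is small because
    the window and the flatness keep the spectrum close to [z]
    ([leapfrog_taylorP]). The parameters are balanced in [packet_parameters], and
    the outcome is [lattice_packet].

    The restricted energies have no sign. A packet released far from [[-1, 1]],
    which is seen in full, first shows that the observability constant is
    positive ([observable_gt0]); the hidden packet then gives the bound
    ([exponential_observability_cost]). *)

(** * Leapfrog and Chebyshev recurrences *)

Fixpoint rec_seq (A : pzRingType) (s a b : A) (n : nat) : A :=
  if n is m.+1 then rec_seq s b (s * b - a) m else a.

Lemma rec_seqSS (A : pzRingType) (s a b : A) n :
  rec_seq s a b n.+2 = s * rec_seq s a b n.+1 - rec_seq s a b n.
Proof. by elim: n a b => [//|n IHn] a b; exact: IHn. Qed.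

Lemma nat_ind2 (P : nat -> Prop) :
  P 0%N -> P 1%N -> (forall n, P n -> P n.+1 -> P n.+2) -> forall n, P n.
Proof.
by move=> P0 P1 PS n; suff [] : P n /\ P n.+1 by []; elim: n => [|n [? ?]]; split; auto.
Qed.

Section Scalar.
Variable R : realType.

(** The leapfrog solution of [u_(n+2) - 2 u_(n+1) + u_n = - x u_(n+1)] started
    from [0, 1]; with [x = 2 - 2 cos t] it is [sin (n t) / sin t]. *)
Definition leapfrog (x : R) (n : nat) : R := rec_seq (2 - x) 0 1 n.
(** Chebyshev polynomials of the first kind. *)
Definition chebyT (y : R) (n : nat) : R := rec_seq (2 * y) 1 y n.

Lemma chebyT_cos (t : R) n : chebyT (cos t) n = cos (n%:R * t).
Proof.
rewrite /chebyT; elim/nat_ind2: n => [||n IH1 IH2].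
- by rewrite mul0r cos0.
- by rewrite mul1r.
rewrite rec_seqSS IH1 IH2.
have -> : n.+2%:R * t = n.+1%:R * t + t by rewrite -[in LHS]natr1 mulrDl mul1r.
have -> : n%:R * t = n.+1%:R * t - t by rewrite -[in RHS]natr1 mulrDl mul1r addrK.
rewrite cosB cosD; ring.
Qed.

Lemma leapfrog_sin (t : R) n : leapfrog (2 - 2 * cos t) n * sin t = sin (n%:R * t).
Proof.
rewrite /leapfrog; have -> : 2 - (2 - 2 * cos t) = 2 * cos t by ring.
elim/nat_ind2: n => [||n IH1 IH2].
- by rewrite !mul0r sin0.
- by rewrite !mul1r.
rewrite rec_seqSS mulrBl -mulrA IH1 IH2.
have -> : n.+2%:R * t = n.+1%:R * t + t by rewrite -[in LHS]natr1 mulrDl mul1r.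
have -> : n%:R * t = n.+1%:R * t - t by rewrite -[in RHS]natr1 mulrDl mul1r addrK.
rewrite sinB sinD; ring.
Qed.

Lemma chebyT_le1 (y : R) n : -1 <= y <= 1 -> `|chebyT y n| <= 1.
Proof.
move=> y1; rewrite -(@acosK _ y) ?in_itv//= chebyT_cos ler_norml.
by rewrite cos_geN1 cos_le1.
Qed.

Lemma leapfrog_chebyT (x : R) n :
  leapfrog x n.+1 = (1 - x / 2) * leapfrog x n + chebyT (1 - x / 2) n.
Proof.
rewrite /leapfrog /chebyT; have -> : 2 * (1 - x / 2) = 2 - x by field.
elim/nat_ind2: n => [||n IH1 IH2]; [by rewrite /=; ring|by rewrite /=; field|].
move: IH1 IH2; rewrite !(rec_seqSS _ _ _ n.+1) !(rec_seqSS _ _ _ n).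
move: (rec_seq _ 1 _ n) (rec_seq _ 1 _ n.+1) => t t' IH1 IH2.
have -> : t = rec_seq (2 - x) 0 1 n.+1 - (1 - x / 2) * rec_seq (2 - x) 0 1 n.
  by rewrite IH1 addrC addKr.
have -> : t' = (2 - x) * rec_seq (2 - x) 0 1 n.+1 - rec_seq (2 - x) 0 1 n
    - (1 - x / 2) * rec_seq (2 - x) 0 1 n.+1 by rewrite IH2 addrC addKr.
ring.
Qed.

(** The factor [n] is attained at the ends of the band, where the two
    characteristic roots collide. *)
Lemma leapfrog_le (x : R) n : 0 <= x <= 4 -> `|leapfrog x n| <= n%:R.
Proof.
move=> x04; elim: n => [|n IHn]; first by rewrite /leapfrog /= normr0.
have c1 : -1 <= 1 - x / 2 <= 1 by apply/andP; split; lra.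
rewrite leapfrog_chebyT -[leRHS]natr1 (le_trans (ler_normD _ _))// lerD ?chebyT_le1// normrM.
by rewrite (le_trans _ IHn)// ler_piMl// ler_norml.
Qed.

(** Strictly inside the stability interval there is no secular growth. *)
Lemma leapfrog_bounded (x : R) : 0 < x < 4 ->
  exists2 G : R, 0 < G & forall n, `|leapfrog x n| <= G.
Proof.
move=> x04; pose c := 1 - x / 2.
have c1 : -1 <= c <= 1 by rewrite /c; apply/andP; split; lra.
have s0 : 0 < sin (acos c) by rewrite sin_acos// sqrtr_gt0 /c; nra.
exists (sin (acos c))^-1 => [|n]; first by rewrite invr_gt0.
have xE : x = 2 - 2 * cos (acos c) by rewrite acosK ?in_itv//= /c; field.
rewrite -[leRHS]mul1r ler_pdivlMr// -[X in _ * X]ger0_norm ?(ltW s0)// -normrM.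
by rewrite {1}xE leapfrog_sin ler_norml sin_geN1 sin_le1.
Qed.

(** Duhamel formula: the recursion at [x] is the one at [z] with the source
    [- (x - z) u]. *)
Lemma leapfrog_duhamel (z x : R) n :
  leapfrog x n = leapfrog z n - (x - z) * \sum_(l < n) leapfrog z (n - l) * leapfrog x l.
Proof.
pose S n := \sum_(l < n) leapfrog z (n - l) * leapfrog x l.
have SE m : S m.+2 = leapfrog x m.+1 + (2 - z) * S m.+1 - S m.
  rewrite /S; cbv beta; rewrite big_ord_recr big_ord_recr.
  rewrite [in X in _ + _ * X - _]big_ord_recr /=.
  rewrite subSnn -addn2 addKn.
  have -> : \sum_(i < m) leapfrog z (m + 2 - i) * leapfrog x i =
      (2 - z) * \sum_(i < m) leapfrog z (m.+1 - i) * leapfrog x i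
      - \sum_(i < m) leapfrog z (m - i) * leapfrog x i.
    rewrite mulr_sumr -sumrB; apply: eq_bigr => i _.
    have -> : (m + 2 - i = (m - i).+2)%N by have := ltn_ord i; lia.
    have -> : (m.+1 - i = (m - i).+1)%N by have := ltn_ord i; lia.
    by rewrite {1}/leapfrog rec_seqSS -/(leapfrog _ _) -/(leapfrog _ _); ring.
  have -> : (m.+1 - m = 1)%N by lia.
  have -> : leapfrog z 2 = 2 - z by rewrite /leapfrog/=; ring.
  have -> : leapfrog z 1 = 1 by [].
  by ring.
rewrite -/(S n); elim/nat_ind2: n => [||n IH1 IH2].
- by rewrite [S 0%N]big_ord0 /leapfrog/=; ring.
- by rewrite [S 1%N]big_ord_recl big_ord0 /leapfrog/=; ring.
have leapfrogSS y : leapfrog y n.+2 = (2 - y) * leapfrog y n.+1 - leapfrog y n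
  by rewrite /leapfrog rec_seqSS.
rewrite SE !leapfrogSS.
move: IH1 IH2; set a := leapfrog x n; set b := leapfrog x n.+1 => IH1 IH2.
have -> : leapfrog z n = a + (x - z) * S n by rewrite IH1; ring.
have -> : leapfrog z n.+1 = b + (x - z) * S n.+1 by rewrite IH2; ring.
ring.
Qed.

(** Taylor polynomial at [z] in [x], of degree less than [d], obtained by
    iterating [leapfrog_duhamel]. *)
Fixpoint leapfrog_taylor (z : R) (d n : nat) : {poly R} :=
  if d is e.+1 then
    (leapfrog z n)%:P - ('X - z%:P) * \sum_(l < n) leapfrog z (n - l) *: leapfrog_taylor z e l
  else 0.

Lemma size_leapfrog_taylor z d n : (size (leapfrog_taylor z d n) <= d)%N.
Proof.
elim: d n => [|d IHd] n /=; first by rewrite size_poly0.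
rewrite (leq_trans (size_polyD _ _))// geq_max size_polyN.
rewrite (leq_trans (size_polyC_leq1 _))//=.
rewrite (leq_trans (size_polyMleq _ _))// size_XsubC /=.
apply: (@leq_trans d.+1) => //; rewrite ltnS.
rewrite (leq_trans (size_sum _ _ _))//; apply/bigmax_leqP => i _.
by rewrite (leq_trans (size_scale_leq _ _)).
Qed.

Lemma sum_bin d n : (\sum_(l < n) 'C(l, d) = 'C(n, d.+1))%N.
Proof.
elim: n => [|n IHn]; first by rewrite big_ord0 bin0n.
by rewrite big_ord_recr /= IHn binS.
Qed.

(** The remainder is a [d]-fold time convolution of bounded kernels, whence the
    binomial coefficient; the last factor [n] bounds the solution at [x], which
    may lie at an end of the stability interval. *)
Lemma leapfrog_taylorP (z G x : R) d n :
  0 <= x <= 4 -> (forall m, `|leapfrog z m| <= G) ->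
  `|leapfrog x n - (leapfrog_taylor z d n).[x]| <=
     n%:R * 'C(n, d)%:R * (G * `|x - z|) ^+ d.
Proof.
move=> x04 hG; have G0 : 0 <= G by rewrite (le_trans _ (hG 0%N)).
elim: d n => [|d IHd] n.
  by rewrite /= horner0 subr0 bin0 expr0 !mulr1 leapfrog_le.
rewrite [leapfrog_taylor _ _ _]/= !hornerE horner_sum (leapfrog_duhamel z).
rewrite opprD opprK addrACA subrr add0r addrC -mulrBr -sumrB normrM.
have -> : n%:R * 'C(n, d.+1)%:R * (G * `|x - z|) ^+ d.+1 =
   `|x - z| * (\sum_(l < n) G * (n%:R * 'C(l, d)%:R * (G * `|x - z|) ^+ d)).
  by rewrite -mulr_sumr -mulr_suml -mulr_sumr -natr_sum sum_bin exprS; ring.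
apply: ler_wpM2l => //; rewrite (le_trans (ler_norm_sum _ _ _))//.
apply: ler_sum => i _; rewrite hornerZ -mulrBr normrM ler_pM//.
rewrite distrC (le_trans (IHd i))// ler_wpM2r ?exprn_ge0 ?mulr_ge0// ler_wpM2r//.
by rewrite ler_nat ltnW.
Qed.

Lemma chebyT_ge1 (y : R) n : 1 <= y -> 1 <= chebyT y n <= chebyT y n.+1.
Proof.
move=> y1; elim: n => [|n /andP[IH1 IH2]]; first by rewrite /chebyT/= lexx.
apply/andP; split; first exact: le_trans IH2.
rewrite {2}/chebyT rec_seqSS -!/(chebyT _ _); nra.
Qed.

(** The increments are monotone too, which makes the induction go through. *)
Lemma chebyT_mono (x y : R) n : 1 <= y <= x ->
  0 <= chebyT x n - chebyT y n <= chebyT x n.+1 - chebyT y n.+1.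
Proof.
move=> /andP[y1 yx]; elim: n => [|n /andP[IH1 IH2]].
  by rewrite /chebyT/= subrr lexx subr_ge0.
apply/andP; split; first exact: le_trans IH2.
rewrite /chebyT !rec_seqSS -!/(chebyT _ _).
have /andP[h1 h2] := chebyT_ge1 n.+1 (le_trans y1 yx).
set a := chebyT x n in IH1 IH2 *; set b := chebyT y n in IH1 IH2 *.
set a' := chebyT x n.+1 in h1 IH1 IH2 *; set b' := chebyT y n.+1 in IH1 IH2 *.
have : 0 <= (x - y) * a' by rewrite mulr_ge0// ?subr_ge0// (le_trans ler01).
have : 0 <= (y - 1) * (a' - b') by rewrite mulr_ge0// subr_ge0// -subr_ge0 (le_trans IH1).
nra.
Qed.

Lemma chebyT_growth (r : R) n : 0 < r -> r ^+ n / 2 <= chebyT ((r + r^-1) / 2) n.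
Proof.
move=> r0.
have -> : chebyT ((r + r^-1) / 2) n = (r ^+ n + r^-1 ^+ n) / 2.
  rewrite /chebyT; elim/nat_ind2: n => [||n IH1 IH2].
  - by rewrite !expr0 /=; field.
  - by rewrite !expr1.
  rewrite rec_seqSS IH1 IH2 !exprS; field; exact: lt0r_neq0.
by rewrite ler_pM2r// lerDl exprn_ge0// invr_ge0 ltW.
Qed.

(** Dolph-Chebyshev filter in [c = cos xi], centred at [c = -1]: at distance
    [(r - 1) ^ 2], that is at distance [r - 1] in frequency, the damping is
    already [r ^ m], because the argument enters [[-1, 1]] there. *)
Lemma chebyshev_filter (r c : R) m : 1 < r -> -1 <= c <= 1 ->
  let e := (r + r^-1) / 2 - 1 in
  [/\ 0 < chebyT (1 + e) m, `|chebyT (e - c) m| <= chebyT (1 + e) m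
    & 1 + c <= (r - 1) ^+ 2 \/ `|chebyT (e - c) m| <= 2 * r ^- m * chebyT (1 + e) m].
Proof.
move=> r1 /andP[c1 c2] e.
have r0 : 0 < r by rewrite (lt_trans _ r1).
have re : e = (r - 1) ^+ 2 / (2 * r) by rewrite /e; field; exact: lt0r_neq0.
have e0 : 0 <= e by rewrite re divr_ge0 ?sqr_ge0// mulr_ge0// ltW.
have eE : 1 + e = (r + r^-1) / 2 by rewrite /e addrC subrK.
have h1 : 1 <= 1 + e by rewrite lerDl.
have /andP[T1 _] := chebyT_ge1 m h1.
have ele : e <= (r - 1) ^+ 2.
  by rewrite re ler_pdivrMr ?mulr_gt0// ler_peMr ?sqr_ge0//; lra.
split; first exact: lt_le_trans T1.
- have [h|h] := lerP (e - c) 1.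
    by rewrite (le_trans _ T1)// chebyT_le1// h andbT; lra.
  have hh : 1 <= e - c <= 1 + e by rewrite ltW//=; lra.
  have /andP[h2 _] := chebyT_mono m hh.
  have /andP[h3 _] := chebyT_ge1 m (ltW h).
  by rewrite ger0_norm ?(le_trans ler01 h3)// -subr_ge0.
- have [h|h] := lerP (1 + c) e; [left; exact: le_trans ele|right].
  apply: (@le_trans _ _ 1).
    by apply: chebyT_le1; apply/andP; split; lra.
  have := chebyT_growth m r0; rewrite -eE ler_pdivrMr// => h2.
  rewrite -mulrA mulrCA -ler_pdivrMl ?invr_gt0 ?exprn_gt0// invrK mulr1 mulrC.
  by [].
Qed.

End Scalar.

(** * Choice of the packet parameters *)

Lemma bin_le_pow2 n m : ('C(n, m) <= 2 ^ n)%N.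
Proof.
elim: n m => [|n IHn] [|m]; rewrite ?bin0 ?bin0n ?expn_gt0// binS expnS.
by have := IHn m; have := IHn m.+1; lia.
Qed.

Lemma ffact_le n m : (n ^_ m <= n ^ m)%N.
Proof.
elim: m => [//|m IHm]; rewrite ffactnSr expnSr leq_mul// leq_subr//.
Qed.

Lemma ffact_ge n m : (m <= n -> (n - m) ^ m <= n ^_ m)%N.
Proof.
elim: m n => [//|m IHm] [//|n] /= mn; rewrite ffactSS expnS leq_mul//.
  by rewrite leq_subLR; lia.
by rewrite (leq_trans _ (IHm n mn))// leq_exp2r//; case: (m) => //; lia.
Qed.

(** From [D ^ D <= 'C(2 D, D) D! <= 4 ^ D D!]. *)
Lemma bin_le_ratio n D : ('C(n, D) * D ^ D <= (4 * n) ^ D)%N.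
Proof.
have h : (D ^ D <= 4 ^ D * D`!)%N.
  have := @ffact_ge (D + D) D (leq_addr _ _); rewrite addnK => /leq_trans; apply.
  rewrite -bin_ffact leq_mul2r; apply/orP; right.
  by rewrite (leq_trans (bin_le_pow2 _ _))// addnn -mul2n expnM.
rewrite (leq_trans (leq_mul (leqnn _) h))// mulnCA bin_ffact expnMn.
by rewrite leq_mul// ffact_le.
Qed.

Section PacketBalance.
Variable R : realType.

Lemma bin_le_scaled (nu : R) n D : 0 <= nu -> (0 < D)%N -> n%:R <= nu * D%:R ->
  'C(n, D)%:R <= (4 * nu) ^+ D :> R.
Proof.
move=> nu0 D0 hn; have D0' : 0 < (D%:R : R) by rewrite ltr0n.
rewrite -(@ler_pM2r _ (D%:R ^+ D)) ?exprn_gt0// -exprMn.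
have := bin_le_ratio n D; rewrite -(ler_nat R) natrM !natrX natrM => /le_trans; apply.
by rewrite lerXn2r ?nnegrE ?mulr_ge0// -mulrA ler_wpM2l.
Qed.

(** The witness [c = 2 ^ p] turns the claim into [4 p + q <= 2 ^ p]. *)
Lemma pow2_beats_pow4 (K : R) : exists c : nat, [/\ (0 < c)%N, K <= c%:R
  & K * c%:R ^+ 4 <= 2 ^+ c].
Proof.
have [q Kq] : exists q : nat, K <= 2 ^+ q.
  exists (Num.bound `|K|); rewrite (le_trans (ler_norm K))//.
  have /ltW h := archi_boundP (normr_ge0 K).
  by rewrite (le_trans h)// -natrX ler_nat ltnW// ltn_expl.
exists (2 ^ (q + 5))%N; split.
- by rewrite expn_gt0.
- by rewrite (le_trans Kq)// -natrX ler_nat leq_exp2l// leq_addr.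
rewrite natrX -exprM (@le_trans _ _ (2 ^+ q * 2 ^+ ((q + 5) * 4)))//.
  by rewrite ler_wpM2r ?exprn_ge0.
rewrite -exprD ler_eXn2l ?ltr1n//.
have : (q < 2 ^ q)%N by rewrite ltn_expl.
by rewrite expnD; lia.
Qed.

Lemma bernoulli (d : R) n : 0 <= d -> 1 + n%:R * d <= (1 + d) ^+ n.
Proof.
move=> d0; elim: n => [|n IHn]; first by rewrite mul0r addr0 expr0.
rewrite exprS (le_trans _ (ler_wpM2l _ IHn)) ?addr_ge0//.
rewrite -natr1; have : 0 <= n%:R * d ^+ 2 by rewrite mulr_ge0// sqr_ge0.
nra.
Qed.

(** The alternative on [W] is the one given by [band_flat], with [c = cos xi]
    and [z] the band value at [pi]; the conclusion compares the packet at the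
    spectral value [x] with its peak.

    The filter has degree [b D] and a window of some width [d], with [r = 1 + d].
    Outside the window it gains a factor [exp (- d b D)], while inside it the
    phase accumulated in [n] steps is of order [b D d ^ 2]. With
    [d = b ^ (- 3 / 4)] the first quantity beats any power of [b], and the second
    one is a small multiple of [D]. *)
Lemma packet_parameters (G C0 w tau : R) (k : nat) :
  0 < G -> 0 <= C0 -> 0 < w -> 0 < tau ->
  exists (b : nat) (r : R), [/\ (0 < b)%N, 1 < r &
  forall (D n : nat) (x z W c : R), (0 < D)%N ->
  n%:R <= tau * (4 * (b + 2 * k + 2))%:R * D%:R ->
  0 <= x <= 4 -> 0 <= z <= 4 -> (forall m, `|leapfrog z m| <= G) ->
  -1 <= c <= 1 -> `|W| <= 4 ^+ k ->
  W ^+ 2 <= C0 * (1 + c) \/ `|W * (x - z)| <= C0 * (1 + c) ->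
  forall e, e = (r + r^-1) / 2 - 1 ->
  `|leapfrog x n - (leapfrog_taylor z D n).[x]| * `|W| ^+ (2 * D) * `|chebyT (e - c) (b * D)|
    <= n%:R * 2 * (w ^+ 2 / 2) ^+ D * chebyT (1 + e) (b * D)].
Proof.
move=> G0 C00 w0 tau0.
pose A1 := 16 * tau * G * (2 * k + 3)%:R.
have A10 : 0 < A1 by rewrite !mulr_gt0// ltr0n addn_gt0 orbT.
have w20 : 0 < w ^+ 2 by rewrite exprn_gt0.
pose K := 8 * 16 ^+ k * A1 * (1 + C0) / w ^+ 2.
have [c0 [c0gt0 Kc0 Kc04]] := pow2_beats_pow4 K.
have c0R : 1 <= (c0%:R : R) by rewrite ler1n.
have c0p : 0 < (c0%:R : R) by rewrite ltr0n.
exists (c0 ^ 4)%N, (1 + c0%:R ^- 3).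
have dgt0 : 0 < (c0%:R : R) ^- 3 by rewrite invr_gt0 exprn_gt0.
have bgt0 : (0 < c0 ^ 4)%N by rewrite expn_gt0 c0gt0.
split=> //; first by rewrite ltrDl.
set b := (c0 ^ 4)%N; set r := 1 + _.
move=> D n x z W c D0 hn x04 z04 hG c11 hW hWc e eE.
pose A := 16 * tau * (b + 2 * k + 2)%:R * G.
have A0 : 0 < A by rewrite !mulr_gt0// ltr0n addnS.
have AA1 : A <= A1 * c0%:R ^+ 4.
  rewrite /A /A1 -natrX -[leRHS]mulrA -natrM.
  have -> : 16 * tau * (b + 2 * k + 2)%:R * G = 16 * tau * G * (b + 2 * k + 2)%:R by ring.
  rewrite ler_wpM2l ?mulr_ge0 ?(ltW tau0) ?(ltW G0)// ler_nat -/b.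
  have -> : (2 * k + 3 = 1 + (2 * k + 2))%N by rewrite addnCA.
  by rewrite mulnDl mul1n -addnA leq_add2l leq_pmulr.
have h16 : 1 <= (16 : R) ^+ k by rewrite exprn_ege1// ler1n.
have h4 : 1 <= (4 : R) ^+ k by rewrite exprn_ege1// ler1n.
have h416 : (4 : R) ^+ k <= 16 ^+ k by rewrite lerXn2r ?nnegrE// ler_nat.
have Kw : 8 * 16 ^+ k * A1 * (1 + C0) = K * w ^+ 2 by rewrite /K divfK ?gt_eqF.
have hT : `|leapfrog x n - (leapfrog_taylor z D n).[x]| <= n%:R * (A * `|x - z|) ^+ D.
  rewrite (le_trans (leapfrog_taylorP D n x04 hG))// -mulrA ler_wpM2l//.
  have -> : A * `|x - z| = 4 * (tau * (4 * (b + 2 * k + 2))%:R) * (G * `|x - z|).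
    by rewrite /A natrM; ring.
  rewrite [leRHS]exprMn ler_wpM2r ?exprn_ge0 ?mulr_ge0 ?(ltW G0)//.
  by apply: bin_le_scaled => //; rewrite mulr_ge0// ltW.
have r1 : 1 < r by rewrite ltrDl.
have [T0 T1 T2] := @chebyshev_filter _ r c (b * D) r1 c11; rewrite -eE in T0 T1 T2.
have y4 : `|x - z| <= 4 by rewrite ler_norml; apply/andP; split; lra.
have nn0 : 0 <= (n%:R : R) by [].
have yW0 : 0 <= A * `|x - z| * `|W| ^+ 2.
  by apply: mulr_ge0; [apply: mulr_ge0 => //; exact: ltW|exact: sqr_ge0].
(* [rho] is the gain of the filter per unit of [D]. *)
have main rho : 0 <= rho -> A * `|x - z| * `|W| ^+ 2 * rho <= w ^+ 2 / 2 ->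
   `|chebyT (e - c) (b * D)| <= 2 * rho ^+ D * chebyT (1 + e) (b * D) ->
  `|leapfrog x n - (leapfrog_taylor z D n).[x]| * `|W| ^+ (2 * D) * `|chebyT (e - c) (b * D)|
    <= n%:R * 2 * (w ^+ 2 / 2) ^+ D * chebyT (1 + e) (b * D).
  move=> rho0 hZ hr.
  have p0 : 0 <= (A * `|x - z| * `|W| ^+ 2 * rho) ^+ D by rewrite exprn_ge0// mulr_ge0.
  apply: (@le_trans _ _ (n%:R * (A * `|x - z|) ^+ D * `|W| ^+ (2 * D) *
      (2 * rho ^+ D * chebyT (1 + e) (b * D)))).
    apply: ler_pM; [|by []| |exact: hr].
      by apply: mulr_ge0 => //; exact: exprn_ge0.
    by apply: ler_wpM2r => //; exact: exprn_ge0.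
  have -> : n%:R * (A * `|x - z|) ^+ D * `|W| ^+ (2 * D) * (2 * rho ^+ D * chebyT (1 + e) (b * D))
      = n%:R * 2 * (A * `|x - z| * `|W| ^+ 2 * rho) ^+ D * chebyT (1 + e) (b * D).
    by rewrite exprM !exprMn; ring.
  rewrite ler_wpM2r ?(ltW T0)// ler_wpM2l ?mulr_ge0//.
  by rewrite lerXn2r// nnegrE ?mulr_ge0 ?divr_ge0// ltW.
have c2 : (c0%:R : R) ^+ 4 * (c0%:R ^- 3) ^+ 2 = (c0%:R ^+ 2)^-1.
  by field; rewrite gt_eqF.
have cK : K / c0%:R ^+ 2 <= 1.
  rewrite ler_pdivrMr ?exprn_gt0// mul1r (le_trans Kc0)// expr2.
  by rewrite ler_peMr// ltW.
case: T2 => [hc|hfar].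
- have rE : r - 1 = c0%:R ^- 3 by rewrite /r addrC addKr.
  rewrite rE in hc.
  have c1p : 0 <= 1 + c by lra.
  have hAC : A * (C0 * (1 + c)) * (8 * 16 ^+ k) <= w ^+ 2.
    apply: (@le_trans _ _ (A1 * c0%:R ^+ 4 * ((1 + C0) * (c0%:R ^- 3) ^+ 2) * (8 * 16 ^+ k))).
      apply: ler_wpM2r; first by rewrite mulr_ge0// exprn_ge0.
      apply: ler_pM; [exact: ltW|exact: mulr_ge0|exact: AA1|].
      by apply: ler_pM => //; rewrite lerDr.
    have -> : A1 * c0%:R ^+ 4 * ((1 + C0) * (c0%:R ^- 3) ^+ 2) * (8 * 16 ^+ k) =
       (8 * 16 ^+ k * A1 * (1 + C0)) * (c0%:R ^+ 4 * (c0%:R ^- 3) ^+ 2) by ring.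
    by rewrite c2 Kw mulrAC ler_piMl// ltW.
  have hC1 : 0 <= C0 * (1 + c) by rewrite mulr_ge0.
  have hAC0 : 0 <= A * (C0 * (1 + c)) by rewrite mulr_ge0// ltW.
  (* Inside the window the filter gains nothing. *)
  apply: (main 1) => //; last by rewrite expr1n mulr1 mulr_natl mulr2n ler_wpDl// ltW.
  rewrite mulr1; case: hWc => [h|h].
  + apply: (@le_trans _ _ (A * 4 * (C0 * (1 + c)))).
      apply: ler_pM; [by apply: mulr_ge0 => //; exact: ltW|exact: sqr_ge0| |].
        by rewrite ler_wpM2l// ltW.
      by rewrite real_normK ?num_real.
    rewrite ler_pdivlMr// (le_trans _ hAC)//.
    have -> : A * 4 * (C0 * (1 + c)) * 2 = A * (C0 * (1 + c)) * 8 by ring.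
    by rewrite ler_wpM2l// ler_peMr.
  + apply: (@le_trans _ _ (A * (C0 * (1 + c)) * 4 ^+ k)).
      have -> : A * `|x - z| * `|W| ^+ 2 = A * `|W * (x - z)| * `|W| by rewrite normrM; ring.
      apply: ler_pM => //; first by apply: mulr_ge0 => //; exact: ltW.
      by rewrite ler_wpM2l// ltW.
    rewrite ler_pdivlMr// (le_trans _ hAC)// -[leLHS]mulrA ler_wpM2l//.
    by lra.
- have rb : 2 ^+ c0 <= r ^+ b.
    have -> : (b = c0 ^ 3 * c0)%N by rewrite /b -expnSr.
    rewrite exprM lerXn2r ?nnegrE ?exprn_ge0// ?(le_trans ler01 (ltW r1))//.
    rewrite (le_trans _ (bernoulli _ (ltW dgt0)))// natrX divff ?expf_neq0 ?gt_eqF//.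
  have rb0 : 0 < r ^+ b by rewrite exprn_gt0// (lt_trans _ r1).
  (* Outside, [r ^ b >= 2 ^ c0] beats the polynomial losses. *)
  apply: (main (r ^+ b)^-1); first by rewrite invr_ge0 ltW.
    rewrite ler_pdivrMr//.
    apply: (@le_trans _ _ (A * 4 * 16 ^+ k)).
      apply: ler_pM; [by apply: mulr_ge0 => //; exact: ltW|exact: sqr_ge0| |].
        by rewrite ler_wpM2l// ltW.
      have -> : (16 : R) ^+ k = (4 ^+ k) ^+ 2.
        by rewrite -exprM mulnC exprM; congr (_ ^+ _); ring.
      by rewrite lerXn2r ?nnegrE ?exprn_ge0.
    rewrite [leRHS]mulrAC ler_pdivlMr//.
    rewrite (@le_trans _ _ (w ^+ 2 * (K * c0%:R ^+ 4)))//; last first.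
      by rewrite ler_wpM2l ?(ltW w20)// (le_trans Kc04).
    have -> : w ^+ 2 * (K * c0%:R ^+ 4) = 8 * 16 ^+ k * (A1 * c0%:R ^+ 4) * (1 + C0).
      by rewrite mulrA [w ^+ 2 * K]mulrC -Kw; ring.
    have -> : A * 4 * 16 ^+ k * 2 = 8 * 16 ^+ k * A * 1 by ring.
    have p0 : 0 <= 8 * (16 : R) ^+ k by rewrite mulr_ge0// exprn_ge0.
    apply: ler_pM; [by rewrite mulr_ge0// ltW|by []| |by rewrite lerDl].
    by rewrite ler_wpM2l.
  by rewrite exprVn -exprM.
Qed.

End PacketBalance.

(** * Hermitian products and orthonormal bases *)

Section Complex.
Variable R : realType.
Local Notation C := R[i].
Local Open Scope complex_scope.

(** The squared modulus as a real number, the norm of [R[i]] being complex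
    valued. *)
Definition nsq (z : C) : R := complex.Re z ^+ 2 + complex.Im z ^+ 2.

Lemma nsq_ge0 z : 0 <= nsq z.
Proof. by rewrite addr_ge0 ?sqr_ge0. Qed.

Lemma nsqM x y : nsq (x * y) = nsq x * nsq y.
Proof. by case: x y => [a b] [c d]; rewrite /nsq /=; ring. Qed.

Lemma nsqR (x : R) : nsq x%:C = x ^+ 2.
Proof. by rewrite /nsq /= expr0n addr0. Qed.

Lemma nsq0 : nsq 0 = 0.
Proof. by rewrite /nsq /= expr0n addr0. Qed.

Lemma nsq_eq0 z : (nsq z == 0) = (z == 0).
Proof. by rewrite paddr_eq0 ?sqr_ge0// !sqrf_eq0 eq_complex. Qed.

Lemma nsqE z : z * conjc z = (nsq z)%:C.
Proof.
by case: z => a b; apply/eqP; rewrite eq_complex /nsq /=; apply/andP; split; apply/eqP; ring.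
Qed.

Lemma nsq_sum n (F : 'I_n -> C) : nsq (\sum_i F i) <= n%:R * \sum_i nsq (F i).
Proof.
have sq (f : 'I_n -> R) : (\sum_i f i) ^+ 2 <= n%:R * \sum_i f i ^+ 2.
  have : 0 <= \sum_i \sum_j (f i - f j) ^+ 2.
    by apply: sumr_ge0 => i _; apply: sumr_ge0 => j _; rewrite sqr_ge0.
  have -> : \sum_i \sum_j (f i - f j) ^+ 2 =
      2 * (n%:R * \sum_i f i ^+ 2) - 2 * (\sum_i f i) ^+ 2.
    have inner (i : 'I_n) : \sum_j (f i - f j) ^+ 2 =
        n%:R * f i ^+ 2 + - (2 * \sum_j f j) * f i + \sum_j f j ^+ 2.
      have -> : \sum_j (f i - f j) ^+ 2 =
          \sum_j (f i ^+ 2 + - (2 * f i) * f j + f j ^+ 2).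
        by apply: eq_bigr => j _; ring.
      by rewrite !big_split /= sumr_const card_ord -mulr_sumr -mulr_natl; ring.
    under eq_bigr => i _ do rewrite inner.
    by rewrite !big_split /= sumr_const card_ord -!mulr_sumr -mulr_natl; ring.
  by rewrite subr_ge0 ler_pM2l.
have ReS : complex.Re (\sum_i F i) = \sum_i complex.Re (F i) by rewrite raddf_sum.
have ImS : complex.Im (\sum_i F i) = \sum_i complex.Im (F i) by rewrite raddf_sum.
rewrite /nsq ReS ImS big_split mulrDr lerD//=; exact: sq.
Qed.

Lemma nsqD x y : nsq (x + y) <= 2 * (nsq x + nsq y).
Proof.
case: x y => [a b] [c d]; rewrite /nsq /=.
have := sqr_ge0 (a - c); have := sqr_ge0 (b - d); nra.
Qed.

Lemma Re_mulJ_le x y : complex.Re (x * conjc y) <= 2^-1 * (nsq x + nsq y).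
Proof.
case: x y => [a b] [c d]; rewrite /nsq /=.
have := sqr_ge0 (a - c); have := sqr_ge0 (b - d); nra.
Qed.

Lemma nsq_cis t : nsq (cis t : C) = 1.
Proof. by rewrite /nsq /= cos2Dsin2. Qed.

Lemma cisD s t : cis (s + t) = cis s * cis t :> C.
Proof.
by apply/eqP; rewrite eq_complex /= cosD sinD; apply/andP; split; apply/eqP; ring.
Qed.

Lemma cisJ t : conjc (cis t) = cis (- t) :> C.
Proof. by rewrite /cis /= cosN sinN. Qed.

Lemma cis0 : cis 0 = 1 :> C.
Proof. by rewrite /cis cos0 sin0. Qed.

Variable k : nat.
Implicit Types (u v w : 'cV[C]_k.+1) (A M : 'M[R]_k.+1).

Lemma hdotDl u v w : hdot (u + v) w = hdot u w + hdot v w.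
Proof. by rewrite /hdot -big_split; apply: eq_bigr => i _; rewrite mxE mulrDl. Qed.

Lemma hdotZl (a : C) u w : hdot (a *: u) w = a * hdot u w.
Proof. by rewrite /hdot mulr_sumr; apply: eq_bigr => i _; rewrite mxE mulrA. Qed.

Lemma hdotDr u v w : hdot w (u + v) = hdot w u + hdot w v.
Proof. by rewrite /hdot -big_split; apply: eq_bigr => i _; rewrite mxE rmorphD mulrDr. Qed.

Lemma hdotZr (a : C) u w : hdot w (a *: u) = conjc a * hdot w u.
Proof. by rewrite /hdot mulr_sumr; apply: eq_bigr => i _; rewrite mxE rmorphM mulrCA. Qed.

Lemma hdot0l u : hdot 0 u = 0.
Proof. by rewrite /hdot big1// => i _; rewrite mxE mul0r. Qed.

Lemma hdot0r u : hdot u 0 = 0.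
Proof. by rewrite /hdot big1// => i _; rewrite mxE rmorph0 mulr0. Qed.

Lemma hdotBl u v w : hdot (u - v) w = hdot u w - hdot v w.
Proof. by rewrite hdotDl -scaleN1r hdotZl mulN1r. Qed.

Lemma hdotBr u v w : hdot w (u - v) = hdot w u - hdot w v.
Proof. by rewrite hdotDr -scaleN1r hdotZr rmorphN rmorph1 mulN1r. Qed.

Lemma hdot_suml (I : finType) (F : I -> 'cV[C]_k.+1) w :
  hdot (\sum_i F i) w = \sum_i hdot (F i) w.
Proof.
apply: (big_ind2 (fun x y => hdot x w = y)); first exact: hdot0l.
  by move=> ? ? ? ? <- <-; rewrite hdotDl.
by [].
Qed.

Lemma hdot_sumr (I : finType) (F : I -> 'cV[C]_k.+1) w :
  hdot w (\sum_i F i) = \sum_i hdot w (F i).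
Proof.
apply: (big_ind2 (fun x y => hdot w x = y)); first exact: hdot0r.
  by move=> ? ? ? ? <- <-; rewrite hdotDr.
by [].
Qed.

Lemma hdotC u v : hdot v u = conjc (hdot u v).
Proof.
rewrite /hdot rmorph_sum; apply: eq_bigr => i _.
by rewrite rmorphM /= conjcK mulrC.
Qed.

Lemma hdot_toC A u v : hdot (toC A *m u) v = hdot u (toC A^T *m v).
Proof.
rewrite /hdot; under eq_bigr => i _ do rewrite mxE mulr_suml.
rewrite exchange_big; apply: eq_bigr => j _ /=.
rewrite mxE rmorph_sum mulr_sumr; apply: eq_bigr => i _.
rewrite !mxE rmorphM mulrA; congr (_ * _); rewrite mulrC; congr (_ * _).
exact: esym (conjc_real _).
Qed.

Lemma toCD A M : toC (A + M) = toC A + toC M.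
Proof. exact: map_mxD. Qed.

Lemma toCM A M : toC (A *m M) = toC A *m toC M.
Proof. exact: map_mxM. Qed.

Lemma toCZ (a : R) A : toC (a *: A) = a%:C *: toC A.
Proof. exact: map_mxZ. Qed.

Definition sq u : R := \sum_i nsq (u i 0).

Lemma sq_ge0 u : 0 <= sq u.
Proof. by apply: sumr_ge0 => i _; exact: nsq_ge0. Qed.

Lemma sq_eq0 u : (sq u == 0) = (u == 0).
Proof.
apply/eqP/eqP => [h|->]; last by rewrite /sq big1// => i _; rewrite mxE nsq0.
apply/matrixP => i j; rewrite ord1 mxE; apply/eqP.
by rewrite -nsq_eq0 (psumr_eq0P _ h)// => l _; exact: nsq_ge0.
Qed.

Lemma sqZ (a : C) u : sq (a *: u) = nsq a * sq u.
Proof. by rewrite /sq mulr_sumr; apply: eq_bigr => i _; rewrite mxE nsqM. Qed.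

Lemma sqD u v : sq (u + v) <= 2 * (sq u + sq v).
Proof.
rewrite /sq -big_split mulr_sumr; apply: ler_sum => i _; rewrite mxE; exact: nsqD.
Qed.

Lemma sq_sum n (F : 'I_n -> 'cV[C]_k.+1) : sq (\sum_i F i) <= n%:R * \sum_i sq (F i).
Proof.
rewrite /sq exchange_big mulr_sumr; apply: ler_sum => i _ /=.
by rewrite summxE nsq_sum.
Qed.

Lemma Re_hdot_le u v : `|complex.Re (hdot u v)| <= 2^-1 * (sq u + sq v).
Proof.
have le w : complex.Re (hdot w v) <= 2^-1 * (sq w + sq v).
  rewrite /hdot raddf_sum /sq -big_split mulr_sumr; apply: ler_sum => i _.
  exact: Re_mulJ_le.
rewrite ler_norml le andbT lerNl -(_ : complex.Re (hdot (- u) v) = - complex.Re (hdot u v)).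
  by rewrite (le_trans (le _))// -scaleN1r sqZ (_ : nsq (-1) = 1) ?mul1r// /nsq /=; ring.
by rewrite -scaleN1r hdotZl mulN1r raddfN.
Qed.

Lemma sq_mulmx A : exists2 c : R, 0 <= c & forall u, sq (toC A *m u) <= c * sq u.
Proof.
exists (\sum_i k.+1%:R * \sum_j A i j ^+ 2) => [|u].
  by apply: sumr_ge0 => i _; rewrite mulr_ge0// sumr_ge0// => j _; rewrite sqr_ge0.
rewrite {1}/sq mulr_suml; apply: ler_sum => i _; rewrite mxE.
rewrite (le_trans (nsq_sum _))// -mulrA ler_wpM2l// mulr_suml; apply: ler_sum => j _.
rewrite mxE nsqM nsqR ler_wpM2l ?sqr_ge0//.
by rewrite /sq (bigD1 j)//= lerDl sumr_ge0// => l _; exact: nsq_ge0.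
Qed.

Section OrthonormalBasis.
Variables (M : 'M[R]_k.+1) (v : 'I_k.+1 -> 'cV[C]_k.+1).
Hypothesis Msym : M^T = M.
Hypothesis ortho : forall p q, hdot (v p) (toC M *m v q) = (p == q)%:R.

(** The Gram identity [V^* M V = 1] also reads [V V^* M = 1]. *)
Lemma onb_expand u : u = \sum_p hdot u (toC M *m v p) *: v p.
Proof.
pose V : 'M[C]_k.+1 := \matrix_(i, p) v p i 0.
pose W : 'M[C]_k.+1 := \matrix_(p, i) conjc ((toC M *m v p) i 0).
have WV : W *m V = 1%:M.
  apply/matrixP => p q; rewrite !mxE eq_sym -ortho /hdot.
  by apply: eq_bigr => i _; rewrite !mxE mulrC.
have VW : V *m W = 1%:M by exact: mulmx1C.
rewrite -{1}[u]mul1mx -VW -mulmxA; apply/matrixP => i j; rewrite ord1 !mxE summxE.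
apply: eq_bigr => p _; rewrite !mxE mulrC; congr (_ * _).
by rewrite /hdot; apply: eq_bigr => l _; rewrite mxE mulrC.
Qed.

Lemma onb_hdot u w : hdot u (toC M *m w) =
  \sum_p hdot u (toC M *m v p) * conjc (hdot w (toC M *m v p)).
Proof.
rewrite -[M in LHS]Msym -hdot_toC {1}(onb_expand w) hdot_sumr.
apply: eq_bigr => p _; rewrite hdotZr mulrC hdot_toC Msym; congr (_ * _).
Qed.

Lemma onb_sqnorm u : hdot u (toC M *m u) = (\sum_p nsq (hdot u (toC M *m v p)))%:C.
Proof.
by rewrite onb_hdot rmorph_sum; apply: eq_bigr => p _; rewrite nsqE.
Qed.

(** Any two norms are equivalent; the basis makes the constant explicit. *)
Lemma onb_coercive : exists2 c : R, 0 < c &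
  forall u, sq u <= c * complex.Re (hdot u (toC M *m u)).
Proof.
exists (1 + k.+1%:R * \sum_p sq (v p)).
  by rewrite ltr_pwDl// mulr_ge0// sumr_ge0// => p _; exact: sq_ge0.
move=> u; rewrite onb_sqnorm /= {1}(onb_expand u) (le_trans (sq_sum _))//.
rewrite mulrDl mul1r ler_wpDl//.
  by apply: sumr_ge0 => p _; exact: nsq_ge0.
rewrite -mulrA ler_wpM2l// mulr_suml; apply: ler_sum => p _.
rewrite sqZ mulrC ler_wpM2l ?sq_ge0//.
by rewrite (bigD1 p)//= lerDl sumr_ge0// => q _; exact: nsq_ge0.
Qed.

Lemma onb_unit : M \in unitmx.
Proof.
rewrite -(map_unitmx (real_complex R)).
pose X : 'M[C]_k.+1 := \matrix_(p, i) v p i 0.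
pose Y : 'M[C]_k.+1 := \matrix_(i, q) conjc (v q i 0).
have h : X *m (toC M *m Y) = 1%:M.
  apply/matrixP => p q; rewrite mulmxA mxE [RHS]mxE -ortho -[in RHS]Msym -hdot_toC /hdot.
  apply: eq_bigr => j _; rewrite [Y _ _]mxE; congr (_ * _); rewrite !mxE.
  by apply: eq_bigr => l _; rewrite !mxE mulrC -[in RHS]Msym mxE.
have /mulmx1_unit[_] := h; rewrite unitmx_mul => /andP[? _] //.
Qed.

End OrthonormalBasis.
End Complex.

(** * Integrals over the cells *)

Section CellIntegral.
Variable R : realType.
Implicit Types (p q : {poly R}) (h : R) (j : int).

Lemma face_gap h j : face h j - face h (j - 1) = h.
Proof. by rewrite /face rmorphB /=; ring. Qed.

(** All integrals of polynomials reduce to this formula, since every polynomial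
    is a derivative. *)
Lemma cell_integral_deriv h j p : 0 < h ->
  cell_integral h j p^`() = p.[face h j] - p.[face h (j - 1)].
Proof.
move=> h0; set b := face h j; set a := face h (j - 1).
have ab : a < b by rewrite -subr_gt0 /a /b face_gap.
rewrite /cell_integral /Rintegral /cell -/a -/b.
rewrite -(@integral_itv_bndoo _ _ _ _ true false); last first.
  by apply: (measurable_EFinP _ (horner p^`())).2; exact: measurable_poly.
rewrite (@continuous_FTC2 _ _ (horner p))//.
- apply/continuous_subspaceT => x; exact: continuous_horner.
- split=> [x _||]; first exact: derivable_horner.
  + by apply: cvg_at_right_filter; exact: continuous_horner.
  + by apply: cvg_at_left_filter; exact: continuous_horner.
- by move=> x _; rewrite derivE.
Qed.

Lemma antiderivative p : exists q, p = q^`().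
Proof.
exists (\poly_(i < (size p).+1) (p`_i.-1 / i%:R)); apply/polyP => i.
rewrite coef_deriv coef_poly ltnS /=; case: ltnP => [ip|ip].
  by rewrite -[RHS]mulr_natr divfK// pnatr_eq0.
by rewrite mul0rn nth_default.
Qed.

Lemma deriv_eq0 p : p^`() = 0 -> p = (p`_0)%:P.
Proof.
move=> p0; apply/polyP => -[|i]; rewrite coefC //=.
have := congr1 (fun q : {poly R} => q`_i) p0; rewrite coef_deriv coef0 => /eqP.
by rewrite mulrn_eq0 /= => /eqP.
Qed.

(** Integral over the reference cell [(-1, 1)]. *)
Definition rint p : R := cell_integral 2 0 p.

Lemma rint_deriv p : rint p^`() = p.[1] - p.[-1].
Proof.
rewrite /rint cell_integral_deriv// /face sub0r; congr (_.[_] - _.[_]).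
  by rewrite add0r mulVf.
by rewrite rmorphN /=; field.
Qed.

Lemma rintD p q : rint (p + q) = rint p + rint q.
Proof.
have [P ->] := antiderivative p; have [Q ->] := antiderivative q.
by rewrite -derivD !rint_deriv !hornerD; ring.
Qed.

Lemma rintZ a p : rint (a *: p) = a * rint p.
Proof.
have [P ->] := antiderivative p.
by rewrite -derivZ !rint_deriv !hornerZ; ring.
Qed.

Lemma rint_sum (I : Type) (r : seq I) (F : I -> {poly R}) :
  rint (\sum_(i <- r) F i) = \sum_(i <- r) rint (F i).
Proof.
have r0 : rint 0 = 0 by rewrite -(scale0r 0) rintZ mul0r.
by apply: (big_ind2 (fun x y => rint x = y)) => // ? ? ? ? <- <-; rewrite rintD.
Qed.

Lemma rint_parts p q :
  rint (p^`() * q) = p.[1] * q.[1] - p.[-1] * q.[-1] - rint (p * q^`()).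
Proof.
apply/eqP; rewrite eq_sym subr_eq -rintD -derivM rint_deriv !hornerM.
by apply/eqP.
Qed.

(** The affine map of the cell [j] onto the reference cell. *)
Definition aff h j : {poly R} := (h / 2)^-1 *: ('X - (Defs.center h j)%:P).

Lemma aff_right h j : h != 0 -> (aff h j).[face h j] = 1.
Proof. by move=> h0; rewrite !hornerE /face /Defs.center; field. Qed.

Lemma aff_left h j : h != 0 -> (aff h j).[face h (j - 1)] = -1.
Proof. by move=> h0; rewrite !hornerE /face /Defs.center rmorphB /=; field. Qed.

Lemma deriv_aff h j : (aff h j)^`() = ((h / 2)^-1)%:P.
Proof. by rewrite derivZ derivXsubC alg_polyC. Qed.

Lemma deriv_comp_aff h j p :
  (p \Po aff h j)^`() = (h / 2)^-1 *: (p^`() \Po aff h j).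
Proof. by rewrite deriv_comp deriv_aff mulrC mul_polyC. Qed.

Lemma cell_integral_aff h j p : 0 < h ->
  cell_integral h j (p \Po aff h j) = h / 2 * rint p.
Proof.
move=> h0; have hn0 : h != 0 by rewrite gt_eqF.
have [P ->] := antiderivative p.
have -> : P^`() \Po aff h j = ((h / 2) *: (P \Po aff h j))^`().
  by rewrite derivZ deriv_comp_aff scalerA divff ?scale1r// mulf_neq0 ?invr_eq0.
rewrite cell_integral_deriv// rint_deriv !hornerZ !horner_comp.
by rewrite aff_right// aff_left// mulrBr.
Qed.

End CellIntegral.

Section ReferenceCell.
Variables (R : realType) (k : nat).
Implicit Types (u q : 'cV[R]_k.+1) (w : {poly R}).

Definition vpol u : {poly R} := \sum_(l < k.+1) u l 0 *: 'X^l.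

Definition refmass : 'M[R]_k.+1 := \matrix_(l, m) rint ('X^l * 'X^m).

(** Blocks of the discrete gradient acting on the cell itself and on its left
    neighbour; only the latter sees the upwind trace at the left face. *)
Definition grad0 : 'M[R]_k.+1 :=
  \matrix_(l, m) (1 - rint ('X^m * ('X^l)^`())).
Definition grad1 : 'M[R]_k.+1 := \matrix_(l, m) (- (-1) ^+ l).

Lemma size_vpol u : (size (vpol u) <= k.+1)%N.
Proof.
apply: (leq_trans (size_sum _ _ _)); apply/bigmax_leqP => l _.
by rewrite (leq_trans (size_scale_leq _ _))// size_polyXn.
Qed.

Lemma coef_vpol u (l : 'I_k.+1) : (vpol u)`_l = u l 0.
Proof.
rewrite coef_sum (bigD1 l)//= coefZ coefXn eqxx mulr1 big1 ?addr0// => m ml.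
by rewrite coefZ coefXn eq_sym (negPf (ml : (m : nat) != l)) mulr0.
Qed.

Lemma polyE_k w : (size w <= k.+1)%N -> w = \sum_(l < k.+1) w`_l *: 'X^l.
Proof.
move=> sw; rewrite -poly_def; apply/polyP => i; rewrite coef_poly; case: ltnP => // ki.
by rewrite nth_default// (leq_trans sw).
Qed.

Lemma vpol_inj0 u : vpol u = 0 -> u = 0.
Proof.
move=> h; apply/matrixP => i j; rewrite ord1 -coef_vpol h coef0 mxE //.
Qed.

Lemma horner_vpol u x : (vpol u).[x] = \sum_(l < k.+1) u l 0 * x ^+ l.
Proof. by rewrite horner_sum; apply: eq_bigr => l _; rewrite hornerZ hornerXn. Qed.

Lemma refmassE q (l : 'I_k.+1) : (refmass *m q) l 0 = rint (vpol q * 'X^l).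
Proof.
rewrite mxE mulr_suml rint_sum; apply: eq_bigr => m _.
by rewrite mxE -scalerAl rintZ mulrC [_ * 'X^l]mulrC.
Qed.

Lemma rint_vpol q w : (size w <= k.+1)%N ->
  rint (vpol q * w) = \sum_(l < k.+1) w`_l * (refmass *m q) l 0.
Proof.
move=> /polyE_k {1}->; rewrite mulr_sumr rint_sum; apply: eq_bigr => l _.
by rewrite refmassE -scalerAr rintZ.
Qed.

Lemma horner_k w x : (size w <= k.+1)%N -> w.[x] = \sum_(l < k.+1) w`_l * x ^+ l.
Proof.
move=> /polyE_k {1}->; rewrite horner_sum.
by apply: eq_bigr => l _; rewrite hornerZ hornerXn.
Qed.

Lemma rint_deriv_k p w : (size w <= k.+1)%N ->
  rint (p * w^`()) = \sum_(l < k.+1) w`_l * rint (p * ('X^l)^`()).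
Proof.
move=> /polyE_k {1}->; rewrite [(\sum_(l < k.+1) _)^`()](raddf_sum (@deriv R)).
rewrite mulr_sumr rint_sum; apply: eq_bigr => l _ /=.
by rewrite derivZ -scalerAr rintZ.
Qed.

Lemma grad0E u (l : 'I_k.+1) :
  (grad0 *m u) l 0 = (vpol u).[1] - rint (vpol u * ('X^l)^`()).
Proof.
rewrite mxE horner_vpol mulr_suml rint_sum -sumrB; apply: eq_bigr => m _.
by rewrite mxE expr1n -scalerAl rintZ mulrC mulrBr.
Qed.

Lemma grad1E u (l : 'I_k.+1) : (grad1 *m u) l 0 = - (vpol u).[1] * (-1) ^+ l.
Proof.
rewrite mxE horner_vpol mulNr mulr_suml -sumrN; apply: eq_bigr => m _.
by rewrite mxE expr1n; ring.
Qed.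

(** Integrating by parts turns the adjoint of the gradient into the second
    equation of the scheme, with downwind traces. *)
Lemma grad0TE q (l : 'I_k.+1) : (grad0^T *m q) l 0 =
  rint (vpol q * ('X^l)^`()) + (vpol q).[-1] * (-1) ^+ l.
Proof.
have -> : rint (vpol q * ('X^l)^`()) + (vpol q).[-1] * (-1) ^+ l =
   (vpol q).[1] - rint ((vpol q)^`() * 'X^l).
  by rewrite rint_parts !hornerXn expr1n; ring.
rewrite mxE horner_vpol [(vpol q)^`()](raddf_sum (@deriv R)) mulr_suml rint_sum -sumrB.
apply: eq_bigr => m _.
by rewrite !mxE expr1n /= derivZ -scalerAl rintZ mulrC mulrBr [_ * 'X^l]mulrC.
Qed.

Lemma grad1TE q (l : 'I_k.+1) : (grad1^T *m q) l 0 = - (vpol q).[-1].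
Proof.
rewrite mxE horner_vpol -sumrN; apply: eq_bigr => m _.
by rewrite !mxE; ring.
Qed.

Lemma phiE (h : R) j l : phi h j l = 'X^l \Po aff h j.
Proof. by rewrite /phi comp_Xn_poly. Qed.

Lemma bpolyE (h : R) (u : int -> 'cV[R]_k.+1) j : bpoly h u j = vpol (u j) \Po aff h j.
Proof.
rewrite /bpoly raddf_sum; apply: eq_bigr => l _ /=.
by rewrite comp_polyZ phiE.
Qed.

Lemma massE (h : R) : 0 < h -> mass k h = (h / 2) *: refmass.
Proof.
move=> h0; apply/matrixP => l m; rewrite !mxE !phiE -rmorphM /=.
by rewrite cell_integral_aff.
Qed.

Lemma mass_sym (h : R) : (mass k h)^T = mass k h.
Proof. by apply/matrixP => l m; rewrite !mxE mulrC. Qed.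

Lemma ldg_gradientP (h : R) (u q : int -> 'cV[R]_k.+1) : 0 < h ->
  (forall j, (h / 2) *: (refmass *m q j) = grad0 *m u j + grad1 *m u (j - 1)) ->
  ldg_gradient h u q.
Proof.
move=> h0 hq j v sv; have hn0 : h != 0 by rewrite gt_eqF.
have h2 : h / 2 != 0 by rewrite mulf_neq0 ?invr_eq0.
pose w := v \Po ((h / 2) *: 'X + (Defs.center h j)%:P).
have vw : v = w \Po aff h j.
  rewrite /w -comp_polyA comp_polyD comp_polyZ comp_polyX comp_polyC.
  by rewrite /aff scalerA divff// scale1r subrK comp_polyXr.
have sw : (size w <= k.+1)%N.
  rewrite /w -mul_polyC; have [v0|v0] := eqVneq v 0.
    by rewrite v0 comp_poly0 size_poly0.
  rewrite size_comp_poly2//.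
  by rewrite size_MXaddC polyC_eq0 (negPf h2) size_polyC h2.
clearbody w; rewrite vw !bpolyE /trace_minus !bpolyE deriv_comp_aff -scalerAr -!comp_polyM.
rewrite -comp_polyZ !cell_integral_aff// rintZ [X in - X]mulrA divff// mul1r.
rewrite !horner_comp aff_right// aff_left//.
have -> : (aff h (j - 1)).[face h (j - 1)] = 1 by rewrite aff_right.
rewrite (rint_vpol _ sw) !(horner_k _ sw) rint_deriv_k// !mulr_sumr -sumrN.
rewrite -big_split -sumrB; apply: eq_bigr => l _ /=.
have := congr1 (fun A : 'cV[R]_k.+1 => A l 0) (hq j).
rewrite [LHS]mxE [RHS]mxE grad0E grad1E => hl.
by rewrite mulrCA hl expr1n; ring.
Qed.

(** With [G0, G1] the blocks of the gradient, the stencil is the one of [G^* M^-1 G]. *)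
Definition ref_stencil (h : R) : stencil R k := Stencil
  ((2 / h) *: (grad0^T *m invmx refmass *m grad1))
  ((2 / h) *: (grad0^T *m invmx refmass *m grad0 + grad1^T *m invmx refmass *m grad1))
  ((2 / h) *: (grad1^T *m invmx refmass *m grad0)).

(** The defining identity determines the blocks: it is tested on data supported
    in one cell. *)
Lemma ldg_stencilP (h : R) (K : stencil R k) : 0 < h -> refmass \in unitmx ->
  ldg_stencil h K -> K = ref_stencil h.
Proof.
move=> h0 Mu hK; have hn0 : h != 0 by rewrite gt_eqF.
have key (u : int -> 'cV[R]_k.+1) j :
  Kminus K *m u (j - 1) + Kzero K *m u j + Kplus K *m u (j + 1) =
  (2 / h) *: (grad0^T *m (invmx refmass *m (grad0 *m u j + grad1 *m u (j - 1)))
   + grad1^T *m (invmx refmass *m (grad0 *m u (j + 1) + grad1 *m u j))).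
  pose q i := (2 / h) *: (invmx refmass *m (grad0 *m u i + grad1 *m u (i - 1))).
  have hq : ldg_gradient h u q.
    apply: ldg_gradientP => // i; rewrite /q -scalemxAr scalerA mulKVmx//.
    by rewrite (_ : _ * _ = 1) ?scale1r//; field.
  have := hK u q hq j => hl.
  apply/matrixP => l o; rewrite ord1 {o} hl.
  have -> : (2 / h) *: (grad0^T *m (invmx refmass *m (grad0 *m u j + grad1 *m u (j - 1)))
      + grad1^T *m (invmx refmass *m (grad0 *m u (j + 1) + grad1 *m u j)))
     = grad0^T *m q j + grad1^T *m q (j + 1).
    by rewrite scalerDr /q addrK !scalemxAr.
  rewrite [RHS]mxE grad0TE grad1TE.
  rewrite /trace_plus !bpolyE phiE deriv_comp_aff -scalerAr -comp_polyM -comp_polyZ.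
  rewrite cell_integral_aff// rintZ !horner_comp aff_right// subrK aff_left//.
  have -> : (aff h (j + 1)).[face h j] = -1.
    by rewrite -(aff_left (j + 1) hn0) addrK.
  rewrite !hornerXn expr1n mulrA divff ?mulf_neq0 ?invr_eq0//; ring.
pose dl (w : 'cV[R]_k.+1) (i : int) : 'cV[R]_k.+1 := if i == 0 then w else 0.
have col (A B : 'M[R]_k.+1) : (forall w : 'cV_k.+1, A *m w = B *m w) -> A = B.
  move=> AB; apply/matrixP => i j.
  have := congr1 (fun X : 'cV[R]_k.+1 => X i 0) (AB (delta_mx j 0)).
  by rewrite -!colE !mxE.
case: K key {hK} => A B D /= key; congr Stencil; apply: col => w.
- have := key (dl w) 1.
  have -> : dl w (1 - 1) = w by []. have -> : dl w 1 = 0 by [].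
  have -> : dl w (1 + 1) = 0 by [].
  by rewrite !(mulmx0, addr0, add0r) -scalemxAl !mulmxA.
- have := key (dl w) 0.
  have -> : dl w (0 - 1) = 0 by []. have -> : dl w 0 = w by [].
  have -> : dl w (0 + 1) = 0 by [].
  by rewrite !(mulmx0, addr0, add0r) -scalemxAl mulmxDl !mulmxA.
- have := key (dl w) (-1).
  have -> : dl w (-1 - 1) = 0 by []. have -> : dl w (-1) = 0 by [].
  have -> : dl w (-1 + 1) = w by [].
  by rewrite !(mulmx0, addr0, add0r) -scalemxAl !mulmxA.
Qed.

(** Simplicity of the spectrum at the Nyquist frequency, where the symbol is
    [H^T M^-1 H] with [H] the gradient for antiperiodic traces and [q = M^-1 H u].
    In a multiple eigenspace some [u <> 0] would satisfy [q(1) + q(-1) = 0]. Then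
    [q' = - s u]; testing [q'] against [q] and the definition of [q] against [u]
    gives [s (u(1) + u(-1)) ^ 2 = 0], and [q = 0] if [s = 0]. Hence [q = u'] and
    [u'' = - s u], which forces the polynomial [u] to vanish. *)
Lemma nyquist_simple (u q : 'cV[R]_k.+1) (s : R) : refmass \in unitmx ->
  refmass *m q = (grad0 - grad1) *m u ->
  (grad0 - grad1)^T *m q = s *: (refmass *m u) ->
  (vpol q).[1] + (vpol q).[-1] = 0 -> u = 0.
Proof.
move=> Mu hq hu hb; set U := vpol u; set Q := vpol q.
have sU : (size U <= k.+1)%N by exact: size_vpol.
have sQ : (size Q <= k.+1)%N by exact: size_vpol.
have sd (p : {poly R}) : (size p <= k.+1 -> size (p^`())%R <= k)%N.
  move=> sp; have [->|p0] := eqVneq p 0; first by rewrite deriv0 size_poly0.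
  by rewrite -ltnS (leq_trans (lt_size_deriv p0)).
have nondeg (w : {poly R}) : (size w <= k.+1)%N ->
    (forall l : 'I_k.+1, rint (w * 'X^l) = 0) -> w = 0.
  move=> sw hw; pose c : 'cV[R]_k.+1 := \col_l w`_l.
  have wc : w = vpol c by rewrite {1}(polyE_k sw); apply: eq_bigr => l _; rewrite mxE.
  have c0 : c = 0; last by rewrite wc c0 /vpol big1// => l _; rewrite mxE scale0r.
  rewrite -(mulKmx Mu c); have -> : refmass *m c = 0; last by rewrite mulmx0.
  by apply/matrixP => l o; rewrite ord1 refmassE -wc hw mxE.
have e1 (l : 'I_k.+1) : rint (Q * 'X^l) = - rint (U * ('X^l)^`()) + U.[1] * (1 + (-1) ^+ l).
  rewrite -refmassE hq mulmxBl [LHS]mxE [X in _ + X]mxE grad0E grad1E; ring.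
have e2 (l : 'I_k.+1) : s * rint (U * 'X^l) = - rint (Q^`() * 'X^l).
  have := congr1 (fun A : 'cV[R]_k.+1 => A l 0) hu.
  rewrite [RHS]mxE refmassE -/U => <-.
  rewrite linearB /= mulmxBl [LHS]mxE [X in _ + X]mxE grad0TE grad1TE -/Q.
  rewrite rint_parts !hornerXn expr1n.
  have -> : Q.[-1] = - Q.[1] by apply/eqP; rewrite -addr_eq0 addrC hb.
  by ring.
have e1w w : (size w <= k.+1)%N ->
    rint (Q * w) = - rint (U * w^`()) + U.[1] * (w.[1] + w.[-1]).
  move=> sw; rewrite rint_deriv_k// !(horner_k _ sw) {1}(polyE_k sw).
  rewrite mulr_sumr rint_sum -big_split mulr_sumr -sumrN -big_split.
  by apply: eq_bigr => l _ /=; rewrite -scalerAr rintZ e1 expr1n; ring.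
have QU : Q^`() = - (s *: U).
  apply/eqP; rewrite -addr_eq0; apply/eqP/nondeg => [|l].
    rewrite (leq_trans (size_polyD _ _))// geq_max (leq_trans (sd _ sQ))//.
    by rewrite (leq_trans (size_scale_leq _ _)).
  by rewrite mulrDl rintD -scalerAl rintZ e2 addrN.
pose al := U.[1] + U.[-1].
have h1 : 2 * rint (Q * U) = al ^+ 2.
  have hUU : rint (U * U^`()) = U.[1] * U.[1] - U.[-1] * U.[-1] - rint (U * U^`()).
    by rewrite -rint_parts mulrC.
  rewrite e1w// mulrDr mulrN; have -> : 2 * rint (U * U^`()) = U.[1] ^+ 2 - U.[-1] ^+ 2.
    by rewrite mulrDl mul1r {1}hUU; ring.
  by rewrite /al; ring.
have hQQ : rint (Q * Q^`()) = 0.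
  have : rint (Q * Q^`()) = Q.[1] * Q.[1] - Q.[-1] * Q.[-1] - rint (Q * Q^`()).
    by rewrite -rint_parts mulrC.
  have -> : Q.[-1] = - Q.[1] by apply/eqP; rewrite -addr_eq0 addrC hb.
  rewrite mulrNN subrr sub0r => /eqP; rewrite -addr_eq0 -mulr2n mulrn_eq0 /=.
  by move/eqP.
have h2 : s * al ^+ 2 = 0.
  rewrite -h1; move: hQQ; rewrite QU mulrN -scalerAr -scaleN1r !rintZ.
  by move=> /eqP; rewrite mulN1r oppr_eq0 => /eqP h; rewrite mulrCA h mulr0.
have Q0 : s = 0 -> Q = 0.
  move=> s0; have : Q^`() = 0 by rewrite QU s0 scale0r oppr0.
  move=> /deriv_eq0; move: (Q`_0) => c QC; rewrite QC; move: hb; rewrite -/Q QC !hornerC.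
  by move=> /eqP; rewrite -mulr2n mulrn_eq0 /= => /eqP ->.
have al0 : al = 0.
  apply/eqP; move/eqP: h2; rewrite mulf_eq0 sqrf_eq0 => /orP[/eqP s0|//].
  move: h1; rewrite (Q0 s0) mul0r -(scale0r 0) rintZ mul0r mulr0 => /esym/eqP.
  by rewrite sqrf_eq0.
have QdU : Q = U^`().
  apply/eqP; rewrite -subr_eq0; apply/eqP/nondeg => [|l].
    rewrite (leq_trans (size_polyD _ _))// geq_max sQ size_polyN.
    by rewrite (leq_trans (sd _ sU)).
  rewrite mulrBl -[- (_ * _)]scaleN1r rintD rintZ mulN1r e1w ?size_polyXn ?ltn_ord//.
  rewrite (rint_parts U).
  have -> : U.[-1] = - U.[1] by apply/eqP; rewrite -addr_eq0 addrC -/al al0.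
  by ring.
apply: vpol_inj0; rewrite -/U.
have [s0|s0] := eqVneq s 0.
  have /deriv_eq0 : U^`() = 0 by rewrite -QdU Q0.
  move: (U`_0) => c UC; rewrite UC.
  move: al0; rewrite /al UC !hornerC => /eqP.
  by rewrite -mulr2n mulrn_eq0 /= => /eqP ->.
apply/eqP; apply: contraT => U0.
have := lt_size_deriv U0; rewrite ltnNge => /negP[].
rewrite -QdU; move: QU; rewrite -scaleNr => /(congr1 (fun p : {poly R} => size p)).
rewrite size_scale ?oppr_eq0// => <-.
have [->|Q1] := eqVneq Q 0; first by rewrite deriv0.
exact/ltnW/lt_size_deriv.
Qed.

End ReferenceCell.

(** * The symbol and its bands on the unit mesh *)

Section Bands.
Variables (R : realType) (k : nat) (lambda : R) (K : stencil R k).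
Variables (sigma : 'I_k.+1 -> R -> R) (v : 'I_k.+1 -> R -> 'cV[R[i]]_k.+1).
Hypothesis Kldg : ldg_stencil 1 K.
Hypothesis branches : eigen_branches 1 K sigma v.
Local Open Scope complex_scope.
Local Notation C := R[i].
Local Notation M := (mass k (1 : R)).
Local Notation G0 := (grad0 R k).
Local Notation G1 := (grad1 R k).
Local Notation M0 := (refmass R k).

Lemma Pi1E (xi : R) : Pi_h 1 xi = (- pi <= xi <= pi) :> Prop.
Proof. by rewrite /Pi_h /= in_itv /= divr1. Qed.

Lemma PiN : Pi_h 1 (- pi : R).
Proof. by rewrite Pi1E lexx /= ge0_cp ?pi_ge0. Qed.

Lemma branch_ortho xi : Pi_h 1 xi ->
  forall p q, hdot (v p xi) (toC M *m v q xi) = (p == q)%:R.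
Proof. by move=> hxi p q; rewrite (branch_orthonormal branches). Qed.

Lemma mass1E : M = 2^-1 *: M0.
Proof. by rewrite massE// mul1r. Qed.

Lemma refmass_unit : M0 \in unitmx.
Proof.
have := onb_unit (mass_sym k _) (branch_ortho PiN).
by rewrite mass1E unitmxZ ?unitfE// invr_eq0.
Qed.

Lemma KE : K = ref_stencil k 1.
Proof. by apply: ldg_stencilP => //; exact: refmass_unit. Qed.

Lemma Kplus_tr : Kplus K = (Kminus K)^T.
Proof.
rewrite KE /= linearZ /= !trmx_mul trmxK trmx_inv mulmxA.
by congr (_ *: (_ *m invmx _ *m _)); apply/matrixP => i j; rewrite !mxE mulrC.
Qed.

Lemma Kzero_tr : (Kzero K)^T = Kzero K.
Proof.
have M0T : M0^T = M0 by apply/matrixP => i j; rewrite !mxE mulrC.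
by rewrite KE /= linearZ /= linearD /= !trmx_mul !trmxK trmx_inv M0T !mulmxA.
Qed.

Lemma symbolE xi (u : 'cV[C]_k.+1) : symbol 1 K xi *m u = toC (Kzero K) *m u
  + cis (- xi) *: (toC (Kminus K) *m u) + cis xi *: (toC (Kplus K) *m u).
Proof.
rewrite /symbol mulr1 (mulmxDl (_ + _) _ u) (mulmxDl (toC _) _ u).
by rewrite -!scalemxAl.
Qed.

Lemma symbol_selfadjoint xi u w :
  hdot (symbol 1 K xi *m u) w = hdot u (symbol 1 K xi *m w).
Proof.
rewrite !symbolE !hdotDl !hdotDr !hdotZl !hdotZr.
rewrite !hdot_toC Kzero_tr Kplus_tr trmxK !cisJ opprK -!addrA; congr (_ + _).
by rewrite addrC.
Qed.

Lemma branch_eq p xi : Pi_h 1 xi ->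
  symbol 1 K xi *m v p xi = (sigma p xi)%:C *: (toC M *m v p xi).
Proof.
move=> /(branch_eigen branches p); rewrite mulmxBl => /eqP.
by rewrite subr_eq0 => /eqP ->; rewrite scalemxAl.
Qed.

(** The gradient of the Bloch wave of frequency [xi] and profile [u]. *)
Definition flux xi (u : 'cV[C]_k.+1) : 'cV[C]_k.+1 :=
  toC (invmx M0) *m (toC G0 *m u + cis (- xi) *: (toC G1 *m u)).

(** The factor 4 combines [K = 2 G^* M0^-1 G] with [M = M0 / 2] on the unit mesh. *)
Lemma symbol_flux xi u w :
  hdot (symbol 1 K xi *m u) w = 4 * hdot (flux xi u) (toC M *m flux xi w).
Proof.
have e1 : toC M *m flux xi w =
    2^-1 *: (toC G0 *m w + cis (- xi) *: (toC G1 *m w)).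
  rewrite /flux mass1E mulmxA toCZ -scalemxAl -toCM mulmxV ?refmass_unit//.
  rewrite /toC map_mx1 -?scalemxAl ?mul1mx.
  by congr (_ *: _); rewrite fmorphV rmorph_nat.
rewrite e1 hdotZr.
have -> : conjc (2^-1 : C) = 2^-1 by rewrite fmorphV rmorph_nat.
rewrite (_ : 4 * _ = 2 * hdot (flux xi u) (toC G0 *m w + cis (- xi) *: (toC G1 *m w))); last first.
  by rewrite mulrA; congr (_ * _); field.
rewrite hdotDr hdotZr cisJ opprK.
have tr A : toC A = toC (A^T)^T by rewrite trmxK.
rewrite [toC G0 in RHS]tr [toC G1 in X in _ = 2 * (_ + _ * X)]tr -!hdot_toC -hdotZl -hdotDl -hdotZl.
congr hdot; rewrite KE /symbol /= mulr1 !toCZ !toCD !toCM /flux divr1.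
rewrite !mulmxDl -!scalemxAl !mulmxDl !(mulmxDr _ _ (_ *: _)) -!scalemxAr !mulmxA.
rewrite rmorph_nat !scalerDr !scalerA.
have cc : cis xi * cis (- xi) = 1 :> C by rewrite -cisD subrr cis0.
rewrite !mulmxDr -!scalemxAr !scalerDr !scalerA !mulmxA -[2 * cis xi * _]mulrA cc mulr1.
rewrite (mulrC (cis (- xi)) 2) (mulrC (cis xi) 2).
have perm (x y z t : 'cV[C]_k.+1) : x + y + z + t = x + z + (t + y).
  by rewrite -!addrA; congr (x + _); rewrite addrCA (addrC y).
exact: perm.
Qed.

Lemma sigma_ge0 p xi : Pi_h 1 xi -> 0 <= sigma p xi.
Proof.
move=> hxi; have := symbol_flux xi (v p xi) (v p xi).
rewrite branch_eq// hdotZl hdotC branch_ortho// eqxx rmorph1 mulr1.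
rewrite (onb_sqnorm (mass_sym k 1) (branch_ortho hxi)) => /(congr1 (@complex.Re R)) /= ->.
by rewrite mulr0 subr0 mulr_ge0// ?sumr_ge0// => q _; exact: nsq_ge0.
Qed.

Local Notation piN := (- pi : R).
Local Notation iM := (invmx M0).

(** Twice the symbol at [pi], as a real matrix. *)
Definition nyq_stiff : 'M[R]_k.+1 := 4 *: ((G0 - G1)^T *m iM *m (G0 - G1)).
(** The trace functional [u |-> q(1) + q(-1)] of [nyquist_simple]. *)
Definition nyq_trace : 'rV[R]_k.+1 := (\row_l (1 + (-1) ^+ l)) *m iM *m (G0 - G1).

Lemma cisNpi : cis piN = -1 :> C.
Proof.
by apply/eqP; rewrite eq_complex /= cosN sinN cospi sinpi !oppr0 !eqxx.
Qed.

Lemma cispi : cis (pi : R) = -1 :> C.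
Proof. by rewrite -cisNpi /cis cosN sinN sinpi oppr0. Qed.

Lemma symbol_nyq : symbol 1 K piN = 2^-1 *: toC nyq_stiff.
Proof.
rewrite /symbol mulr1 opprK cispi cisNpi !scaleN1r.
rewrite /toC -!map_mxN -!map_mxD -[2^-1](_ : real_complex R 2^-1 = _); last by rewrite fmorphV rmorph_nat.
rewrite -map_mxZ /nyq_stiff scalerA; congr map_mx.
rewrite KE /= -!scalerN -!scalerDr; congr (_ *: _); first by field.
rewrite [(G0 - G1)^T]linearB  /= !mulmxBl !mulmxBr opprB.
by rewrite -!addrA; congr (_ + _); rewrite addrCA addrA addrC.
Qed.

Lemma nyq_real (u : 'cV[R]_k.+1) s :
  nyq_stiff *m u = s *: (M0 *m u) -> nyq_trace *m u = 0 -> u = 0.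
Proof.
move=> hu hb; pose q := iM *m ((G0 - G1) *m u).
apply: (@nyquist_simple _ _ u q (s / 4)); first exact: refmass_unit.
- by rewrite /q mulKVmx ?refmass_unit.
- move: hu; rewrite /nyq_stiff -scalemxAl => /(congr1 (fun X => 4^-1 *: X)).
  by rewrite !scalerA mulVf// scale1r /q !mulmxA mulrC => ->.
- rewrite !horner_vpol -big_split /=.
  have h : ((\row_l (1 + (-1) ^+ l)) *m q) 0 0 = 0 :> R.
    by rewrite /q !mulmxA -/nyq_trace hb mxE.
  rewrite -[RHS]h mxE; apply: eq_bigr => l _.
  by rewrite [in RHS]mxE expr1n; ring.
Qed.

Let reV (u : 'cV[C]_k.+1) : 'cV[R]_k.+1 := map_mx (@complex.Re R) u.
Let imV (u : 'cV[C]_k.+1) : 'cV[R]_k.+1 := map_mx (@complex.Im R) u.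

Lemma re_mul m (A : 'M[R]_(m, k.+1)) u :
  map_mx (@complex.Re R) (map_mx (real_complex R) A *m u) = A *m reV u.
Proof.
apply/matrixP => i j; rewrite !mxE raddf_sum; apply: eq_bigr => l _.
by rewrite !mxE /=; case: (u l j) => a b /=; rewrite mul0r subr0.
Qed.

Lemma im_mul m (A : 'M[R]_(m, k.+1)) u :
  map_mx (@complex.Im R) (map_mx (real_complex R) A *m u) = A *m imV u.
Proof.
apply/matrixP => i j; rewrite !mxE raddf_sum; apply: eq_bigr => l _.
by rewrite !mxE /=; case: (u l j) => a b /=; rewrite mul0r addr0.
Qed.

Lemma reZ m n (s : R) (A : 'M[C]_(m, n)) :
  map_mx (@complex.Re R) (s%:C *: A) = s *: map_mx (@complex.Re R) A.
Proof. by apply/matrixP => i j; rewrite !mxE; case: (A i j) => a b /=; rewrite mul0r subr0. Qed.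

Lemma imZ m n (s : R) (A : 'M[C]_(m, n)) :
  map_mx (@complex.Im R) (s%:C *: A) = s *: map_mx (@complex.Im R) A.
Proof. by apply/matrixP => i j; rewrite !mxE; case: (A i j) => a b /=; rewrite mul0r addr0. Qed.

Definition beta (u : 'cV[C]_k.+1) : C := (map_mx (real_complex R) nyq_trace *m u) 0 0.

Lemma nyq_cplx (u : 'cV[C]_k.+1) s :
  toC nyq_stiff *m u = s%:C *: (toC M0 *m u) -> beta u = 0 -> u = 0.
Proof.
move=> hu hb.
have hb' : map_mx (real_complex R) nyq_trace *m u = 0.
  by apply/matrixP => i j; rewrite !ord1 [RHS]mxE.
have r0 : reV u = 0.
  apply: (@nyq_real _ s).
  - by rewrite -!re_mul -reZ; congr map_mx.
  - by rewrite -re_mul hb'; apply/matrixP => i j; rewrite !mxE.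
have i0 : imV u = 0.
  apply: (@nyq_real _ s).
  - by rewrite -!im_mul -imZ; congr map_mx.
  - by rewrite -im_mul hb'; apply/matrixP => i j; rewrite !mxE.
apply/matrixP => i j; rewrite ord1 [RHS]mxE; apply/eqP; rewrite eq_complex.
have := congr1 (fun X : 'cV[R]_k.+1 => X i 0) r0.
have := congr1 (fun X : 'cV[R]_k.+1 => X i 0) i0.
by rewrite !mxE => -> -> /=; rewrite eqxx.
Qed.

Lemma betaD a b u w : beta (a *: u + b *: w) = a * beta u + b * beta w.
Proof. by rewrite /beta mulmxDr -!scalemxAr !mxE. Qed.

Lemma nyq_eig p : toC nyq_stiff *m v p piN = (sigma p piN)%:C *: (toC M0 *m v p piN).
Proof.
have := branch_eq p PiN; rewrite symbol_nyq -scalemxAl mass1E (toCZ _ M0) -scalemxAl.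
rewrite scalerA [_%:C * _]mulrC -scalerA fmorphV rmorph_nat.
by have two0 : (2 : C) != 0 by []; move=> /(scalerI (invr_neq0 two0)).
Qed.

Lemma v_neq0 p xi : Pi_h 1 xi -> v p xi != 0.
Proof.
move=> hxi; apply/eqP => v0; have := branch_ortho hxi p p.
by rewrite v0 hdot0l eqxx => /esym/eqP; rewrite oner_eq0.
Qed.

Lemma beta_neq0 p : beta (v p piN) != 0.
Proof.
by apply/eqP => /(nyq_cplx (nyq_eig p)) /eqP; rewrite (negPf (v_neq0 p PiN)).
Qed.

(** The trace functional [beta] is nonzero on every eigenvector, so it cannot
    vanish on any combination of two of them with equal eigenvalues. *)
Lemma nyq_distinct p q : p != q -> sigma p piN != sigma q piN.
Proof.
move=> pq; apply/eqP => spq.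
pose w := beta (v q piN) *: v p piN + - beta (v p piN) *: v q piN.
have w0 : w = 0.
  apply: (@nyq_cplx _ (sigma p piN)); last by rewrite betaD; ring.
  rewrite /w !mulmxDr -!scalemxAr nyq_eig nyq_eig -spq scalerDr !scalerA.
  by rewrite mulrC [- _ * _]mulrC.
have : hdot w (toC M *m v p piN) = beta (v q piN).
  rewrite /w hdotDl !hdotZl !(branch_ortho PiN) eqxx [q == p]eq_sym (negPf pq).
  by rewrite mulr1 mulr0 addr0.
by rewrite w0 hdot0l => /esym/eqP; rewrite (negPf (beta_neq0 q)).
Qed.

Lemma nyq_gt0 p : 0 < sigma p piN.
Proof.
rewrite lt_neqAle (sigma_ge0 _ PiN) andbT eq_sym; apply/eqP => s0.
have := symbol_flux piN (v p piN) (v p piN).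
rewrite (branch_eq _ PiN) s0 scale0r hdot0l => /esym/eqP.
rewrite mulf_eq0 pnatr_eq0 /= => /eqP h.
have [c c0 hc] := onb_coercive (mass_sym k _) (branch_ortho PiN).
have := hc (flux piN (v p piN)); rewrite h /= mulr0 => hf.
have /eqP f0 : flux piN (v p piN) == 0 by rewrite -sq_eq0 eq_le sq_ge0 hf.
have /eqP := beta_neq0 p; apply.
have -> : beta (v p piN) = (map_mx (real_complex R) (\row_l (1 + (-1) ^+ l)) *m flux piN (v p piN)) 0 0.
  rewrite /beta /nyq_trace !map_mxM /= map_mxB /flux opprK cispi scaleN1r.
  by rewrite -mulmxBl !mulmxA.
by rewrite f0 mulmx0 mxE.
Qed.

(** By simplicity the eigenvectors at the Nyquist frequency are multiples of
    real ones; this is what makes their group velocity vanish. *)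
Lemma nyq_skew (S : 'M[R]_k.+1) p : S^T = - S ->
  hdot (toC S *m v p piN) (v p piN) = 0.
Proof.
move=> ST; set u := v p piN.
pose uc := map_mx (@conjc R) u.
have tc m (A : 'M[R]_(m, k.+1)) :
    map_mx (@conjc R) (map_mx (real_complex R) A) = map_mx (real_complex R) A.
  by apply/matrixP => i j; rewrite !mxE conjc_real.
have huc : toC nyq_stiff *m uc = (sigma p piN)%:C *: (toC M0 *m uc).
  have := congr1 (map_mx (@conjc R)) (nyq_eig p).
  by rewrite map_mxM map_mxZ map_mxM /= !tc oppr0.
have buc : beta uc = conjc (beta u).
  by rewrite /beta -(tc _ nyq_trace) -map_mxM mxE tc.
pose w := beta u *: uc + - beta uc *: u.
have w0 : w = 0.
  apply: (@nyq_cplx _ (sigma p piN)); last by rewrite betaD; ring.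
  rewrite /w !mulmxDr -!scalemxAr nyq_eig huc scalerDr !scalerA.
  by rewrite mulrC [- _ * _]mulrC.
have ucE : uc = (beta uc / beta u) *: u.
  apply/eqP; rewrite -subr_eq0 -scaleNr; apply/eqP.
  have := congr1 (fun X => (beta u)^-1 *: X) w0.
  rewrite /w scaler0 scalerDr !scalerA mulVf ?beta_neq0// scale1r => <-.
  by congr (_ + _ *: _); rewrite mulrN mulrC.
have anti : \sum_l (toC S *m u) l 0 * u l 0 = 0.
  set t := LHS; have : t = - t.
    rewrite {1}/t; under eq_bigr => l _ do rewrite mxE mulr_suml.
    rewrite exchange_big /t -sumrN; apply: eq_bigr => m _ /=.
    rewrite mxE mulr_suml -sumrN; apply: eq_bigr => l _.
    rewrite !mxE; have -> : S l m = - S m l.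
      by have := congr1 (fun X : 'M[R]_k.+1 => X m l) ST; rewrite !mxE.
    by rewrite rmorphN /=; ring.
  by move=> /eqP; rewrite -addr_eq0 -mulr2n mulrn_eq0 /= => /eqP.
rewrite /hdot; transitivity (\sum_l (toC S *m u) l 0 * ((beta uc / beta u) * u l 0)).
  apply: eq_bigr => l _; congr (_ * _).
  by have := congr1 (fun X : 'cV[C]_k.+1 => X l 0) ucE; rewrite !mxE.
by under eq_bigr => l _ do rewrite mulrCA; rewrite -mulr_sumr anti mulr0.
Qed.

(** Eigenvalues of the lattice operator [lattice_op]; the CFL conditions say that they
    are at most 4. *)
Definition band p xi : R := lambda ^+ 2 * sigma p xi.
(** The factor of the characteristic polynomial at [pi] that omits the physical
    branch. *)
Definition other_bands (y : R) : R := \prod_(q | q != ord0) (y - band q piN).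

Hypothesis band_le4 : forall p xi, Pi_h 1 xi -> band p xi <= 4.

Lemma band_itv p xi : Pi_h 1 xi -> 0 <= band p xi <= 4.
Proof. by move=> h; rewrite band_le4// andbT mulr_ge0 ?sqr_ge0 ?sigma_ge0. Qed.

Lemma band_dist p q xi : Pi_h 1 xi -> `|band p xi - band q piN| <= 4.
Proof.
move=> /(band_itv p) /andP[h1 h2]; have /andP[h3 h4] := band_itv q PiN.
by rewrite ler_norml; apply/andP; split; lra.
Qed.

Lemma prod_dist_le (P : pred 'I_k.+1) p xi : Pi_h 1 xi ->
  `|\prod_(q | P q) (band p xi - band q piN)| <= 4 ^+ #|P|.
Proof.
move=> hxi; rewrite normr_prod -prodr_const; apply: ler_prod => q _.
by rewrite normr_ge0 band_dist.
Qed.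

Lemma other_bands_le p xi : Pi_h 1 xi -> `|other_bands (band p xi)| <= 4 ^+ k.
Proof.
move=> hxi; rewrite (le_trans (prod_dist_le _ _ hxi))//.
by rewrite (_ : #|_| = k)//; have := cardC1 (ord0 : 'I_k.+1); rewrite card_ord.
Qed.

(* Matrix entries of the variation of the symbol in the Nyquist eigenbasis. *)
Let jump (r q : 'I_k.+1) xi : C :=
  hdot ((symbol 1 K xi - symbol 1 K piN) *m v r piN) (v q piN).

Lemma jumpE r q xi : jump r q xi =
  (1 + cos xi)%:C * hdot (toC (Kminus K + Kplus K) *m v r piN) (v q piN)
  + (0 +i* sin xi) * hdot (toC (Kplus K - Kminus K) *m v r piN) (v q piN).
Proof.
rewrite /jump; set a := (1 + cos xi)%:C; set b := 0 +i* sin xi; set S := Kminus K + _; set D := Kplus K - _.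
suff -> : symbol 1 K xi - symbol 1 K piN = a *: toC S + b *: toC D.
  by rewrite mulmxDl -!scalemxAl hdotDl !hdotZl.
have comb (c1 c2 : C) (x y z : 'M[C]_k.+1) : c1 + 1 = a - b -> c2 + 1 = a + b ->
    x + c1 *: y + c2 *: z - (x + (-1) *: y + (-1) *: z) = a *: (y + z) + b *: (z - y).
  move=> h1 h2; transitivity ((c1 + 1) *: y + (c2 + 1) *: z).
    rewrite !scaleN1r !opprD !opprK !scalerDl !scale1r addrACA; congr (_ + _).
    by rewrite addrACA subrr add0r.
  by rewrite h1 h2 scalerBl scalerDl scalerDr scalerBr addrACA; congr (_ + _); rewrite addrC.
rewrite /symbol !mulr1 opprK cispi cisNpi /S /D.
rewrite toCD (_ : toC (_ - _) = toC (Kplus K) - toC (Kminus K)); last exact: map_mxB.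
by apply: comb; apply/eqP; rewrite eq_complex /= ?cosN ?sinN; apply/andP; split; apply/eqP; ring.
Qed.

(** The variation is of first order, but its physical diagonal entry is of second
    order because the odd part [sin xi (K+ - K-)] drops out by [nyq_skew]. *)
Lemma jump_le : exists2 A : R, 0 <= A & forall xi,
  (forall r q, nsq (jump r q xi) <= A * (1 + cos xi)) /\
  nsq (jump ord0 ord0 xi) <= A * (1 + cos xi) ^+ 2.
Proof.
pose a r q := nsq (hdot (toC (Kminus K + Kplus K) *m v r piN) (v q piN)).
pose b r q := nsq (hdot (toC (Kplus K - Kminus K) *m v r piN) (v q piN)).
have a0 r q : 0 <= a r q by exact: nsq_ge0.
have b0 r q : 0 <= b r q by exact: nsq_ge0.
pose A := \sum_r \sum_q (a r q + b r q).
have A0 r q : a r q + b r q <= A.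
  rewrite /A (bigD1 r)//= (bigD1 q)//= -addrA lerDl addr_ge0//.
    by apply: sumr_ge0 => i _; rewrite addr_ge0.
  by apply: sumr_ge0 => i _; apply: sumr_ge0 => j _; rewrite addr_ge0.
exists (4 * A) => [|xi].
  by rewrite mulr_ge0// (le_trans _ (A0 ord0 ord0))// addr_ge0.
have c1 := cos_geN1 xi; have c2 := cos_le1 xi; have cs := cos2Dsin2 xi.
have d0 : 0 <= 1 + cos xi by lra.
split=> [r q|].
  rewrite jumpE (le_trans (nsqD _ _))// !nsqM nsqR -/(a r q) -/(b r q).
  rewrite (_ : nsq (0 +i* sin xi) = sin xi ^+ 2); last by rewrite /nsq /= expr0n add0r.
  have -> : sin xi ^+ 2 = (1 + cos xi) * (1 - cos xi) by apply: (addrI (cos xi ^+ 2)); rewrite cs; ring.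
  rewrite (@le_trans _ _ (4 * (a r q + b r q) * (1 + cos xi)))//; last first.
    by rewrite ler_wpM2r// ler_wpM2l.
  have := mulr_ge0 d0 (a0 r q); have := mulr_ge0 d0 (b0 r q).
  set u := a r q; set w := b r q => h1 h2.
  have : 0 <= (1 - cos xi) * ((1 + cos xi) * u) by rewrite mulr_ge0// subr_ge0.
  have : 0 <= (1 + cos xi) * ((1 + cos xi) * w) by rewrite mulr_ge0.
  nra.
rewrite jumpE [X in _ + _ * X]nyq_skew ?mulr0 ?addr0; last first.
  by rewrite linearB /= Kplus_tr trmxK opprB.
rewrite nsqM nsqR -/(a _ _) mulrC ler_wpM2r ?sqr_ge0//.
have := A0 ord0 ord0; have := b0 ord0 ord0; have := a0 ord0 ord0; lra.
Qed.

(** Second-order perturbation theory without following the branches. Write an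
    eigenvector at [xi] in the Nyquist basis. Every component is coupled to the
    others to first order only, so a component other than the physical one is
    large only if the eigenvalue is close to another band, which makes [other_bands]
    small. If the physical component is large, its self-coupling is of second
    order, and so is the feedback through the other components. *)
Lemma band_flat : exists2 C0 : R, 0 <= C0 & forall p xi, Pi_h 1 xi ->
  other_bands (band p xi) ^+ 2 <= C0 * (1 + cos xi) \/
  `|other_bands (band p xi) * (band p xi - band ord0 piN)| <= C0 * (1 + cos xi).
Proof.
have [A A0 hA] := jump_le.
pose L := lambda ^+ 4 * k.+1%:R.
have L0 : 0 <= L by rewrite mulr_ge0// exprn_even_ge0.
pose D1 := 16 ^+ k.+1 * (L * A); pose D2 := L * (16 ^+ k.+1 * A + k.+1%:R * (D1 * A)).
have D10 : 0 <= D1 by rewrite /D1 mulr_ge0 ?exprn_ge0// mulr_ge0.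
have D20 : 0 <= D2.
  apply: mulr_ge0 => //; apply: addr_ge0; apply: mulr_ge0 => //.
  exact: mulr_ge0.
have n0 : 0 < (k.+1%:R : R) by [].
exists (k.+1%:R * (D1 + D2) + 1) => [|p xi hxi].
  by rewrite addr_ge0// mulr_ge0// addr_ge0.
have [hA1 hA2] := hA xi.
set d := 1 + cos xi in hA1 hA2 *.
have d0 : 0 <= d by rewrite /d; have := cos_geN1 xi; lra.
set x := band p xi; set w := v p xi.
pose a q := hdot w (toC M *m v q piN).
have wE : w = \sum_q a q *: v q piN by exact: onb_expand (branch_ortho PiN) w.
have asum : \sum_q nsq (a q) = 1.
  have := onb_sqnorm (mass_sym k _) (branch_ortho PiN) w.
  by rewrite branch_ortho// eqxx => /(congr1 (@complex.Re R)) /= <-.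
have a_le1 q : nsq (a q) <= 1.
  by rewrite -asum (bigD1 q)//= lerDl sumr_ge0// => i _; exact: nsq_ge0.
have key q : (x - band q piN)%:C * a q = (lambda ^+ 2)%:C * \sum_r a r * jump r q xi.
  have -> : \sum_r a r * jump r q xi =
      hdot ((symbol 1 K xi - symbol 1 K piN) *m w) (v q piN).
    rewrite {1}wE mulmx_sumr hdot_suml; apply: eq_bigr => r _.
    by rewrite -scalemxAr hdotZl.
  have wB : symbol 1 K xi *m w = (sigma p xi)%:C *: (toC M *m w) by exact: branch_eq.
  rewrite mulmxBl hdotBl wB (symbol_selfadjoint piN) (branch_eq _ PiN).
  rewrite hdotZr hdotZl conjc_real -/(a q) hdot_toC (mass_sym k 1) -/(a q).
  by rewrite /x /band -mulrBl -rmorphB /= -mulrBr mulrA -rmorphM.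
have nkey q : nsq ((x - band q piN)%:C * a q) <= L * \sum_r nsq (a r) * nsq (jump r q xi).
  rewrite key nsqM nsqR -exprM /L -mulrA ler_wpM2l ?exprn_even_ge0//.
  by rewrite (le_trans (nsq_sum _))//; under eq_bigr => r _ do rewrite nsqM.
have first q : nsq ((x - band q piN)%:C * a q) <= L * A * d.
  rewrite (le_trans (nkey q))// -mulrA ler_wpM2l//.
  rewrite -[leRHS]mul1r -asum mulr_suml; apply: ler_sum => r _.
  by rewrite ler_wpM2l ?nsq_ge0.
have W16 (P : pred 'I_k.+1) : (\prod_(q | P q) (x - band q piN)) ^+ 2 <= 16 ^+ k.+1.
  have -> : (16 : R) ^+ k.+1 = (4 ^+ k.+1) ^+ 2 by rewrite -exprM mulnC exprM; congr (_ ^+ _); ring.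
  rewrite -real_normK ?num_real// lerXn2r ?nnegrE ?exprn_ge0//.
  rewrite (le_trans (prod_dist_le _ _ hxi))// ler_eXn2l ?ltr1n//.
  by rewrite (leq_trans (max_card _))// card_ord.
set W := other_bands x.
have other r : r != ord0 -> nsq (W%:C * a r) <= D1 * d.
  move=> r0; rewrite /W /other_bands (bigD1 r)//= [(_ - _) * _]mulrC rmorphM /= -mulrA nsqM nsqR.
  by rewrite /D1 -mulrA; apply: ler_pM; rewrite ?sqr_ge0 ?nsq_ge0 ?W16.
have self : nsq ((W * (x - band ord0 piN))%:C * a ord0) <= D2 * d ^+ 2.
  have W2 : W ^+ 2 <= 16 ^+ k.+1 by exact: W16.
  rewrite rmorphM /= -mulrA nsqM nsqR.
  rewrite (le_trans (ler_wpM2l (sqr_ge0 _) (nkey _)))//.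
  rewrite mulrCA /D2 -[leRHS]mulrA ler_wpM2l// mulr_sumr (bigD1 ord0)//= [leRHS]mulrDl lerD//.
    rewrite -mulrA; apply: ler_pM; rewrite ?sqr_ge0 ?mulr_ge0 ?nsq_ge0//.
    by rewrite -[leRHS]mul1r; apply: ler_pM; rewrite ?nsq_ge0.
  rewrite (@le_trans _ _ (\sum_(r : 'I_k.+1 | r != ord0) D1 * A * d ^+ 2))//.
    apply: ler_sum => r r0; rewrite mulrA -[W ^+ 2]nsqR -nsqM.
    have -> : D1 * A * d ^+ 2 = D1 * d * (A * d) by ring.
    by apply: ler_pM; rewrite ?nsq_ge0 ?other.
  rewrite sumr_const -[leLHS]mulr_natl -[leRHS]mulrA ler_wpM2r//.
    exact: mulr_ge0 (mulr_ge0 D10 A0) (sqr_ge0 d).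
  by rewrite ler_nat (leq_trans (max_card _))// card_ord.
have [q hq] : exists q, k.+1%:R^-1 <= nsq (a q).
  apply/existsP; apply: contraT => /existsPn h.
  have : \sum_q nsq (a q) < \sum_(q < k.+1) k.+1%:R^-1.
    apply: ltr_sum => [|q _]; last by rewrite ltNge h.
    by apply/hasP; exists ord0; rewrite ?mem_index_enum.
  by rewrite asum sumr_const card_ord -[ltRHS]mulr_natl divff ?gt_eqF// ltxx.
(* A component of squared modulus at least [1 / (k + 1)] can be divided out. *)
have drop y D : 0 <= y -> y * nsq (a q) <= D -> y <= k.+1%:R * D.
  move=> y0 h; rewrite -ler_pdivrMl// mulrC (le_trans _ h)// ler_wpM2l//.
have [q0|q0] := eqVneq q ord0; [right|left].
  rewrite q0 in drop hq.
  have := self; rewrite nsqM nsqR => /(drop _ _ (sqr_ge0 _)) h.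
  set y := W * _ in h *.
  have h1 : `|y| ^+ 2 <= k.+1%:R * D2 * d ^+ 2 by rewrite real_normK ?num_real// -mulrA.
  rewrite leNgt; apply/negP => hy.
  have E0 : 0 <= k.+1%:R * D1 by rewrite mulr_ge0.
  have E2 : 0 <= k.+1%:R * D2 by rewrite mulr_ge0.
  have : ((k.+1%:R * (D1 + D2) + 1) * d) ^+ 2 < `|y| ^+ 2.
    by rewrite ltrXn2r ?nnegrE// mulr_ge0// addr_ge0// mulr_ge0// addr_ge0.
  rewrite ltNge => /negP[]; rewrite (le_trans h1)// exprMn ler_wpM2r ?sqr_ge0//.
  by rewrite mulrDr; nra.
have := other q q0; rewrite nsqM nsqR => /(drop _ _ (sqr_ge0 _)) h.
rewrite (le_trans h)// mulrA ler_wpM2r// mulrDr.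
have : 0 <= k.+1%:R * D2 by rewrite mulr_ge0.
lra.
Qed.

Lemma other_bands_neq0 : lambda != 0 -> other_bands (band ord0 piN) != 0.
Proof.
move=> l0; rewrite prodf_seq_neq0; apply/allP => q _; apply/implyP => q0.
by rewrite -mulrBr mulf_neq0 ?expf_neq0// subr_eq0 nyq_distinct// eq_sym.
Qed.

End Bands.

(** * Finitely supported sequences and the discrete Fourier transform *)

Lemma cis_nat (R : realType) (t : R) n : cis (n%:R * t) = cis t ^+ n :> R[i].
Proof.
elim: n => [|n IHn]; first by rewrite mul0r cis0 expr0.
by rewrite -natr1 mulrDl mul1r cisD IHn exprSr.
Qed.

Lemma cis_neq1 (R : realType) (t : R) : 0 < t < 2 * pi -> cis t != 1 :> R[i].
Proof.
move=> /andP[t0 t2]; rewrite eq_complex /= negb_and; apply/orP; left.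
have s0 : 0 < sin (t / 2).
  by rewrite sin_gt0_pi// divr_gt0//= ltr_pdivrMr// mulrC.
have -> : cos t = 1 - 2 * sin (t / 2) ^+ 2.
  have {1}-> : t = t / 2 + t / 2 by rewrite -splitr.
  rewrite cosD -!expr2; have := cos2Dsin2 (t / 2); lra.
rewrite lt_eqF// ltrBlDr ltrDl mulr_gt0// exprn_gt0//.
Qed.

Section WindowSums.
Implicit Types (B : nat) (j : int).

Definition site B (i : 'I_(2 * B).+1) : int := i%:Z - B%:Z.
Definition wsum (V : nmodType) B (f : int -> V) : V := \sum_(i < (2 * B).+1) f (site i).

Lemma site_le B (i : 'I_(2 * B).+1) : (`|site i| <= B)%N.
Proof. by have := ltn_ord i; rewrite /site; lia. Qed.

Lemma siteP B j : (`|j| <= B)%N -> exists i : 'I_(2 * B).+1, j = site i.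
Proof.
move=> jB; have h : (`|(j + B%:Z)%R| < (2 * B).+1)%N by lia.
by exists (Ordinal h); rewrite /site /=; lia.
Qed.

Lemma wsum_shift (V : zmodType) B (f : int -> V) :
  f (B%:Z + 1) = 0 -> f (- B%:Z) = 0 -> wsum B (fun j => f (j + 1)) = wsum B f.
Proof.
move=> f1 f2; apply/eqP; rewrite -subr_eq0 /wsum -sumrB; apply/eqP.
pose g i := f (i%:Z - B%:Z).
transitivity (\sum_(0 <= i < (2 * B).+1) (g i.+1 - g i)).
  rewrite big_mkord; apply: eq_bigr => i _; rewrite /g /site; congr (f _ - _).
  by lia.
rewrite telescope_sumr// /g; have -> : ((2 * B).+1%:Z - B%:Z = B%:Z + 1)%R by lia.
by rewrite f1 (_ : f (0%:Z - B%:Z) = 0) ?subr0// -f2; congr f; lia.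
Qed.

Lemma wsum_ge (R : numDomainType) B (f : int -> R) j :
  (forall i, 0 <= f i) -> (`|j| <= B)%N -> f j <= wsum B f.
Proof.
move=> f0 /siteP[i ->]; rewrite /wsum (bigD1 i)//= lerDl sumr_ge0//.
Qed.

Lemma esum_finite (R : realType) (A : set int) (g : int -> \bar R) B :
  (forall j, 0 <= g j)%E -> (forall j, (B < `|j|)%N -> g j = 0%E) ->
  esum A g = (\sum_(i < (2 * B).+1) (if site i \in A then g (site i) else 0))%E.
Proof.
move=> g0 gB.
pose s := [seq site i | i <- enum 'I_(2 * B).+1].
have us : uniq s.
  rewrite map_inj_uniq ?enum_uniq// => i j; rewrite /site => ij.
  have ij' : (i : nat) = j by move: ij => /=; lia.
  exact: val_inj.
have ms j : (j \in s) = (`|j| <= B)%N.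
  apply/mapP/idP => [[i _ ->]|/siteP[i ->]]; first exact: site_le.
  by exists i; rewrite ?mem_enum.
rewrite esum_mkcond.
transitivity (esum [set` s] (fun j => if j \in A then g j else 0%E)).
  rewrite [RHS]esum_mkcond; apply: eq_esum => j _.
  have [js|js] := boolP (j \in s); first by rewrite (@mem_set _ [set` s]).
  rewrite (@memNset _ [set` s]); last exact/negP.
  by case: ifP => // _; rewrite gB// ltnNge -ms.
rewrite esum_fset; [|exact: finite_seq|by move=> j _; case: ifP].
by rewrite -fsbig_seq// /s big_map big_enum.
Qed.

(** The positive and negative parts in the definition of a sum over a set of
    integers recombine as soon as the family has finite support. *)
Lemma zsum_finite (R : realType) (A : set int) (f : int -> R) B :
  (forall j, (B < `|j|)%N -> f j = 0) ->
  zsum A f = wsum B (fun j => if j \in A then f j else 0).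
Proof.
move=> f0; have es := @esum_finite R A _ B.
rewrite /zsum es; [|by move=> j; rewrite funeposE le_max lexx orbT|]; last first.
  by move=> j /f0 fj; rewrite funeposE /= fj maxxx.
rewrite es; [|by move=> j; rewrite funenegE le_max lexx orbT|]; last first.
  by move=> j /f0 fj; rewrite funenegE /= fj oppr0 maxxx.
rewrite (eq_bigr (fun i => (if site i \in A then Num.max (f (site i)) 0 else 0)%:E)); last first.
  by move=> i _; rewrite funeposE; case: ifP => // _; rewrite EFin_max.
rewrite [X in (_ - X)%E](eq_bigr (fun i => (if site i \in A then Num.max (- f (site i)) 0 else 0)%:E)); last first.
  by move=> i _; rewrite funenegE; case: ifP => // _; rewrite EFin_max.
rewrite !sumEFin /= /wsum -sumrB; apply: eq_bigr => i _.
case: ifP => // _; last by rewrite subrr.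
case: (lerP 0 (f (site i))) => h.
  by rewrite [Num.max (- _) _]max_r ?subr0// oppr_le0.
by rewrite [Num.max (- _) _]max_l ?sub0r ?opprK// oppr_ge0 ltW.
Qed.

End WindowSums.

Section Frequencies.
Variable R : realType.
Local Notation C := R[i].

(** The sampling starts at [- pi] so as to contain the Nyquist frequency. *)
Definition freq (Q t : nat) : R := 2 * pi * t%:R / Q%:R - pi.

Lemma freq_itv Q t : (t < Q)%N -> Pi_h 1 (freq Q t).
Proof.
move=> tQ; have Q0 : 0 < (Q%:R : R) by rewrite ltr0n; lia.
have p0 := pi_ge0 R.
rewrite Pi1E /freq lerBrDr addNr lerBlDr; apply/andP; split.
  by rewrite divr_ge0 ?(ltW Q0)// !mulr_ge0.
rewrite ler_pdivrMr// (_ : pi + pi = 2 * pi); last by ring.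
by rewrite ler_wpM2l ?mulr_ge0// ler_nat ltnW.
Qed.

Lemma freq_orthogonality Q (d : int) : (0 < `|d| < Q)%N ->
  \sum_(t < Q) cis (freq Q t * d%:~R) = 0 :> C.
Proof.
have pos (n : nat) : (0 < n < Q)%N -> \sum_(t < Q) cis (freq Q t * n%:R) = 0 :> C.
  move=> /andP[n0 nQ]; have Q0 : 0 < (Q%:R : R) by rewrite ltr0n; lia.
  pose w : C := cis (2 * pi * n%:R / Q%:R).
  have -> : \sum_(t < Q) cis (freq Q t * n%:R) = cis (- pi * n%:R) * \sum_(t < Q) w ^+ t :> C.
    rewrite mulr_sumr; apply: eq_bigr => t _; rewrite /w -cis_nat -cisD; congr cis.
    by rewrite /freq; ring.
  have w1 : w != 1.
    have p0 : 0 < 2 * (pi : R) by rewrite mulr_gt0// pi_gt0.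
    apply: cis_neq1; apply/andP; split; first by rewrite divr_gt0// mulr_gt0// ltr0n.
    by rewrite ltr_pdivrMr// ltr_pM2l// ltr_nat.
  have wQ : w ^+ Q = 1.
    rewrite /w -cis_nat mulrC divfK ?gt_eqF// mulrC cis_nat /cis.
    rewrite mulr_natl cos2pi sin2pi. by rewrite expr1n.
  have := subrX1 w Q; rewrite wQ subrr => /esym/eqP; rewrite mulf_eq0 subr_eq0 (negPf w1) /=.
  by move=> /eqP ->; rewrite mulr0.
case: d => n hn; first exact: pos.
rewrite -[LHS]conjcK rmorph_sum /= (_ : \sum_(i < Q) _ = 0) ?conjc0//.
rewrite -[RHS](pos n.+1)//; apply: eq_bigr => t _.
transitivity (conjc (cis (freq Q t * (Negz n)%:~R)) : C) => //; rewrite cisJ; congr cis.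
by rewrite NegzE rmorphN /= mulrN opprK.
Qed.

End Frequencies.

Section Hat.
Variables (R : realType) (k : nat).
Local Notation C := R[i].
Local Notation V := ('cV[C]_k.+1).
Implicit Types (U W : int -> V) (B : nat) (xi : R).

Definition supp B U := forall j, (B < `|j|)%N -> U j = 0.

Lemma suppW B B' U : (B <= B')%N -> supp B U -> supp B' U.
Proof. by move=> BB h j jB; apply: h; exact: leq_ltn_trans jB. Qed.

Definition hat B xi U : V := wsum B (fun j => cis (- (xi * j%:~R)) *: U j).

Lemma hatD B xi U W : hat B xi (fun j => U j + W j) = hat B xi U + hat B xi W.
Proof. by rewrite /hat /wsum -big_split; apply: eq_bigr => i _; rewrite scalerDr. Qed.

Lemma hatZ B xi (a : C) U : hat B xi (fun j => a *: U j) = a *: hat B xi U.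
Proof. by rewrite /hat /wsum scaler_sumr; apply: eq_bigr => i _; rewrite !scalerA mulrC. Qed.

Lemma hatM B xi (A : 'M[C]_k.+1) U : hat B xi (fun j => A *m U j) = A *m hat B xi U.
Proof. by rewrite /hat /wsum mulmx_sumr; apply: eq_bigr => i _; rewrite scalemxAr. Qed.

Lemma hat_sum B xi n (F : 'I_n -> int -> V) :
  hat B xi (fun j => \sum_i F i j) = \sum_i hat B xi (F i).
Proof. by rewrite /hat /wsum exchange_big; apply: eq_bigr => i _; rewrite scaler_sumr. Qed.

Lemma eq_hat B xi U W : U =1 W -> hat B xi U = hat B xi W.
Proof. by move=> h; apply: eq_bigr => i _; rewrite h. Qed.

Lemma hat_next B B' xi U : (B' < B)%N -> supp B' U ->
  hat B xi (fun j => U (j + 1)) = cis xi *: hat B xi U.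
Proof.
move=> BB hU; rewrite -hatZ /hat.
rewrite -[RHS]wsum_shift ?hU ?scaler0//; [|by lia|by lia].
apply: eq_bigr => i _; rewrite scalerA -cisD; congr (cis _ *: _).
by rewrite intrD; ring.
Qed.

Lemma hat_prev B B' xi U : (B' < B)%N -> supp B' U ->
  hat B xi (fun j => U (j - 1)) = cis (- xi) *: hat B xi U.
Proof.
move=> BB hU; rewrite -hatZ /hat.
rewrite -[LHS]wsum_shift ?hU ?scaler0//; [|by lia|by lia].
apply: eq_bigr => i _; rewrite addrK scalerA -cisD; congr (cis _ *: _).
by rewrite intrD; ring.
Qed.

(** As many frequencies as cells in the window make the identity exact. *)
Lemma parseval B (M : 'M[R]_k.+1) U :
  \sum_(t < (2 * B).+1) hdot (hat B (freq R (2 * B).+1 t) U)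
     (toC M *m hat B (freq R (2 * B).+1 t) U)
  = (2 * B).+1%:R * wsum B (fun j => hdot (U j) (toC M *m U j)).
Proof.
set Q := (2 * B).+1.
transitivity (\sum_(t < Q) \sum_(i < Q) \sum_(l < Q)
   cis (freq R Q t * (site l - site i)%:~R) * hdot (U (site i)) (toC M *m U (site l))).
  apply: eq_bigr => t _; rewrite /hat /wsum hdot_suml; apply: eq_bigr => i _.
  rewrite mulmx_sumr hdot_sumr; apply: eq_bigr => l _.
  rewrite -scalemxAr hdotZl hdotZr cisJ opprK mulrA -cisD; congr (cis _ * _).
  by rewrite intrB; ring.
rewrite exchange_big /wsum mulr_sumr; apply: eq_bigr => i _ /=.
rewrite exchange_big (bigD1 i)//= subrr [X in _ + X]big1 ?addr0 => [|l li].
  rewrite -mulr_suml; congr (_ * _).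
  by under eq_bigr => t _ do rewrite mulr0 cis0; rewrite sumr_const card_ord.
rewrite -mulr_suml freq_orthogonality ?mul0r//.
have : (l : nat) != i by []. have := ltn_ord l; have := ltn_ord i.
rewrite /site /Q; lia.
Qed.

End Hat.

(** * Evolution on the lattice *)

Fixpoint rec2 (T : Type) (F : T -> T -> T) (u w : T) (n : nat) : T :=
  if n is m.+1 then rec2 F w (F u w) m else u.

Lemma rec2SS (T : Type) (F : T -> T -> T) u w n :
  rec2 F u w n.+2 = F (rec2 F u w n) (rec2 F u w n.+1).
Proof. by elim: n u w => [//|n IHn] u w; exact: IHn. Qed.

Section Evolution.
Variables (R : realType) (k : nat) (lambda : R) (K : stencil R k).
Local Open Scope complex_scope.
Local Notation C := R[i].
Local Notation V := ('cV[C]_k.+1).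
Local Notation M := (mass k (1 : R)).
Implicit Types (U W : int -> V) (B : nat) (xi : R).

(** The scheme on the unit mesh reads [U^(n+2) - 2 U^(n+1) + U^n = - L U^(n+1)]. *)
Definition lattice_op U (j : int) : V :=
  (lambda ^+ 2)%:C *: (toC (invmx M) *m stiff_op K U j).

Definition evol U W : nat -> int -> V :=
  rec2 (fun U W j => 2%:R *: W j - U j - lattice_op W j) U W.

Definition avg_op U (j : int) : V := 2^-1 *: (U (j - 1) + U (j + 1)).

(** [T_n(e - avg_op) U]. *)
Definition cheb_op (e : R) U : nat -> int -> V :=
  rec2 (fun U W j => 2%:R *: (e%:C *: W j - avg_op W j) - U j)
       U (fun j => e%:C *: U j - avg_op U j).

Definition poly_op (p : {poly R}) U (j : int) : V :=
  \sum_(i < size p) (p`_i)%:C *: iter i lattice_op U j.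

Definition single (w : V) (j : int) : V := if j == 0 then w else 0.

Lemma supp_lattice_op B U : supp B U -> supp B.+1 (lattice_op U).
Proof.
by move=> h j jB; rewrite /lattice_op /stiff_op !h ?mulmx0 ?addr0 ?mulmx0 ?scaler0//; lia.
Qed.

Lemma supp_avg_op B U : supp B U -> supp B.+1 (avg_op U).
Proof. by move=> h j jB; rewrite /avg_op !h ?addr0 ?scaler0//; lia. Qed.

Lemma supp_evol B U W n : supp B U -> supp B W -> supp (B + n) (evol U W n).
Proof.
move=> hU hW; elim/nat_ind2: n => [||n IH1 IH2].
- by rewrite addn0.
- by apply: suppW hW; rewrite leq_addr.
have h3 := supp_lattice_op IH2.
move=> j jB; rewrite /evol rec2SS -!/(evol _ _ _) IH1 ?IH2 ?h3 ?scaler0 ?subr0//; lia.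
Qed.

Lemma supp_cheb B e U n : supp B U -> supp (B + n) (cheb_op e U n).
Proof.
move=> hU; elim/nat_ind2: n => [||n IH1 IH2].
- by rewrite addn0.
- move=> j jB; rewrite /cheb_op /= hU ?scaler0 ?sub0r ?(supp_avg_op hU) ?oppr0//; lia.
have h3 := supp_avg_op IH2.
move=> j jB; rewrite /cheb_op rec2SS -!/(cheb_op _ _ _) IH1 ?IH2 ?h3 ?scaler0 ?subr0 ?scaler0//; lia.
Qed.

Lemma supp_iter B U n : supp B U -> supp (B + n) (iter n lattice_op U).
Proof.
move=> hU; elim: n => [|n IHn]; first by rewrite addn0.
by rewrite addnS; exact: supp_lattice_op.
Qed.

Lemma supp_poly_op B U (p : {poly R}) d : supp B U -> (size p <= d.+1)%N ->
  supp (B + d) (poly_op p U).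
Proof.
move=> hU sp j jB; rewrite /poly_op big1// => i _.
rewrite (supp_iter hU) ?scaler0//; have := ltn_ord i; lia.
Qed.

Lemma supp_single w : supp 0 (single w).
Proof. by move=> j j0; rewrite /single; case: eqP j0 => // ->. Qed.

Lemma hat_single B xi w : hat B xi (single w) = w.
Proof.
have [i0 hi0] : exists i : 'I_(2 * B).+1, (0 : int) = site i by apply: siteP.
rewrite /hat /wsum (bigD1 i0)//= -hi0 mulr0 oppr0 cis0 scale1r /single eqxx.
rewrite big1 ?addr0// => i ii0; case: eqP => [h|_]; last by rewrite scaler0.
have : (i : nat) != i0 by []. by move: h hi0; rewrite /site; lia.
Qed.

Lemma hat_stiff B B' xi U : (B' < B)%N -> supp B' U ->
  hat B xi (stiff_op K U) = symbol 1 K xi *m hat B xi U.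
Proof.
move=> BB hU; rewrite symbolE.
rewrite (eq_hat _ _ (W := fun j =>
    (toC (Kminus K) *m U (j - 1) + toC (Kzero K) *m U j) + toC (Kplus K) *m U (j + 1)))//.
rewrite hatD hatD !hatM (hat_prev _ BB hU) (hat_next _ BB hU) -!scalemxAr.
by congr (_ + _); rewrite addrC.
Qed.

Lemma hat_avg_op B B' xi U : (B' < B)%N -> supp B' U ->
  hat B xi (avg_op U) = (cos xi)%:C *: hat B xi U.
Proof.
move=> BB hU; rewrite hatZ hatD (hat_prev _ BB hU) (hat_next _ BB hU) -scalerDl scalerA.
congr (_ *: _); apply/eqP; rewrite -(inj_eq (mulfI (_ : (2 : C) != 0)))// mulrA divff// mul1r.
by rewrite eq_complex /= cosN sinN; apply/andP; split; apply/eqP; ring.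
Qed.

Lemma hat_cheb B B' e xi U n : (B' + n < B)%N -> supp B' U ->
  hat B xi (cheb_op e U n) = (chebyT (e - cos xi) n)%:C *: hat B xi U.
Proof.
move=> + hU; elim/nat_ind2: n => [|BB|n IH1 IH2 BB].
- by rewrite scale1r.
- rewrite [cheb_op _ _ _]/= /chebyT /= rmorphB scalerBl -(@hat_avg_op _ B') //; last by lia.
  by rewrite -hatZ /hat /wsum -sumrB; apply: eq_bigr => i _; rewrite scalerBr.
have s1 := supp_cheb e hU (n := n.+1).
rewrite /cheb_op rec2SS -!/(cheb_op _ _ _) (eq_hat _ _ (W := fun j =>
    2%:R *: (e%:C *: cheb_op e U n.+1 j + (-1) *: avg_op (cheb_op e U n.+1) j)
    + (-1) *: cheb_op e U n j)); last first.
  by move=> j; rewrite !scaleN1r.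
rewrite hatD (hatZ _ _ (-1) (cheb_op e U n)) hatZ hatD.
rewrite (hatZ _ _ _ (cheb_op e U n.+1)) (hatZ _ _ _ (avg_op (cheb_op e U n.+1))).
rewrite (hat_avg_op _ _ s1); last by lia.
rewrite IH1 ?IH2; [|lia|lia].
rewrite /chebyT rec_seqSS -!/(chebyT _ _) !scalerA -scalerDl scalerA -scalerDl; congr (_ *: _).
by rewrite !(rmorphB, rmorphM) rmorph_nat /=; ring.
Qed.

End Evolution.

Section Modes.
Variables (R : realType) (k : nat) (lambda : R) (K : stencil R k).
Variables (sigma : 'I_k.+1 -> R -> R) (v : 'I_k.+1 -> R -> 'cV[R[i]]_k.+1).
Hypothesis Kldg : ldg_stencil 1 K.
Hypothesis branches : eigen_branches 1 K sigma v.
Local Open Scope complex_scope.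
Local Notation C := R[i].
Local Notation V := ('cV[C]_k.+1).
Local Notation M := (mass k (1 : R)).
Local Notation piN := (- pi : R).
Local Notation x_ := (band lambda sigma).
Local Notation L := (lattice_op lambda K).
Implicit Types (U W : int -> V) (B : nat) (xi : R).

(** Component of [U] on the Bloch wave of the branch [p] at frequency [xi]. *)
Definition mode B p xi U : C := hdot (hat B xi U) (toC M *m v p xi).

Lemma modeD B p xi U W : mode B p xi (fun j => U j + W j) = mode B p xi U + mode B p xi W.
Proof. by rewrite /mode hatD hdotDl. Qed.

Lemma modeZ B p xi a U : mode B p xi (fun j => a *: U j) = a * mode B p xi U.
Proof. by rewrite /mode hatZ hdotZl. Qed.

Lemma modeB B p xi U W : mode B p xi (fun j => U j - W j) = mode B p xi U - mode B p xi W.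
Proof.
rewrite -[X in _ - X]mul1r -mulNr -modeZ -modeD /mode; congr hdot; apply: eq_hat => j.
by rewrite scaleN1r.
Qed.

Lemma mass1_unit : M \in unitmx.
Proof. exact: onb_unit (mass_sym k _) (branch_ortho branches (PiN R)). Qed.

Lemma mode_lattice_op B B' p xi U : Pi_h 1 xi -> (B' < B)%N -> supp B' U ->
  mode B p xi (L U) = (x_ p xi)%:C * mode B p xi U.
Proof.
move=> hxi BB hU; rewrite /mode /lattice_op hatZ hatM (hat_stiff _ _ BB hU) hdotZl.
rewrite hdot_toC mulmxA -toCM.
have -> : (invmx M)^T *m M = 1%:M.
  by rewrite trmx_inv mass_sym mulVmx// mass1_unit.
rewrite /toC map_mx1 mul1mx (symbol_selfadjoint Kldg branches) (branch_eq branches)//.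
by rewrite hdotZr conjc_real mulrA -rmorphM.
Qed.

(** The modes diagonalize the evolution started from zero displacement. *)
Lemma mode_evol B B' p xi U n : Pi_h 1 xi -> (B' + n < B)%N -> supp B' U ->
  mode B p xi (evol lambda K (fun=> 0) U n) = (leapfrog (x_ p xi) n)%:C * mode B p xi U.
Proof.
move=> hxi + hU; have h0 : supp B' (fun=> 0 : V) by [].
elim/nat_ind2: n => [|BB|n IH1 IH2 BB].
- rewrite /mode /leapfrog /= mul0r => _; rewrite /hat /wsum big1 ?hdot0l// => i _.
  by rewrite scaler0.
- by rewrite /leapfrog /= mul1r.
have s1 := supp_evol lambda K (n := n.+1) h0 hU.
rewrite /evol rec2SS -!/(evol _ _ _ _).
rewrite modeB modeB modeZ (mode_lattice_op _ hxi _ s1); last by lia.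
rewrite IH1 ?IH2; [|lia|lia].
by rewrite /leapfrog rec_seqSS -!/(leapfrog _ _) !(rmorphB, rmorphM) rmorph_nat /=; ring.
Qed.

Lemma mode_poly_op B B' p xi (q : {poly R}) U : Pi_h 1 xi -> (B' + size q <= B)%N -> supp B' U ->
  mode B p xi (poly_op lambda K q U) = (q.[x_ p xi])%:C * mode B p xi U.
Proof.
move=> hxi BB hU; rewrite /mode hat_sum hdot_suml horner_coef rmorph_sum mulr_suml.
apply: eq_bigr => i _.
rewrite [hat _ _ _](hatZ _ _ _ (iter i L U)) hdotZl -/(mode B p xi (iter i L U)).
rewrite rmorphM -mulrA; congr (_ * _).
have := ltn_ord i; move: (nat_of_ord i) => l lq.
elim: l lq => [|l IHl] lq; first by rewrite expr0 mul1r.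
rewrite iterS (mode_lattice_op _ hxi _ (supp_iter lambda K (n := l) hU)); last by lia.
by rewrite IHl ?exprS ?rmorphM ?mulrA//; lia.
Qed.

(** Up to a constant factor, the energy of the solution that starts from 0 with
    velocity [U]. *)
Definition energy2 B U : R := wsum B (fun j => complex.Re (hdot (U j) (toC M *m U j))).

Lemma energy2_modes B U : (2 * B).+1%:R * energy2 B U =
  \sum_(t < (2 * B).+1) \sum_p nsq (mode B p (freq R (2 * B).+1 t) U).
Proof.
have -> : energy2 B U = complex.Re (wsum B (fun j => hdot (U j) (toC M *m U j))).
  by rewrite /energy2 /wsum raddf_sum.
apply: complexI; rewrite rmorphM rmorph_nat.
have real : (complex.Re (wsum B (fun j => hdot (U j) (toC M *m U j))))%:C =
    wsum B (fun j => hdot (U j) (toC M *m U j)).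
  rewrite /wsum raddf_sum rmorph_sum; apply: eq_bigr => i _ /=.
  by rewrite (onb_sqnorm (mass_sym k _) (branch_ortho branches (PiN R))).
rewrite [X in _ * X]real -parseval rmorph_sum; apply: eq_bigr => t _.
by rewrite (onb_sqnorm (mass_sym k _) (branch_ortho branches (freq_itv R (ltn_ord t)))).
Qed.

(** The Nyquist frequency is one of the sampled ones, so the Parseval sum keeps
    it. *)
Lemma mode_le_energy2 B p U :
  nsq (mode B p piN U) <= (2 * B).+1%:R * energy2 B U.
Proof.
rewrite energy2_modes; have f0 : freq R (2 * B).+1 0 = piN.
  by rewrite /freq mulr0 mul0r sub0r.
rewrite (bigD1 (ord0 : 'I_(2 * B).+1))//= (bigD1 p)//= f0 -addrA lerDl addr_ge0//.
  by apply: sumr_ge0 => i _; exact: nsq_ge0.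
by apply: sumr_ge0 => i _; apply: sumr_ge0 => l _; exact: nsq_ge0.
Qed.

(** Parseval, then coercivity of the mass matrix in each cell. *)
Lemma pointwise_from_modes : exists2 c : R, 0 < c & forall B U eta,
  (forall p xi, Pi_h 1 xi -> nsq (mode B p xi U) <= eta) ->
  forall j, (`|j| <= B)%N -> sq (U j) <= c * eta.
Proof.
have [c c0 hc] := onb_coercive (mass_sym k _) (branch_ortho branches (PiN R)).
exists (c * k.+1%:R) => [|B U eta h j jB]; first by rewrite mulr_gt0.
have Q0 : 0 < ((2 * B).+1%:R : R) by [].
rewrite (le_trans (hc _))// -mulrA ler_wpM2l ?(ltW c0)//.
have hE : energy2 B U <= k.+1%:R * eta.
  rewrite -(ler_pM2l Q0) energy2_modes.
  have -> : (2 * B).+1%:R * (k.+1%:R * eta) = \sum_(t < (2 * B).+1) \sum_(p < k.+1) eta.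
    by rewrite !sumr_const !card_ord -[RHS]mulr_natl -[in RHS](mulr_natl eta).
  by apply: ler_sum => t _; apply: ler_sum => p _; rewrite h//; exact: freq_itv.
apply: (le_trans _ hE); apply: (wsum_ge (f := fun j => complex.Re (hdot (U j) (toC M *m U j)))) => // i.
rewrite (onb_sqnorm (mass_sym k _) (branch_ortho branches (PiN R))) /=.
by apply: sumr_ge0 => p _; exact: nsq_ge0.
Qed.

End Modes.

(** * The localized packet *)

Section Packet.
Variables (R : realType) (k : nat) (lambda tau : R) (K : stencil R k).
Variables (sigma : 'I_k.+1 -> R -> R) (v : 'I_k.+1 -> R -> 'cV[R[i]]_k.+1).
Hypothesis Kldg : ldg_stencil 1 K.
Hypothesis branches : eigen_branches 1 K sigma v.
Hypotheses (lambda0 : 0 < lambda) (tau0 : 0 < tau).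
Local Open Scope complex_scope.
Local Notation C := R[i].
Local Notation V := ('cV[C]_k.+1).
Local Notation M := (mass k (1 : R)).
Local Notation piN := (- pi : R).
Local Notation x_ := (band lambda sigma).
Local Notation evol0 := (evol lambda K (fun=> 0)).
Hypothesis band_le4 : forall p xi, Pi_h 1 xi -> x_ p xi <= 4.
Hypothesis band_lt4 : x_ ord0 piN < 4.

Definition other_bands_poly : {poly R} := \prod_(q | q != ord0) ('X - (x_ q piN)%:P).

Lemma horner_other_bands y : other_bands_poly.[y] = other_bands lambda sigma y.
Proof.
by rewrite /other_bands_poly horner_prod; apply: eq_bigr => q _; rewrite !hornerE.
Qed.

Lemma size_other_bands_exp n : (size (other_bands_poly ^+ n) <= (k * n).+1)%N.
Proof.
have card : #|(fun q : 'I_k.+1 => q != ord0)| = k.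
  by have := cardC1 (ord0 : 'I_k.+1); rewrite card_ord.
have s1 : (size other_bands_poly <= k.+1)%N.
  rewrite /other_bands_poly (leq_trans (size_poly_prod_leq _ _))//.
  under eq_bigr => q _ do rewrite size_XsubC.
  by rewrite sum_nat_const card; lia.
rewrite (leq_trans (size_poly_exp_leq _ _))// ltnS leq_mul//.
by move: s1; case: (size _).
Qed.

(** [a] is the packet, [B0] the radius of its support together with the range of
    the Taylor polynomial, and [D] is proportional to [J]. The solution far away is
    compared with the energy of [a], bounded below by its peak at the physical
    Nyquist mode; the window [B] is any one that contains the solution up to step
    [N]. *)
Lemma lattice_packet : exists (s : nat) (c : R), [/\ (0 < s)%N, 0 < c &
  forall (J : R) (N : nat), 4 * s%:R <= J -> N%:R = tau * J ->
  exists (a : int -> V) (B0 D : nat), [/\ supp B0 a, B0%:R <= J, J <= 4 * s%:R * D%:R &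
  forall B, (B0 + N < B)%N -> 0 < energy2 B a /\
    forall n j, (n <= N)%N -> J - 1 < (`|j|%N)%:R ->
    sq (evol0 a n j) <= c * (2 * B).+1%:R * N%:R ^+ 2 * 4 ^- D * energy2 B a]].
Proof.
pose z := x_ ord0 piN.
have z0 : 0 < z by rewrite /z /band mulr_gt0 ?exprn_gt0// (nyq_gt0 Kldg branches).
have z04 : 0 <= z <= 4 by rewrite !ltW.
have [G G0 hG] := @leapfrog_bounded _ z (introT andP (conj z0 band_lt4)).
have [C0 C00 hC0] := band_flat Kldg branches band_le4.
pose w := `|other_bands lambda sigma z|.
have w0 : 0 < w.
  by rewrite normr_gt0 (other_bands_neq0 Kldg branches)// gt_eqF.
have [b [r [b0 r1 hp]]] := packet_parameters k G0 C00 w0 tau0.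
have [c1 c10 hc1] := pointwise_from_modes branches.
pose s := (b + 2 * k + 2)%N.
have s0 : (0 < s)%N by rewrite /s addn2.
have s0R : 1 <= (s%:R : R) by rewrite ler1n.
exists s, (4 * c1); split; [exact: s0|by rewrite mulr_gt0|].
move=> J N sJ NJ.
pose D := Num.truncn (J / (2 * s%:R)).
have p2s : 0 < 2 * (s%:R : R) by rewrite mulr_gt0// ltr0n.
have J2 : 2 <= J / (2 * s%:R) by rewrite ler_pdivlMr//; lra.
have D2 : (2 <= D)%N by rewrite truncn_ge_nat// (le_trans _ J2).
have /andP[DJ JD] := truncn_itv (le_trans (ler0n R 2) J2).
rewrite -/D in DJ JD.
have D2R : 2 <= (D%:R : R) by rewrite ler_nat.
rewrite ler_pdivlMr// in DJ; rewrite ltr_pdivrMr// -natr1 in JD.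
pose e := (r + r^-1) / 2 - 1.
pose v0 := v ord0 piN; pose m := (b * D)%N.
pose filt := cheb_op e (single v0) m.
have sf : supp m filt by rewrite -[m]add0n; exact: supp_cheb (supp_single v0).
pose a := poly_op lambda K (other_bands_poly ^+ (2 * D)) filt.
have sa : supp (m + k * (2 * D)) a by apply: supp_poly_op => //; exact: size_other_bands_exp.
pose B0 := (m + k * (2 * D) + D)%N.
have B0s : (B0 <= s * D)%N.
  by rewrite /B0 /m /s; move: (D) => d; clear; nia.
have B0J : B0%:R <= J / 2.
  rewrite ler_pdivlMr// (le_trans _ DJ)// [_ * 2]mulrC mulrCA ler_wpM2l//.
  by rewrite mulrC -natrM ler_nat.
exists a, B0, D; split.
- by apply: suppW sa; rewrite leq_addr.
- by rewrite (le_trans B0J)//; lra.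
- have : (s%:R : R) * 2 <= s%:R * D%:R by rewrite ler_wpM2l.
  by nra.
move=> B hB.
have mode_a p xi : Pi_h 1 xi -> mode v B p xi a =
    (other_bands lambda sigma (x_ p xi) ^+ (2 * D) * chebyT (e - cos xi) m)%:C
    * hdot v0 (toC M *m v p xi).
  move=> hxi; rewrite /a (mode_poly_op lambda Kldg branches _ hxi _ sf); last first.
    by move: (size_other_bands_exp (2 * D)) hB; rewrite /B0; move: (size _) (k * _)%N => i j; clear; lia.
  rewrite horner_exp horner_other_bands /mode (hat_cheb e xi _ (supp_single v0)); last first.
    by rewrite add0n (leq_trans _ hB)// ltnS /B0 -!addnA leq_addr.
  by rewrite hat_single hdotZl mulrA -rmorphM.
have v00 : hdot v0 (toC M *m v0) = 1 by rewrite /v0 (branch_ortho branches (PiN R)) eqxx.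
have proj_le1 p xi : Pi_h 1 xi -> nsq (hdot v0 (toC M *m v p xi)) <= 1.
  move=> hxi; have := onb_sqnorm (mass_sym k _) (branch_ortho branches hxi) v0.
  rewrite v00 => /(congr1 (@complex.Re R)) /= s1; rewrite [leRHS]s1.
  by rewrite (bigD1 p)//= lerDl sumr_ge0// => q _; exact: nsq_ge0.
have T0 : 0 < chebyT (1 + e) m.
  have h1 : -1 <= (1 : R) <= 1 by apply/andP; split; lra.
  by have [] := @chebyshev_filter _ r 1 m r1 h1; rewrite -/e.
pose A := (w ^+ 2) ^+ D * chebyT (1 + e) m.
have A0 : 0 < A by rewrite mulr_gt0// !exprn_gt0.
have EA : A ^+ 2 <= (2 * B).+1%:R * energy2 B a.
  rewrite (le_trans _ (mode_le_energy2 branches B ord0 a))// mode_a; last exact: PiN.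
  rewrite v00 mulr1 nsqR cosN cospi opprK [e + 1]addrC.
  rewrite /A /w -normrX ger0_norm ?sqr_ge0// -exprM //.
have Q0 : 0 < ((2 * B).+1%:R : R) by [].
have E0 : 0 < energy2 B a.
  by rewrite -(pmulr_rgt0 _ Q0) (lt_le_trans _ EA)// exprn_gt0.
split; first exact: E0.
move=> n j nN jJ.
(* Removing the Taylor polynomial changes nothing outside its range. *)
pose W j := evol0 a n j - poly_op lambda K (leapfrog_taylor z D n) a j.
have jB0 : (B0 < `|j|)%N.
  by rewrite -(ltr_nat R) (le_lt_trans B0J)// (le_lt_trans _ jJ)//; lra.
have D0 : (0 < D)%N by exact: leq_trans D2.
have D1 : D = D.-1.+1 by rewrite prednK.
have WE : evol0 a n j = W j.
  rewrite /W (supp_poly_op lambda K (d := D.-1) sa) ?subr0//.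
    by rewrite -D1 size_leapfrog_taylor.
  by rewrite (leq_ltn_trans _ jB0)// /B0 leq_add2l leq_pred.
have Bn : (m + k * (2 * D) + n <= B0 + N)%N by rewrite leq_add// leq_addr.
have BDn : (m + k * (2 * D) + n < B)%N by exact: leq_ltn_trans hB.
have [jB|Bj] := leqP `|j| B; last first.
  rewrite (supp_evol lambda K (n := n) (_ : supp (m + k * (2 * D)) (fun=> 0)) sa)//; last exact: ltn_trans Bj.
  rewrite (_ : sq 0 = 0); last by apply/eqP; rewrite sq_eq0.
  by rewrite !mulr_ge0 ?sqr_ge0 ?invr_ge0 ?exprn_ge0 ?(ltW c10) ?(ltW E0).
rewrite WE.
pose eta := (N%:R * 2 * 2^-1 ^+ D * A) ^+ 2.
have key p xi : Pi_h 1 xi -> nsq (mode v B p xi W) <= eta.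
  move=> hxi; rewrite /W modeB (mode_evol lambda Kldg branches _ hxi BDn sa).
  rewrite (mode_poly_op lambda Kldg branches _ hxi _ sa); last first.
    apply/ltnW/(leq_ltn_trans _ hB)/(leq_trans _ (leq_addr _ _)).
    by rewrite /B0 leq_add2l size_leapfrog_taylor.
  rewrite -mulrBl -rmorphB mode_a// mulrA -rmorphM nsqM nsqR /=.
  rewrite -[eta]mulr1; apply: ler_pM; rewrite ?sqr_ge0 ?nsq_ge0 ?proj_le1//.
  rewrite -real_normK ?num_real// lerXn2r ?nnegrE//.
    by rewrite !mulr_ge0 ?exprn_ge0 ?invr_ge0// ltW.
  rewrite !normrM normrX mulrA.
  have c11 : -1 <= cos xi <= 1 by rewrite cos_geN1 cos_le1.
  have nJ : n%:R <= tau * (4 * s)%:R * D%:R.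
    apply: (@le_trans _ _ N%:R); first by rewrite ler_nat.
    rewrite NJ -mulrA ler_wpM2l ?(ltW tau0)// natrM.
    have : (s%:R : R) * 2 <= s%:R * D%:R by rewrite ler_wpM2l.
    by nra.
  have := hp D n (x_ p xi) z _ (cos xi) D0 nJ (band_itv Kldg branches band_le4 p hxi) z04 hG c11
     (other_bands_le Kldg branches band_le4 p hxi) (hC0 p xi hxi) e erefl.
  move=> /le_trans; apply.
  have -> : N%:R * 2 * 2^-1 ^+ D * A = N%:R * 2 * (w ^+ 2 / 2) ^+ D * chebyT (1 + e) m.
    rewrite /A [(w ^+ 2 / 2) ^+ D]exprMn.
    by move: (2^-1 ^+ D) ((w ^+ 2) ^+ D) => x1 x2; ring.
  rewrite ler_wpM2r ?(ltW T0)// ler_wpM2r ?exprn_ge0 ?divr_ge0 ?sqr_ge0//.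
  by rewrite ler_wpM2r// ler_nat.
rewrite (le_trans (hc1 B W eta key j jB))//.
have -> : eta = 4 * N%:R ^+ 2 * 4 ^- D * A ^+ 2.
  have -> : 4 ^- D = (2^-1 ^+ D) ^+ 2 :> R.
    by rewrite -exprM mulnC exprM -exprVn; congr (_ ^+ D); field.
  by rewrite /eta; move: (2^-1 ^+ D) (A) => x1 x2; ring.
have -> : 4 * c1 * (2 * B).+1%:R * N%:R ^+ 2 * 4 ^- D * energy2 B a =
   c1 * (4 * N%:R ^+ 2 * 4 ^- D * ((2 * B).+1%:R * energy2 B a)) by ring.
by rewrite ler_wpM2l ?(ltW c10)// ler_wpM2l.
Qed.

End Packet.

(** * Growth comparison and bilinear forms *)

Section Asymptotics.
Variable R : realType.

Lemma powR_ge_eventually (r y : R) : 0 < r -> 0 <= y ->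
  exists2 J0 : R, 0 < J0 & forall J, J0 <= J -> y <= J `^ r.
Proof.
move=> r0 y0; exists (1 + y `^ r^-1) => [|J hJ].
  by rewrite ltr_pwDl// powR_ge0.
have h : y `^ r^-1 <= J by rewrite (le_trans _ hJ)// lerDr.
rewrite -[leLHS]powRr1// -(mulVf (lt0r_neq0 r0)) powRrM.
by rewrite ge0_ler_powR ?nnegrE ?powR_ge0 ?(ltW r0)// (le_trans _ h)// powR_ge0.
Qed.

(** Half of the exponent [J ln 4 / (4 s)] absorbs the power of [J], the other half
    dominates [J ^ (1 - eps)]. *)
Lemma expR_beats (P eps : R) (s : nat) : 0 < P -> 0 < eps < 1 -> (0 < s)%N ->
  exists2 J0 : R, 0 < J0 & forall (J : R) (D : nat),
    J0 <= J -> J <= 4 * s%:R * D%:R -> P * J ^+ 4 * expR (J `^ (1 - eps)) <= 4 ^+ D.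
Proof.
move=> P0 /andP[e0 e1] s0; have s0R : 0 < 4 * (s%:R : R) by rewrite mulr_gt0// ltr0n.
pose al : R := ln 4 / (4 * s%:R).
have al0 : 0 < al by rewrite divr_gt0// ln_gt0// ltr1n.
have [J1 J10 hJ1] := @powR_ge_eventually eps (2 / al) e0 (ltW (divr_gt0 (ltr0Sn R 1) al0)).
pose q := (10 / al) ^+ 5.
have q0 : 0 < q by rewrite exprn_gt0// divr_gt0.
exists (J1 + P * q) => [|J D hJ JD]; first by rewrite addr_gt0// mulr_gt0.
have JJ1 : J1 <= J by rewrite (le_trans _ hJ)// lerDl mulr_ge0 ?ltW.
have J0 : 0 < J by exact: lt_le_trans JJ1.
have hP : P * q <= J by rewrite (le_trans _ hJ)// lerDr ltW.
have E4 : expR (al * J) <= 4 ^+ D.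
  have -> : (4 : R) ^+ D = expR (D%:R * ln 4) by rewrite expRM_natl lnK// posrE.
  rewrite ler_expR /al mulrAC ler_pdivrMr// [leRHS]mulrAC [leRHS]mulrC.
  by rewrite ler_wpM2l ?ln_ge0 ?ler1n// mulrC.
apply: (le_trans _ E4).
have -> : al * J = al * J / 2 + al * J / 2 by exact: splitr.
rewrite expRD; apply: ler_pM; rewrite ?expR_ge0 ?mulr_ge0 ?exprn_ge0 ?(ltW P0) ?(ltW J0)//.
  have -> : al * J / 2 = 5%:R * (al * J / 10) by field.
  rewrite expRM_natl (@le_trans _ _ ((al * J / 10) ^+ 5))//; last first.
    have h0 : 0 <= al * J / 10 by rewrite divr_ge0// mulr_ge0 ?ltW.
    rewrite lerXn2r ?nnegrE ?expR_ge0//.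
    by rewrite (le_trans _ (expR_ge1Dx _))// lerDr.
  have -> : (al * J / 10) ^+ 5 = J ^+ 5 / q by rewrite /q; field; rewrite gt_eqF.
  have -> : J ^+ 5 = J * J ^+ 4 by rewrite exprS.
  by rewrite ler_pdivlMr// mulrAC ler_wpM2r ?exprn_ge0 ?(ltW J0).
rewrite ler_expR powRB ?(gt_eqF J0) ?implybT// powRr1 ?(ltW J0)//.
have Je0 : 0 < J `^ eps by exact: powR_gt0.
rewrite ler_pdivrMr//; have := hJ1 J JJ1; rewrite ler_pdivrMr// => h.
have := ler_wpM2l (ltW J0) h; nra.
Qed.

End Asymptotics.

Section BilinearForms.
Variables (R : realType) (k : nat) (lambda : R) (K : stencil R k).
Local Open Scope complex_scope.
Local Notation C := R[i].
Local Notation V := ('cV[C]_k.+1).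
Local Notation M := (mass k (1 : R)).
Implicit Types (U W : int -> V) (B : nat).
Hypothesis K0T : (Kzero K)^T = Kzero K.
Hypothesis KpT : Kplus K = (Kminus K)^T.
Local Notation L := (lattice_op lambda K).

Definition mform B U W : R := wsum B (fun j => complex.Re (hdot (U j) (toC M *m W j))).
Definition kform B U W : R := wsum B (fun j => complex.Re (hdot (U j) (stiff_op K W j))).

Lemma stiffB U W j : stiff_op K (fun i => U i - W i) j = stiff_op K U j - stiff_op K W j.
Proof.
by rewrite /stiff_op !mulmxBr !opprD [RHS]addrACA; congr (_ + _); rewrite addrACA.
Qed.

Lemma mformBl B U U' W : mform B (fun j => U j - U' j) W = mform B U W - mform B U' W.
Proof. by rewrite /mform /wsum -sumrB; apply: eq_bigr => i _; rewrite hdotBl raddfB. Qed.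

Lemma mformBr B U W W' : mform B U (fun j => W j - W' j) = mform B U W - mform B U W'.
Proof. by rewrite /mform /wsum -sumrB; apply: eq_bigr => i _; rewrite mulmxBr hdotBr raddfB. Qed.

Lemma kformBl B U U' W : kform B (fun j => U j - U' j) W = kform B U W - kform B U' W.
Proof. by rewrite /kform /wsum -sumrB; apply: eq_bigr => i _; rewrite hdotBl raddfB. Qed.

Lemma kformBr B U W W' : kform B U (fun j => W j - W' j) = kform B U W - kform B U W'.
Proof. by rewrite /kform /wsum -sumrB; apply: eq_bigr => i _; rewrite stiffB hdotBr raddfB. Qed.

Lemma Re_hdotC (u w : V) : complex.Re (hdot u w) = complex.Re (hdot w u).
Proof. by rewrite hdotC; case: (hdot w u). Qed.

Lemma mformC B U W : mform B U W = mform B W U.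
Proof.
apply: eq_bigr => i _; rewrite Re_hdotC hdot_toC mass_sym //.
Qed.

Lemma kformC B B' U W : (B' < B)%N -> supp B' U -> supp B' W -> kform B U W = kform B W U.
Proof.
move=> BB hU hW.
have e X Y : kform B X Y = wsum B (fun j => complex.Re (hdot (X j) (toC (Kzero K) *m Y j)))
   + wsum B (fun j => complex.Re (hdot (X j) (toC (Kminus K) *m Y (j - 1))))
   + wsum B (fun j => complex.Re (hdot (X j) (toC (Kplus K) *m Y (j + 1)))).
  rewrite /kform /wsum -!big_split; apply: eq_bigr => i _ /=.
  by rewrite /stiff_op !hdotDr !raddfD /= [X in X + _]addrC.
have swap X Y : supp B' X -> supp B' Y ->
    wsum B (fun j => complex.Re (hdot (X j) (toC (Kminus K) *m Y (j - 1)))) =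
    wsum B (fun j => complex.Re (hdot (Y j) (toC (Kplus K) *m X (j + 1)))).
  move=> hX hY; rewrite -wsum_shift; [|by rewrite hX ?hdot0l//; lia|by rewrite hX ?hdot0l//; lia].
  by apply: eq_bigr => i _; rewrite addrK Re_hdotC hdot_toC KpT.
rewrite !e (swap U W)// (swap W U)// -!addrA; congr (_ + _); last exact: addrC.
by apply: eq_bigr => i _; rewrite Re_hdotC hdot_toC K0T.
Qed.

(** [M L = lambda ^ 2 K]. *)
Lemma mform_lattice_op B U W : M \in unitmx ->
  mform B (L U) W = lambda ^+ 2 * kform B W U.
Proof.
move=> Munit; rewrite /mform /kform /wsum mulr_sumr; apply: eq_bigr => i _.
rewrite /lattice_op hdotZl hdot_toC mulmxA -toCM trmx_inv mass_sym mulVmx//.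
rewrite /toC map_mx1 mul1mx Re_hdotC; move: (hdot _ _) => [a b] /=.
by rewrite mul0r subr0.
Qed.

End BilinearForms.

(** * Energies on a mesh of size [h] *)

Section MeshEnergies.
Variables (R : realType) (k : nat) (lambda h : R) (K Kh : stencil R k).
Local Open Scope complex_scope.
Local Notation C := R[i].
Local Notation V := ('cV[C]_k.+1).
Local Notation M := (mass k (1 : R)).
Local Notation evol0 := (evol lambda K (fun=> 0)).
Local Notation dt := (lambda * h).
Implicit Types (U W : int -> V) (B : nat) (Omega : set R).
Hypotheses (lambda0 : 0 < lambda) (h0 : 0 < h).
Hypothesis Munit : M \in unitmx.
Hypothesis K0T : (Kzero K)^T = Kzero K.
Hypothesis KpT : Kplus K = (Kminus K)^T.
Hypothesis Kh_scale : forall U j, stiff_op Kh U j = (h^-1)%:C *: stiff_op K U j.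

Lemma mass_opE U j : mass_op h U j = h%:C *: (toC M *m U j).
Proof.
rewrite /mass_op massE// (massE k ltr01) mul1r scalemxAl -toCZ scalerA.
by congr (toC _ *m _).
Qed.

Lemma ell2_supp B U : supp B U -> ell2 U.
Proof.
move=> hU; rewrite /ell2 /summable (@esum_finite _ _ _ B); last 2 first.
- by move=> j; exact: abse_ge0.
- by move=> j jB; rewrite hU// hdot0l /= normr0.
rewrite (eq_bigr (fun i => (if site i \in [set: int] then
   `|complex.Re (hdot (U (site i)) (U (site i)))| else 0)%:E)); last first.
  by move=> i _; case: ifP.
by rewrite sumEFin ltry.
Qed.

Lemma scheme_evol B W : supp B W -> scheme_solution h dt Kh (evol0 W).
Proof.
move=> hW; split=> [n|n j].
  exact: (ell2_supp (supp_evol lambda K (n := n) (fun _ _ => erefl) hW)).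
rewrite mass_opE Kh_scale /evol rec2SS -!/(evol _ _ _ _).
set U' := evol0 W n.+1; set U := evol0 W n.
have cancel (a y z : V) : a - y - z - a + y = - z.
  by rewrite -addrA [- a + y]addrC addrACA subrK addrC subrK.
rewrite cancel /lattice_op -scaleN1r !scalerA -scalemxAr mulmxA -toCM mulmxV// /toC map_mx1 mul1mx.
rewrite scalerA -scalerDl (_ : _ + _ = 0) ?scale0r//.
rewrite -[-1](_ : real_complex R (-1) = _); last by rewrite rmorphN rmorph1.
rewrite -!rmorphM -rmorphD (_ : _ + _ = 0)//=.
by field; rewrite !gt_eqF.
Qed.

Lemma sqnorm_finite (S : (int -> V) -> int -> V) B Omega U : supp B U ->
  sqnorm h S Omega U =
  wsum B (fun j => if j \in [set j | Omega (Defs.center h j)]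
                 then complex.Re (hdot (U j) (S U j)) else 0).
Proof. by move=> hU; apply: zsum_finite => j jB; rewrite hU// hdot0l. Qed.

Lemma sqnorm_eq (S : (int -> V) -> int -> V) B Omega U : supp B U ->
  (forall j, ~ Omega (Defs.center h j) -> U j = 0) ->
  sqnorm h S Omega U = sqnorm h S setT U.
Proof.
move=> hU hO; rewrite !(sqnorm_finite _ _ hU); apply: eq_bigr => i _.
rewrite (@mem_set _ [set j | setT (Defs.center h j)])//.
case: ifPn => // /negP hi; rewrite hO ?hdot0l// => ho; apply: hi.
exact: mem_set.
Qed.

Lemma sqnorm_mass B U : supp B U -> sqnorm h (mass_op h) setT U = h * mform B U U.
Proof.
move=> hU; rewrite (sqnorm_finite _ _ hU) /mform /wsum mulr_sumr; apply: eq_bigr => i _.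
rewrite mem_set// mass_opE hdotZr conjc_real.
by case: (hdot _ _) => a b /=; rewrite mul0r subr0.
Qed.

Lemma sqnorm_stiff B U : supp B U -> sqnorm h (stiff_op Kh) setT U = h^-1 * kform K B U U.
Proof.
move=> hU; rewrite (sqnorm_finite _ _ hU) /kform /wsum mulr_sumr; apply: eq_bigr => i _.
rewrite mem_set// Kh_scale hdotZr conjc_real.
by case: (hdot _ _) => a b /=; rewrite mul0r subr0.
Qed.

Lemma stiffZ (c : C) U j : stiff_op K (fun i => c *: U i) j = c *: stiff_op K U j.
Proof. by rewrite /stiff_op -!scalemxAr !scalerDr. Qed.

Lemma mformZ B (c : R) U W :
  mform B (fun j => c%:C *: U j) (fun j => c%:C *: W j) = c ^+ 2 * mform B U W.
Proof.
rewrite /mform /wsum mulr_sumr; apply: eq_bigr => i _.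
rewrite -scalemxAr hdotZl hdotZr conjc_real mulrA -rmorphM.
by case: (hdot _ _) => a b /=; rewrite mul0r subr0.
Qed.

Lemma kformZ B (c : R) U W :
  kform K B (fun j => c%:C *: U j) (fun j => c%:C *: W j) = c ^+ 2 * kform K B U W.
Proof.
rewrite /kform /wsum mulr_sumr; apply: eq_bigr => i _.
rewrite stiffZ hdotZl hdotZr conjc_real mulrA -rmorphM.
by case: (hdot _ _) => a b /=; rewrite mul0r subr0.
Qed.

(** The potential part of the energy polarizes into [<U^(n+1), K U^n>]. *)
Lemma energy_setT B B' (U : nat -> int -> V) n : (B' < B)%N ->
  supp B' (U n) -> supp B' (U n.+1) ->
  energy h dt Kh setT U n = (2 * h)^-1 * (lambda ^- 2 *
    mform B (fun j => U n.+1 j - U n j) (fun j => U n.+1 j - U n j)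
    + kform K B (U n.+1) (U n)).
Proof.
move=> BB hU hU'; set d := fun j => U n.+1 j - U n j.
have BB' := ltnW BB.
have sB := suppW BB' hU; have sB' := suppW BB' hU'.
have sd : supp B' d by move=> j jB; rewrite /d hU// hU'// subrr.
have sv : supp B (velocity dt U n).
  by move=> j jB; rewrite /velocity -/(d j) (suppW BB' sd)// scaler0.
rewrite /energy (sqnorm_mass sv) !(sqnorm_stiff sv) (sqnorm_stiff sB) (sqnorm_stiff sB').
have -> : velocity dt U n = fun j => (dt^-1)%:C *: d j by [].
rewrite mformZ kformZ.
have -> : kform K B d d = kform K B (U n.+1) (U n.+1) + kform K B (U n) (U n)
   - 2 * kform K B (U n.+1) (U n).
  rewrite /d kformBl 2!(kformBr _ _ _ (U n.+1) (U n)) (kformC K0T KpT BB hU hU').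
  by move: (kform _ _ _ _) (kform _ _ _ _) (kform _ _ _ _) => x y z; ring.
move: (kform _ _ (U n.+1) (U n.+1)) (kform _ _ (U n) _) (kform _ _ (U n.+1) (U n)) (mform _ _ _).
move=> x y z t; field.
by rewrite !gt_eqF.
Qed.

(** Pairing the scheme with the centred difference [U^(n+2) - U^n]. *)
Lemma energy_step B B' U U' U'' : (B' < B)%N -> supp B' U -> supp B' U' ->
  (forall j, U'' j = 2%:R *: U' j - U j - lattice_op lambda K U' j) ->
  lambda ^- 2 * mform B (fun j => U'' j - U' j) (fun j => U'' j - U' j) + kform K B U'' U' =
  lambda ^- 2 * mform B (fun j => U' j - U j) (fun j => U' j - U j) + kform K B U' U.
Proof.
move=> BB s0 s1 hU''.
pose d j := U' j - U j; pose l := lattice_op lambda K U'.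
have e2 : U'' = fun j => U' j - (l j - d j).
  apply/funext => j; rewrite hU'' -/(l j) scaler_nat mulr2n /d !opprB.
  by rewrite -!addrA; congr (_ + _); rewrite [RHS]addrC -!addrA.
have dE : (fun j => U'' j - U' j) = fun j => d j - l j.
  by apply/funext => j; rewrite e2 addrAC subrr add0r opprB.
have sd : supp B' d by move=> j jB; rewrite /d s0// s1// subrr.
rewrite dE (mformBl B d l) (mformBr B d d l) (mformBr B l d l) (mformC B d l).
rewrite (@mform_lattice_op R k lambda K B U' d Munit) (@mform_lattice_op R k lambda K B U' l Munit).
rewrite e2 (kformBl _ _ U' (fun j => l j - d j)) (kformBl _ _ l d).
rewrite [kform K B U' U](kformC K0T KpT BB s1 s0).
have -> : U = fun j => U' j - d j by apply/funext => j; rewrite /d opprB addrCA subrr addr0.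
rewrite (kformBl _ _ U' d).
have -> : (fun j => U' j - (U' j - d j)) = d.
  by apply/funext => j; rewrite opprB addrCA subrr addr0.
move: (kform _ _ U' _) (kform _ _ l _) (kform _ _ d _) (mform _ _ _) => x y z t.
by field; rewrite gt_eqF.
Qed.

Lemma energy_conserved B B' W n : (B' + n.+1 < B)%N -> supp B' W ->
  energy h dt Kh setT (evol0 W) n = energy h dt Kh setT (evol0 W) 0.
Proof.
move=> + hW; elim: n => [//|n IHn] BB.
transitivity (energy h dt Kh setT (evol0 W) n); last first.
  by apply: IHn; rewrite (leq_ltn_trans _ BB)// leq_add2l.
have s i : supp (B' + i) (evol0 W i) by exact: supp_evol.
have s0 : supp (B' + n.+2) (evol0 W n) by apply: suppW (s n); rewrite leq_add2l ltnW.
have s1 : supp (B' + n.+2) (evol0 W n.+1) by apply: suppW (s n.+1); rewrite leq_add2l.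
have s2 := s n.+2.
rewrite (@energy_setT B _ (evol0 W) n.+1 BB s1 s2) (@energy_setT B _ (evol0 W) n BB s0 s1).
have hs j : evol0 W n.+2 j =
    2%:R *: evol0 W n.+1 j - evol0 W n j - lattice_op lambda K (evol0 W n.+1) j.
  by rewrite [in LHS]/evol rec2SS.
by rewrite (energy_step BB s0 s1 hs).
Qed.

End MeshEnergies.

(** * Bounds on the restricted energies *)

Section EnergyBounds.
Variables (R : realType) (k : nat) (lambda : R) (K : stencil R k).
Local Open Scope complex_scope.
Local Notation C := R[i].
Local Notation V := ('cV[C]_k.+1).
Local Notation M := (mass k (1 : R)).
Local Notation evol0 := (evol lambda K (fun=> 0)).
Implicit Types (U W : int -> V) (B : nat) (Omega : set R).
Hypothesis lambda0 : 0 < lambda.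

Definition scaled (h : R) (Kh : stencil R k) : Prop :=
  forall U j, stiff_op Kh U j = (h^-1)%:C *: stiff_op K U j.

Lemma sqnorm_le (h : R) (S : (int -> V) -> int -> V) B Omega U be : supp B U -> 0 <= be ->
  (forall j, Omega (Defs.center h j) -> `|complex.Re (hdot (U j) (S U j))| <= be) ->
  `|sqnorm h S Omega U| <= (2 * B).+1%:R * be.
Proof.
move=> hU be0 hO; rewrite (sqnorm_finite _ _ _ hU) /wsum (le_trans (ler_norm_sum _ _ _))//.
have -> : (2 * B).+1%:R * be = \sum_(i < (2 * B).+1) be.
  by rewrite sumr_const card_ord -[RHS]mulr_natl.
apply: ler_sum => i _; case: ifPn => [hi|_]; last by rewrite normr0.
by apply: hO; have := set_mem hi.
Qed.

Lemma mass_le : exists2 c : R, 0 <= c & forall u : V,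
  `|complex.Re (hdot u (toC M *m u))| <= c * sq u.
Proof.
have [c c0 hc] := sq_mulmx M.
exists (2^-1 * (1 + c)) => [|u]; first by rewrite mulr_ge0// addr_ge0.
rewrite (le_trans (Re_hdot_le _ _))// -mulrA ler_wpM2l// mulrDl mul1r lerD2l.
exact: hc.
Qed.

Lemma stiff_le : exists2 c : R, 0 <= c & forall U j eta,
  sq (U (j - 1)) <= eta -> sq (U j) <= eta -> sq (U (j + 1)) <= eta ->
  `|complex.Re (hdot (U j) (stiff_op K U j))| <= c * eta.
Proof.
have [c1 c10 h1] := sq_mulmx (Kminus K).
have [c2 c20 h2] := sq_mulmx (Kzero K).
have [c3 c30 h3] := sq_mulmx (Kplus K).
exists (2^-1 * (1 + 4 * (c1 + c2 + c3))) => [|U j eta e1 e2 e3].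
  by rewrite mulr_ge0// addr_ge0// mulr_ge0// !addr_ge0.
rewrite (le_trans (Re_hdot_le _ _))// -mulrA ler_wpM2l// mulrDl mul1r lerD//.
rewrite /stiff_op.
have := sqD (toC (Kminus K) *m U (j - 1) + toC (Kzero K) *m U j) (toC (Kplus K) *m U (j + 1)).
have := sqD (toC (Kminus K) *m U (j - 1)) (toC (Kzero K) *m U j).
have := le_trans (h1 (U (j - 1))) (ler_wpM2l c10 e1).
have := le_trans (h2 (U j)) (ler_wpM2l c20 e2).
have := le_trans (h3 (U (j + 1))) (ler_wpM2l c30 e3).
have := sq_ge0 (toC (Kplus K) *m U (j + 1)).
move: (sq _) (sq _) (sq _) (sq _) (sq _) => x y z t u; lra.
Qed.

Let collect (a b c d x y z : R) : a <= x -> b <= y -> c <= y -> d <= y -> 0 <= z ->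
  2^-1 * a + 4^-1 * c + 4^-1 * b + d <= z + 2^-1 * x + 3 / 2 * y.
Proof. by clear; lra. Qed.

(** The restricted energy is not a sum of squares, but it is dominated by the
    values of two consecutive steps on the observed cells and their
    neighbours. *)
Lemma energy_le : exists2 c : R, 0 < c & forall (h : R) (Kh : stencil R k) Omega
    (U : nat -> int -> V) B n eta,
  0 < h -> scaled h Kh -> 0 <= eta -> supp B (U n) -> supp B (U n.+1) ->
  (forall j i, Omega (Defs.center h j) -> (`|(i - j)%R| <= 1)%N ->
     sq (U n i) <= eta /\ sq (U n.+1 i) <= eta) ->
  `|energy h (lambda * h) Kh Omega U n| <= (2 * B).+1%:R * (c * h^-1 * eta).
Proof.
have [cM cM0 hM] := mass_le; have [cK cK0 hK] := stiff_le.
have l2 : 0 < lambda ^- 2 by rewrite invr_gt0 exprn_gt0.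
exists (1 + 2 * cM * lambda ^- 2 + 3 / 2 * cK).
  by rewrite ltr_wpDr ?ltr_wpDr ?mulr_ge0// ltW.
move=> h Kh Omega U B n eta h0 hKh eta0 sB sB' hO.
pose dt := lambda * h.
have dt0 : 0 < dt by rewrite mulr_gt0.
have sv : supp B (velocity dt U n).
  by move=> j jB; rewrite /velocity sB// sB'// subrr scaler0.
have i0 : 0 <= h^-1 by rewrite invr_ge0 ltW.
have nb j : [/\ (`|(j - j)%R| <= 1)%N, (`|(j - 1 - j)%R| <= 1)%N & (`|(j + 1 - j)%R| <= 1)%N].
  by clear; split; lia.
have v4 j i : Omega (Defs.center h j) -> (`|(i - j)%R| <= 1)%N ->
    sq (velocity dt U n i) <= dt ^- 2 * (4 * eta).
  move=> hj hi; have [e1 e2] := hO j i hj hi.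
  rewrite /velocity sqZ nsqR -exprVn ler_wpM2l ?sqr_ge0//.
  rewrite (le_trans (sqD _ _))// -scaleN1r sqZ (_ : nsq (-1) = 1) ?mul1r; last first.
    by rewrite /nsq /=; ring.
  by move: (sq _) (sq _) e1 e2 => x y; lra.
have bM : `|sqnorm h (mass_op h) Omega (velocity dt U n)| <=
    (2 * B).+1%:R * (4 * cM * lambda ^- 2 * h^-1 * eta).
  apply: sqnorm_le => [//||j hj]; first by rewrite !mulr_ge0// ltW.
  have [n0 _ _] := nb j.
  rewrite mass_opE// hdotZr conjc_real.
  have -> : complex.Re (h%:C * hdot (velocity dt U n j) (toC M *m velocity dt U n j)) =
     h * complex.Re (hdot (velocity dt U n j) (toC M *m velocity dt U n j)).
    by case: (hdot _ _) => a b /=; rewrite mul0r subr0.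
  rewrite normrM gtr0_norm//.
  apply: (@le_trans _ _ (h * (cM * (dt ^- 2 * (4 * eta))))).
    by rewrite ler_wpM2l ?(ltW h0)// (le_trans (hM _))// ler_wpM2l// (v4 j j).
  rewrite le_eqVlt; apply/orP; left; apply/eqP; rewrite /dt; field.
  by rewrite !gt_eqF.
have bK W be : supp B W -> 0 <= be -> (forall j i, Omega (Defs.center h j) ->
      (`|(i - j)%R| <= 1)%N -> sq (W i) <= be) ->
    `|sqnorm h (stiff_op Kh) Omega W| <= (2 * B).+1%:R * (h^-1 * (cK * be)).
  move=> sW be0 hW; apply: sqnorm_le => [//||j hj]; first by rewrite !mulr_ge0.
  have [n0 n1 n2] := nb j.
  rewrite hKh hdotZr conjc_real.
  have -> : complex.Re ((h^-1)%:C * hdot (W j) (stiff_op K W j)) =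
     h^-1 * complex.Re (hdot (W j) (stiff_op K W j)).
    by case: (hdot _ _) => a b /=; rewrite mul0r subr0.
  rewrite normrM ger0_norm// ler_wpM2l//.
  by apply: hK; apply: (hW j).
have b1 := bK (U n) eta sB eta0 (fun j i hj hi => proj1 (hO j i hj hi)).
have b2 := bK (U n.+1) eta sB' eta0 (fun j i hj hi => proj2 (hO j i hj hi)).
have d0 : 0 <= dt ^- 2 * (4 * eta).
  by rewrite mulr_ge0 ?invr_ge0 ?sqr_ge0// mulr_ge0.
have b3 := bK (velocity dt U n) _ sv d0 v4.
rewrite /energy -/dt; move: bM b1 b2 b3.
set Q := _.+1%:R; set a := sqnorm _ _ _ _; set b := sqnorm _ _ _ (U n).
set c := sqnorm _ _ _ (U n.+1); set d := sqnorm _ _ _ (velocity _ _ _).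
have Q0 : 0 <= Q by rewrite /Q.
move=> bM b1 b2 b3.
have b3' : `|dt ^+ 2 / 4 * d| <= Q * (h^-1 * (cK * eta)).
  rewrite normrM ger0_norm ?divr_ge0 ?sqr_ge0//.
  rewrite (le_trans (ler_wpM2l _ b3)) ?divr_ge0 ?sqr_ge0//.
  rewrite le_eqVlt; apply/orP; left; apply/eqP; field.
  by rewrite !gt_eqF.
have tri (p1 p2 p3 p4 : R) : `|2^-1 * p1 + 4^-1 * p2 + 4^-1 * p3 - p4| <=
    2^-1 * `|p1| + 4^-1 * `|p2| + 4^-1 * `|p3| + `|p4|.
  have n2 (p : R) : `|2^-1 * p| = 2^-1 * `|p| by rewrite normrM ger0_norm.
  have n4 (p : R) : `|4^-1 * p| = 4^-1 * `|p| by rewrite normrM ger0_norm.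
  rewrite (le_trans (ler_normB _ _))// lerD2r -n2 -!n4 (le_trans (ler_normD _ _))//.
  by rewrite lerD2r ler_normD.
apply: (le_trans (tri a c b (dt ^+ 2 / 4 * d))).
have : 0 <= Q * (h^-1 * eta) by rewrite !mulr_ge0.
have -> : Q * ((1 + 2 * cM * lambda ^- 2 + 3 / 2 * cK) * h^-1 * eta) =
  Q * (h^-1 * eta) + 2^-1 * (Q * (4 * cM * lambda ^- 2 * h^-1 * eta)) + 3 / 2 * (Q * (h^-1 * (cK * eta))).
  by field; rewrite !gt_eqF.
by move=> hz; exact: (collect bM b1 b2 b3' hz).
Qed.

End EnergyBounds.

(** * The cost of observability *)

Section Observability.
Variables (R : realType) (k : nat) (lambda T : R) (K : R -> stencil R k).
Variables (sigma : R -> 'I_k.+1 -> R -> R) (v : R -> 'I_k.+1 -> R -> 'cV[R[i]]_k.+1).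
Local Open Scope complex_scope.
Local Notation C := R[i].
Local Notation V := ('cV[C]_k.+1).
Local Notation M := (mass k (1 : R)).
Local Notation K1 := (K 1).
Local Notation evol0 := (evol lambda K1 (fun=> 0)).
Local Notation Omega := (~` `[(-1 : R), 1]).
Hypotheses (lambda0 : 0 < lambda) (T0 : 0 < T).
Hypothesis Kldg : forall h : R, 0 < h -> ldg_stencil h (K h).
Hypothesis branches : forall h : R, 0 < h -> eigen_branches h (K h) (sigma h) (v h).
Hypothesis A1 : forall h : R, 0 < h ->
  sup (sigma h ord0 @` Pi_h h) < 4 / (lambda * h) ^+ 2.
Hypothesis A2 : forall (h : R) (i : 'I_k), 0 < h ->
  sup (sigma h (lift ord0 i) @` Pi_h h) <= 4 / (lambda * h) ^+ 2.

Let Kldg1 : ldg_stencil 1 K1. Proof. exact: Kldg. Qed.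
Let branches1 : eigen_branches 1 K1 (sigma 1) (v 1). Proof. exact: branches. Qed.
Let Munit : M \in unitmx. Proof. exact: mass1_unit branches1. Qed.

(** The gradient blocks do not depend on [h] and the mass matrix scales like [h]. *)
Lemma stencil_scale (h : R) : 0 < h -> scaled K1 h (K h).
Proof.
move=> h0 U j; have M0u := refmass_unit branches1.
rewrite (ldg_stencilP h0 M0u (Kldg h0)) (ldg_stencilP ltr01 M0u Kldg1).
rewrite /stiff_op /ref_stencil /= !divr1.
have e (A : 'M[R]_k.+1) : toC ((2 / h) *: A) = (h^-1)%:C *: toC (2 *: A).
  by rewrite -toCZ scalerA mulrC.
by rewrite !e -!scalemxAl !scalerDr.
Qed.

(** The suprema over the bands are finite because the symbol is bounded. *)
Lemma sigma1_le_sup p xi : Pi_h 1 xi -> sigma 1 p xi <= sup (sigma 1 p @` Pi_h 1).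
Proof.
move=> hxi; apply: ub_le_sup; last by exists xi.
have [c1 c10 hc] := onb_coercive (mass_sym k _) (branch_ortho branches1 (PiN R)).
have [c2 c20 h2] := sq_mulmx (Kminus K1).
have [c3 c30 h3] := sq_mulmx (Kzero K1).
have [c4 c40 h4] := sq_mulmx (Kplus K1).
exists (2^-1 * (1 + 4 * (c2 + c3 + c4)) * c1) => _ [y hy <-].
set u := v 1 p y.
have su : sq u <= c1.
  by rewrite (le_trans (hc u))// (branch_ortho branches1 hy) eqxx mulr1.
have -> : sigma 1 p y = complex.Re (hdot (symbol 1 K1 y *m u) u).
  rewrite (branch_eq branches1 p hy) hdotZl hdotC (branch_ortho branches1 hy) eqxx.
  by rewrite rmorph1 mulr1.
rewrite (le_trans (ler_norm _))// (le_trans (Re_hdot_le _ _))// -mulrA ler_wpM2l//.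
rewrite (@le_trans _ _ ((1 + 4 * (c2 + c3 + c4)) * sq u))//; last first.
  by rewrite ler_wpM2l// addr_ge0// mulr_ge0// !addr_ge0.
rewrite mulrDl mul1r [leLHS]addrC lerD2l symbolE.
have z1 (t : R) (w : V) : sq (cis t *: w) = sq w by rewrite sqZ nsq_cis mul1r.
rewrite (le_trans (sqD _ _))// z1.
have := sqD (toC (Kzero K1) *m u) (cis (- y) *: (toC (Kminus K1) *m u)); rewrite z1.
have := h2 u; have := h3 u; have := h4 u.
have := sq_ge0 (toC (Kplus K1) *m u).
move: (sq (_ + _)) (sq (toC (Kminus K1) *m u)) (sq (toC (Kzero K1) *m u)) (sq (toC (Kplus K1) *m u)) (sq u).
by move=> a1 a2 a3 a4 a5; lra.
Qed.

Let band_lt4 xi : Pi_h 1 xi -> band lambda (sigma 1) ord0 xi < 4.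
Proof.
move=> hxi; have := le_lt_trans (sigma1_le_sup ord0 hxi) (A1 ltr01).
by rewrite mulr1 ltr_pdivlMr ?exprn_gt0// mulrC.
Qed.

Let band_le4 p xi : Pi_h 1 xi -> band lambda (sigma 1) p xi <= 4.
Proof.
move=> hxi; case: (unliftP ord0 p) => [i ->|->]; last exact/ltW/band_lt4.
have := le_trans (sigma1_le_sup (lift ord0 i) hxi) (A2 i ltr01).
by rewrite mulr1 ler_pdivlMr ?exprn_gt0// mulrC.
Qed.

Let K0T : (Kzero K1)^T = Kzero K1. Proof. exact: (Kzero_tr Kldg1 branches1). Qed.
Let KpT : Kplus K1 = (Kminus K1)^T. Proof. exact: (Kplus_tr Kldg1 branches1). Qed.

Lemma energy_start (h : R) B B' W : 0 < h -> (B' < B)%N -> supp B' W ->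
  energy h (lambda * h) (K h) setT (evol0 W) 0 =
  (2 * h)^-1 * (lambda ^- 2 * energy2 B W).
Proof.
move=> h0 BB hW.
rewrite (energy_setT lambda0 h0 K0T KpT (stencil_scale h0) BB)//=.
rewrite [kform _ _ _ _](_ : _ = 0) ?addr0; last first.
  rewrite /kform /wsum big1// => i _.
  by rewrite /stiff_op !mulmx0 !addr0 hdot0r.
congr (_ * (_ * _)); apply: eq_bigr => i _.
by rewrite /evol /= subr0.
Qed.

Lemma evol_translate W (m : int) n j :
  evol0 (fun i => W (i - m)) n j = evol0 W n (j - m).
Proof.
have L_tr U i : lattice_op lambda K1 (fun l => U (l - m)) i = lattice_op lambda K1 U (i - m).
  by rewrite /lattice_op /stiff_op [i + 1 - m]addrAC [i - 1 - m]addrAC.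
suff h : evol0 (fun i => W (i - m)) n = fun j => evol0 W n (j - m) by rewrite h.
have evSS X l : evol0 X l.+2 =
    fun i => 2%:R *: evol0 X l.+1 i - evol0 X l i - lattice_op lambda K1 (evol0 X l.+1) i.
  by rewrite {1}/evol rec2SS.
elim/nat_ind2: n => [||n IH1 IH2]; [by []|by []|].
by rewrite !evSS IH1 IH2; apply/funext => i; rewrite L_tr.
Qed.

(** A packet released far from [[-1, 1]] is observed in full, since the scheme
    propagates by one cell per step. *)
Lemma observable_gt0 (h : R) N CT : 0 < h -> N%:R * (lambda * h) = T ->
  observable h (lambda * h) (K h) Omega N CT -> 0 < CT.
Proof.
move=> h0 NT obs; pose v0 := v 1 ord0 (- pi).
have [m0 hm0] : exists m0 : nat, 1 < m0%:R * h.
  exists (Num.bound h^-1); rewrite -ltr_pdivrMr// mul1r.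
  by apply: archi_boundP; rewrite invr_ge0 ltW.
pose m := (N + m0)%N; pose W j := single v0 (j - m%:Z).
have sW : supp m W.
  by move=> j jm; rewrite /W /single; case: eqP => // hj; move: jm hj; clear; lia.
pose B := (m + N.+1)%N.
have sU n : supp (m + n) (evol0 W n) by exact: supp_evol.
have sUB n : (n <= N)%N -> supp B (evol0 W n).
  by move=> nN; apply: suppW (sU n); rewrite leq_add2l leqW.
have mB : (m < B)%N by rewrite /B addnS ltnS leq_addr.
have zero n j : (n <= N)%N -> ~ Omega (Defs.center h j) -> evol0 W n j = 0.
  move=> nN hj; have jm0 : (j < m0%:Z)%R.
    rewrite ltNge; apply/negP => mj; apply: hj => /= hj.
    move: hj; rewrite in_itv /= => /andP[_]; rewrite leNgt => /negP; apply.
    apply: (lt_le_trans hm0); rewrite /Defs.center ler_pM2r//.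
    by rewrite -(ler_int R) in mj.
  rewrite /W evol_translate.
  have s0 : supp (0 + n) (evol0 (single v0) n).
    by apply: supp_evol => //; exact: supp_single.
  by apply: s0; move: jm0 nN; rewrite /m; clear; lia.
have E n : (n < N)%N -> energy h (lambda * h) (K h) Omega (evol0 W) n =
    energy h (lambda * h) (K h) setT (evol0 W) 0.
  move=> nN; have nN' := ltnW nN.
  rewrite -(energy_conserved lambda0 h0 Munit K0T KpT (stencil_scale h0) (B := B.+1) (n := n) _ sW); last first.
    by rewrite /B ltnS leq_add2l ltnW.
  have sv : supp B (velocity (lambda * h) (evol0 W) n).
    by move=> j jB; rewrite /velocity !sUB// subrr scaler0.
  have zv j : ~ Omega (Defs.center h j) -> velocity (lambda * h) (evol0 W) n j = 0.
    by move=> hj; rewrite /velocity !zero// subrr scaler0.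
  rewrite /energy !(sqnorm_eq _ sv zv).
  rewrite (sqnorm_eq _ (sUB _ nN) (fun j => @zero _ j nN)).
  by rewrite (sqnorm_eq _ (sUB _ nN') (fun j => @zero _ j nN')).
have E0 : 0 < energy h (lambda * h) (K h) setT (evol0 W) 0.
  rewrite (energy_start h0 mB sW) !mulr_gt0 ?invr_gt0 ?mulr_gt0 ?exprn_gt0//.
  rewrite (lt_le_trans ltr01)//.
  have e1 : complex.Re (hdot (W m%:Z) (toC M *m W m%:Z)) = 1.
    rewrite /W subrr /single eqxx /v0 (branch_ortho branches1 (PiN R)) eqxx //.
  rewrite -e1; apply: (wsum_ge (f := fun j => complex.Re (hdot (W j) (toC M *m W j)))); last first.
    exact: ltnW.
  move=> i; rewrite (onb_sqnorm (mass_sym k _) (branch_ortho branches1 (PiN R))) /=.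
  by apply: sumr_ge0 => p _; exact: nsq_ge0.
have := obs _ (scheme_evol lambda0 h0 Munit (stencil_scale h0) sW).
rewrite big_mkord (eq_bigr (fun=> energy h (lambda * h) (K h) setT (evol0 W) 0)); last first.
  by move=> n _; exact: E.
rewrite sumr_const card_ord -mulr_natl [_ * (_ * energy _ _ _ _ _ _)]mulrA [_ * N%:R]mulrC NT.
set e := energy _ _ _ _ _ _ in E0 *; rewrite leNgt => /negP he.
rewrite ltNge; apply/negP => CT0; apply: he.
by rewrite (le_lt_trans _ E0)// mulr_le0_ge0// mulr_ge0// ltW.
Qed.

(** The solution of [lattice_packet] is tested in the observability inequality.
    Both sides carry the same power of [h], and the lost factors are powers of
    [1 / h]. *)
Theorem exponential_observability_cost (eps : R) : 0 < eps < 1 ->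
  exists2 J0 : R, 0 < J0 & forall (h : R) (N : nat) (CT : R), 0 < h -> J0 <= h^-1 ->
    N%:R * (lambda * h) = T -> observable h (lambda * h) (K h) Omega N CT ->
    expR (h^-1 `^ (1 - eps)) <= CT.
Proof.
move=> heps; pose tau := T / lambda.
have tau0 : 0 < tau by rewrite divr_gt0.
have [s [c [s0 c0 packet]]] :=
  lattice_packet Kldg1 branches1 lambda0 tau0 band_le4 (band_lt4 (PiN R)).
have [c2 c20 hE] := energy_le K1 lambda0.
pose q := 2 * tau + 5.
have q0 : 0 < q by rewrite addr_gt0// mulr_gt0.
pose P := 2 * lambda ^+ 2 * T * c2 * c * q ^+ 2 * tau ^+ 2.
have P0 : 0 < P.
  by rewrite /P; do ![apply: mulr_gt0] => //; rewrite invr_gt0.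
have [J1 J10 hJ1] := expR_beats P0 heps s0.
have s0R : 1 <= (s%:R : R) by rewrite ler1n.
exists (J1 + 4 * s%:R) => [|h N CT h0 hJ NT obs].
  by rewrite addr_gt0// mulr_gt0// (lt_le_trans ltr01).
pose J := h^-1; have J0 : 0 < J by rewrite invr_gt0.
have JJ1 : J1 <= J by rewrite (le_trans _ hJ)// lerDl mulr_ge0.
have Js : 4 * s%:R <= J by rewrite (le_trans _ hJ)// lerDr ltW.
have J1' : 1 <= J by rewrite (le_trans _ Js)//; lra.
have NJ : N%:R = tau * J.
  by rewrite /tau /J -NT; field; rewrite !gt_eqF.
have [a [B0 [D [sa B0J JD hB]]]] := packet J N Js NJ.
pose B := (B0 + N).+1.
have [E0 small] := hB B (ltnSn _).
set E := energy2 B a in E0 small.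
have CT0 := observable_gt0 h0 NT obs.
pose eta := c * (2 * B).+1%:R * N%:R ^+ 2 * 4 ^- D * E.
have eta0 : 0 <= eta.
  by rewrite !mulr_ge0 ?sqr_ge0 ?invr_ge0 ?exprn_ge0 ?(ltW c0) ?(ltW E0).
have sU n : (n <= N)%N -> supp B (evol0 a n).
  move=> nN; apply: (@suppW _ _ (B0 + n)); first by rewrite /B leqW// leq_add2l.
  exact: supp_evol.
have bound n : (n < N)%N ->
    energy h (lambda * h) (K h) Omega (evol0 a) n <= (2 * B).+1%:R * (c2 * J * eta).
  move=> nN; rewrite (le_trans (ler_norm _))//.
  apply: (hE h (K h) Omega (evol0 a) B n eta h0 (stencil_scale h0) eta0).
  - exact/sU/ltnW.
  - exact: sU.
  move=> j i hj ij.
  have jJ : J < `|j|%N%:R.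
    rewrite ltNge; apply/negP => jJ; apply: hj; rewrite /= in_itv /= -ler_norml.
    rewrite /Defs.center normrM (gtr0_norm h0) -ler_pdivlMr// mul1r -/J.
    by rewrite -intr_norm -abszE.
  have iJ : J - 1 < `|i|%N%:R.
    rewrite ltrBlDr (lt_le_trans jJ)// natr1 ler_nat.
    by move: ij; clear; lia.
  by split; apply: small => //; exact: ltnW.
have obsa := obs _ (scheme_evol lambda0 h0 Munit (stencil_scale h0) sa).
have BB0 : (B0 < B)%N by rewrite /B ltnS leq_addr.
rewrite (energy_start h0 BB0 sa) -/E in obsa.
have sum_le : \sum_(0 <= n < N) energy h (lambda * h) (K h) Omega (evol0 a) n <=
    N%:R * ((2 * B).+1%:R * (c2 * J * eta)).
  rewrite big_mkord mulr_natl -[X in _ <= _ *+ X]card_ord -sumr_const.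
  by apply: ler_sum => n _; exact: bound.
have key : lambda ^- 2 * E <= 2 * CT * T * (2 * B).+1%:R * c2 * eta.
  have h1 : (2 * h)^-1 * (lambda ^- 2 * E) <=
      CT * (lambda * h * (N%:R * ((2 * B).+1%:R * (c2 * J * eta)))).
    rewrite (le_trans obsa)// ler_wpM2l ?(ltW CT0)// ler_wpM2l//.
    by rewrite mulr_ge0// ltW.
  have h2 : 0 <= 2 * h by rewrite mulr_ge0// ltW.
  have := ler_wpM2l h2 h1; rewrite mulVKf; last by rewrite gt_eqF// mulr_gt0.
  move=> /le_trans; apply; rewrite le_eqVlt; apply/orP; left; apply/eqP.
  by rewrite -NT /J; field; rewrite gt_eqF.
have QJ : (2 * B).+1%:R <= q * J.
  have -> : (2 * B).+1%:R = 2 * (B0%:R + N%:R + 1) + 1 :> R.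
    by rewrite -natrD !natr1 -natrM natr1.
  by rewrite NJ /q; move: B0J J1'; move: (B0%:R : R) => b; nra.
have D4 : 0 < (4 : R) ^+ D by rewrite exprn_gt0.
have main : 4 ^+ D <= P * J ^+ 4 * CT.
  have Q0 : 0 <= ((2 * B).+1%:R : R) by [].
  have QQ : (2 * B).+1%:R ^+ 2 <= (q * J) ^+ 2.
    by rewrite lerXn2r ?nnegrE// (le_trans Q0).
  have h1 : 4 ^+ D * E <= lambda ^+ 2 * 2 * CT * T * c2 * c * N%:R ^+ 2 * (2 * B).+1%:R ^+ 2 * E.
    have := ler_wpM2l (ltW (mulr_gt0 D4 (exprn_gt0 2 lambda0))) key.
    rewrite (_ : 4 ^+ D * lambda ^+ 2 * (lambda ^- 2 * E) = 4 ^+ D * E); last first.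
      by rewrite -mulrA mulVKf// expf_neq0// gt_eqF.
    move=> /le_trans; apply; rewrite le_eqVlt; apply/orP; left; apply/eqP.
    rewrite /eta.
    by move: (2 * B).+1%:R (N%:R : R) (E) => x y z; field; rewrite gt_eqF.
  rewrite ler_pM2r// in h1; apply: (le_trans h1).
  have -> : P * J ^+ 4 * CT =
      lambda ^+ 2 * 2 * CT * T * c2 * c * (tau * J) ^+ 2 * (q * J) ^+ 2 by rewrite /P; ring.
  rewrite NJ; apply: ler_wpM2l => //; apply/ltW.
  by do ![apply: mulr_gt0] => //; rewrite invr_gt0.
have PJ0 : 0 < P * J ^+ 4 by rewrite mulr_gt0// exprn_gt0.
by rewrite -(ler_pM2l PJ0) (le_trans (hJ1 J D JJ1 JD)).
Qed.

End Observability.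

Theorem theorem3p5 (R : realType) :
  exists (C13 : nat -> R -> R -> R) (C4 : nat -> R -> R -> R),
  forall (k : nat) (lambda T eps : R)
         (K : R -> stencil R k)
         (sigma : R -> 'I_k.+1 -> R -> R)
         (v : R -> 'I_k.+1 -> R -> 'cV[R[i]]_k.+1)
         (gamma : R) (xi_c : R -> R),
  let Omega : set R := ~` `[-1, 1] in
  0 < lambda -> 0 < T -> 0 < eps < 1 ->
  (forall h : R, 0 < h -> ldg_stencil h (K h)) ->
  (forall h : R, 0 < h -> eigen_branches h (K h) (sigma h) (v h)) ->
  (* wave packet parameters *)
  0 < gamma < 1 ->
  (forall h : R, 0 < h -> 0 < xi_c h < pi / h) ->
  h * xi_c h @[h --> 0^'+] --> (pi : R) ->
  (* (A1) *)
  (forall h : R, 0 < h ->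
     sup (sigma h ord0 @` Pi_h h) < 4 / (lambda * h) ^+ 2) ->
  (* (A2) *)
  (forall (h : R) (i : 'I_k), 0 < h ->
     sup (sigma h (lift ord0 i) @` Pi_h h) <= 4 / (lambda * h) ^+ 2) ->
  ~ uniformly_observable lambda K Omega T /\
  exists s : R, [/\ 1 < s, 0 < C13 k T s, 0 < C4 k lambda s &
    \forall h \near 0^'+,
      (* (A3) *)
      xi_c h + h `^ (- gamma) < pi / h ->
      forall N : nat, N%:R * (lambda * h) = T ->
      forall C_T : R, observable h (lambda * h) (K h) Omega N C_T ->
        C13 k T s * expR (C4 k lambda s / h `^ (1 - eps)) <= C_T].
Proof.
exists (fun _ _ _ => 1), (fun _ _ _ => 1).
move=> k lambda T eps K sigma v gamma xi_c Omega lambda0 T0 heps Kldg branches _ _ _ A1 A2.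
have [J0 J00 main] :=
  exponential_observability_cost lambda0 T0 Kldg branches A1 A2 heps.
have /andP[eps0 eps1] := heps.
split.
- move=> [C [C0 [r /= r0 hC]]].
  have e10 : 0 < 1 - eps by rewrite subr_gt0.
  have [J2 J20 hJ2] := powR_ge_eventually e10 (ltW C0).
  pose Jmin := J0 + J2 + r^-1.
  have Jmin0 : 0 < Jmin by rewrite !addr_gt0 ?invr_gt0.
  pose N := Num.bound (T / lambda * Jmin).
  have hN : T / lambda * Jmin < N%:R.
    by apply: archi_boundP; rewrite mulr_ge0 ?divr_ge0 ?ltW.
  have N0 : 0 < (N%:R : R) by rewrite (le_lt_trans _ hN)// mulr_ge0 ?divr_ge0 ?ltW.
  pose h := T / (lambda * N%:R).
  have h0 : 0 < h by rewrite divr_gt0// mulr_gt0.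
  have hJ : Jmin < h^-1.
    rewrite /h invf_div ltr_pdivlMr// [lambda * _]mulrC -ltr_pdivrMr//.
    by rewrite (mulrC Jmin) mulrAC.
  have NT : N%:R * (lambda * h) = T by rewrite /h; field; rewrite !gt_eqF.
  have hr : h < r.
    rewrite -[r]invrK -[h]invrK ltf_pV2 ?posrE ?invr_gt0// (le_lt_trans _ hJ)//.
    by rewrite /Jmin lerDr addr_ge0// ltW.
  have obs : observable h (lambda * h) (K h) Omega N C.
    by apply: hC => //; rewrite /= sub0r normrN gtr0_norm.
  have hJ0 : J0 <= h^-1.
    by rewrite (le_trans _ (ltW hJ))// /Jmin -addrA lerDl addr_ge0 ?invr_ge0 ?ltW.
  have hJ2' : J2 <= h^-1.
    by rewrite (le_trans _ (ltW hJ))// /Jmin -addrA addrCA lerDl addr_ge0 ?invr_ge0 ?ltW.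
  have := main h N C h0 hJ0 NT obs; rewrite leNgt => /negP; apply.
  rewrite (lt_le_trans _ (expR_ge1Dx _))// (le_lt_trans (hJ2 _ hJ2'))// ltrDr.
  exact: ltr01.
- exists 2; split; rewrite ?ltr01 ?ltr1n//.
  near=> h => _ N NT CT obs; have h0 : 0 < h by near: h; exact: nbhs_right_gt.
  rewrite !mul1r -powRN -mulN1r powRrM powR_inv1 ?(ltW h0)//.
  apply: main NT obs => //.
  rewrite -[J0]invrK lef_pV2 ?posrE ?invr_gt0//; apply/ltW.
  by near: h; apply: nbhs_right_lt; rewrite invr_gt0.
Unshelve. all: by end_near.
Qed.
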